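(* Let $N\ge2$ and $\rho>1$. There exists a Cantor set $X$ in $\mathbb{C}^N$ contained in the spherical shell $\{z\in\mathbb{C}^N: 1<\|z\|<\rho\}$ such that $h_r^{N-1}(X)$ contains the closed unit ball $\{z\in\mathbb{C}^N:\|z\|\le1\}$.
   Context: $\|z\|$ is the Euclidean norm on $\mathbb{C}^N$. An analytic subvariety of $\mathbb{C}^N$ of pure codimension $m$ means a pure-dimensional analytic subvariety of $\mathbb{C}^N$ of dimension $N-m$. For compact $X\subset\mathbb{C}^N$ and $1\le k\le N$, the $k$-rational hull $h_r^k(X)$ is the set of $z\in\mathbb{C}^N$ such that every analytic subvariety of $\mathbb{C}^N$ of pure codimension $\le k$ that passes through $z$ intersects $X$. *)

(* Defs.v *)
From Stdlib Require Import Reals.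
Open Scope R_scope.

Definition C : Type := (R * R)%type.
Definition C0 : C := (0, 0).
Definition Cadd (a b : C) : C := (fst a + fst b, snd a + snd b).
Definition Csub (a b : C) : C := (fst a - fst b, snd a - snd b).
Definition Cmul (a b : C) : C :=
  (fst a * fst b - snd a * snd b, fst a * snd b + snd a * fst b).
Definition Cmod (a : C) : R := sqrt (fst a * fst a + snd a * snd a).

Fixpoint sumR (f : nat -> R) (n : nat) : R :=
  match n with O => 0 | S m => sumR f m + f m end.
Fixpoint sumC (f : nat -> C) (n : nat) : C :=
  match n with O => C0 | S m => Cadd (sumC f m) (f m) end.

(** Points of C^N: sequences of complex numbers vanishing from index N on. *)
Definition pt : Type := nat -> C.
Definition inCN (N : nat) (z : pt) : Prop := forall i, (N <= i)%nat -> z i = C0.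
Definition padd (z w : pt) : pt := fun i => Cadd (z i) (w i).
Definition psub (z w : pt) : pt := fun i => Csub (z i) (w i).

Definition cnorm (N : nat) (z : pt) : R :=
  sqrt (sumR (fun i => fst (z i) * fst (z i) + snd (z i) * snd (z i)) N).
Definition cdist (N : nat) (z w : pt) : R := cnorm N (psub z w).
Definition ball (N : nat) (p : pt) (r : R) : pt -> Prop :=
  fun q => inCN N q /\ cdist N q p < r.

Definition has_cderiv (N : nat) (f : pt -> C) (z : pt) (c : nat -> C) : Prop :=
  forall eps, 0 < eps -> exists delta, 0 < delta /\
    forall h, inCN N h -> 0 < cnorm N h < delta ->
      Cmod (Csub (Csub (f (padd z h)) (f z))
                 (sumC (fun i => Cmul (c i) (h i)) N)) <= eps * cnorm N h.

Definition holo_on (N : nat) (U : pt -> Prop) (f : pt -> C) : Prop :=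
  forall z, U z -> inCN N z -> exists c, has_cderiv N f z c.

Definition analytic_subvariety (N : nat) (V : pt -> Prop) : Prop :=
  (forall z, V z -> inCN N z) /\
  forall p, inCN N p -> exists r, 0 < r /\ exists (k : nat) (g : nat -> pt -> C),
    (forall j, (j < k)%nat -> holo_on N (ball N p r) (g j)) /\
    (forall q, ball N p r q -> (V q <-> forall j, (j < k)%nat -> g j q = C0)).

Definition lin_indep (N k : nat) (c : nat -> nat -> C) : Prop :=
  forall a : nat -> C,
    (forall i, (i < N)%nat -> sumC (fun j => Cmul (a j) (c j i)) k = C0) ->
    forall j, (j < k)%nat -> a j = C0.

(** p is a regular point of V of dimension d: near p, V is the zero set of
    N - d holomorphic functions with C-linearly independent differentials at p
    (i.e. V is a d-dimensional complex submanifold near p). *)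
Definition regular_dim (N : nat) (V : pt -> Prop) (p : pt) (d : nat) : Prop :=
  V p /\ (d <= N)%nat /\
  exists r, 0 < r /\ exists (g : nat -> pt -> C) (c : nat -> nat -> C),
    (forall j, (j < N - d)%nat -> holo_on N (ball N p r) (g j)) /\
    (forall j, (j < N - d)%nat -> has_cderiv N (g j) p (c j)) /\
    lin_indep N (N - d) c /\
    (forall q, ball N p r q -> (V q <-> forall j, (j < N - d)%nat -> g j q = C0)).

(** dim_p V = d, where dim_p V := limsup of the dimensions of V at regular
    points q -> p. *)
Definition local_dim (N : nat) (V : pt -> Prop) (p : pt) (d : nat) : Prop :=
  (exists r, 0 < r /\ forall q e, ball N p r q -> regular_dim N V q e -> (e <= d)%nat) /\
  (forall r, 0 < r -> exists q, ball N p r q /\ regular_dim N V q d).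

Definition pure_dim (N : nat) (V : pt -> Prop) (d : nat) : Prop :=
  forall p, V p -> local_dim N V p d.

Definition analytic_pure_codim (N : nat) (V : pt -> Prop) (m : nat) : Prop :=
  analytic_subvariety N V /\ (m <= N)%nat /\ pure_dim N V (N - m).

Definition rational_hull (N k : nat) (X : pt -> Prop) (z : pt) : Prop :=
  inCN N z /\
  forall (V : pt -> Prop) (m : nat), (m <= k)%nat -> analytic_pure_codim N V m ->
    V z -> exists x, V x /\ X x.

Definition cantor_ternary (x : R) : Prop :=
  exists a : nat -> bool,
    infinite_sum (fun n => (if a n then 2 else 0) / 3 ^ (S n)) x.

Definition cantor_set (N : nat) (X : pt -> Prop) : Prop :=
  (forall z, X z -> inCN N z) /\
  exists (f : pt -> R) (g : R -> pt),
    (forall z, X z -> cantor_ternary (f z)) /\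
    (forall t, cantor_ternary t -> X (g t)) /\
    (forall z, X z -> g (f z) = z) /\
    (forall t, cantor_ternary t -> f (g t) = t) /\
    (forall z, X z -> forall eps, 0 < eps -> exists delta, 0 < delta /\
        forall w, X w -> cdist N w z < delta -> Rabs (f w - f z) < eps) /\
    (forall t, cantor_ternary t -> forall eps, 0 < eps -> exists delta, 0 < delta /\
        forall s, cantor_ternary s -> Rabs (s - t) < delta -> cdist N (g s) (g t) < eps).

(* Main.v *)
(** Let V be a pure-dimensional variety of positive dimension.  The key fact is a maximum principle:
    if V meets a compact set K at z, then for every d > 0 and every real linear form
    l = Re (a z_i), V contains a point q at distance exactly d from K with l(q) >= l(z).
    Granting this, start with the closed unit ball and replace a compact set K by its two children
    {x : d(x, K) = e/4, l(x) >= m} and {x : d(x, K) = e/2, l(x) <= m}, where l runs cyclically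
    through the real coordinates and m is the midpoint of l(K).  They are disjoint, a variety that
    meets K meets one of them, and the diameters tend to 0 along every branch of the resulting
    binary tree when e decreases fast; the limit set is the required Cantor set.

    For the maximum principle, let T be the set of points of V at which the restriction to V of
    some entire function has a strict local maximum modulus.  If the principle failed, T would be
    nonempty.  T has no isolated point: given a strict peak p of f, the maximum of
    |f^m (z_i - p_i)|^2 prod_j (1 + |z_j|^2) on V near p is attained at some p' <> p, and
    f^m (z_i - p_i) prod_j (1 + z_j conj(p'_j)) peaks strictly at p'.  Singular points of V cause
    no trouble, because a set without isolated points on which holomorphic g_1, ..., g_k vanish
    always has a point through which there passes an injective holomorphic disc inside {g = 0}:
    take a lowest-order directional derivative of some g_j that does not vanish identically on T,
    use the implicit function theorem to confine T to a graph, and induct on the dimension.  Such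
    a disc through a point of T contradicts the one-variable maximum principle. *)
From Stdlib Require Import Reals Lra Lia List Wf_nat Factorial.
From Stdlib Require Import Classical ClassicalEpsilon FunctionalExtensionality.
From Coquelicot Require Import Rcomplements Hierarchy Continuity Derive RInt AutoDerive.
Require Import Defs.
Import ListNotations.
Open Scope R_scope.
Set Bullet Behavior "Strict Subproofs".

(** * Goursat's theorem for closed forms *)

(** Holomorphy here means complex differentiability at every point, with no continuity of the
    derivative. This is why Goursat's theorem is the starting point: circle means, Cauchy estimates
    and a uniform second-order estimate rest on it, and they make directional derivatives
    holomorphic again, which the search for a lowest-order derivative requires. The discs stand in
    for a local structure theory of varieties. The price is that a disc passes through some point of
    T, not through a prescribed one; hence the set of all peaks is studied rather than a single
    peak. The weight has a simple origin: prod_j (1 + z_j conj(p_j)) is the inner product of the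
    tensor products of the vectors (1, z_j) and (1, p_j), and prod_j (1 + |z_j|^2) is the squared
    norm of the former. Cauchy-Schwarz is strict unless z = p, so a maximum of a weighted modulus,
    which need not be strict, becomes a strict maximum of the modulus of a holomorphic function. *)

Lemma dependent_choice {S : Type} (I : nat -> S -> Prop) (step : nat -> S -> S -> Prop) (s0 : S) :
  I 0%nat s0 ->
  (forall n s, I n s -> exists s', I (Datatypes.S n) s' /\ step n s s') ->
  exists u : nat -> S, u 0%nat = s0 /\
    forall n, I n (u n) /\ step n (u n) (u (Datatypes.S n)).
Proof.
  intros H0 Hs.
  set (nxt := fun n s => epsilon (inhabits s0) (fun s' => I (Datatypes.S n) s' /\ step n s s')).
  exists (fix u n := match n with O => s0 | Datatypes.S m => nxt m (u m) end).
  split; [reflexivity|].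
  set (u := fix u n := match n with O => s0 | Datatypes.S m => nxt m (u m) end).
  assert (HI : forall n, I n (u n)).
  { induction n as [|n IH]; [exact H0|].
    exact (proj1 (epsilon_spec (inhabits s0) _ (Hs n _ IH))). }
  intro n; split; [apply HI|].
  exact (proj2 (epsilon_spec (inhabits s0) _ (Hs n _ (HI n)))).
Qed.

Lemma nested_intervals (x w : nat -> R) :
  (forall n, 0 <= w n) -> (forall n, x n <= x (S n)) ->
  (forall n, x (S n) + w (S n) <= x n + w n) ->
  exists l, forall n, x n <= l <= x n + w n.
Proof.
  intros Hw Hx Hxw.
  assert (H1 : forall n k, x n <= x (n + k)%nat).
  { intros n k; induction k as [|k IH]; [rewrite Nat.add_0_r; lra|].
    rewrite Nat.add_succ_r; specialize (Hx (n + k)%nat); lra. }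
  assert (H2 : forall n k, x (n + k)%nat + w (n + k)%nat <= x n + w n).
  { intros n k; induction k as [|k IH]; [rewrite Nat.add_0_r; lra|].
    rewrite Nat.add_succ_r; specialize (Hxw (n + k)%nat); lra. }
  assert (H3 : forall n m, x n <= x m + w m).
  { intros n m. generalize (H1 n m) (H2 m n) (Hw (m + n)%nat).
    rewrite (Nat.add_comm m n); lra. }
  destruct (completeness (fun r => exists n, r = x n)) as [l [Hl1 Hl2]].
  - exists (x 0%nat + w 0%nat); intros r [n ->]; apply H3.
  - exists (x 0%nat); now exists 0%nat.
  - exists l; intro n; split.
    + apply Hl1; now exists n.
    + apply Hl2; intros r [m ->]; apply H3.
Qed.

Lemma pow2_pos n : 0 < 2 ^ n.
Proof. apply pow_lt; lra. Qed.

Lemma half_pow_small (a d : R) : 0 < d -> exists n, a / 2 ^ n < d.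
Proof.
  intro Hd. destruct (Rle_lt_dec a 0) as [Ha|Ha].
  { exists 0%nat; simpl; lra. }
  destruct (pow_lt_1_zero (/ 2) ltac:(rewrite Rabs_pos_eq; lra) (d / a)) as [n Hn].
  { apply Rdiv_lt_0_compat; assumption. }
  exists n. specialize (Hn n (Nat.le_refl n)).
  rewrite Rabs_pos_eq in Hn by (apply pow_le; lra).
  rewrite pow_inv in Hn. apply (Rmult_lt_compat_l a) in Hn; [|assumption].
  replace (a * (d / a)) with d in Hn by (field; lra). exact Hn.
Qed.

Lemma RInt_near_const (F : R -> R) (a b k B : R) :
  a <= b -> ex_RInt F a b -> (forall x, a <= x <= b -> Rabs (F x - k) <= B) ->
  Rabs (RInt F a b - k * (b - a)) <= B * (b - a).
Proof.
  intros Hab HF Hb.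
  assert (Hk : RInt (fun _ => k) a b = k * (b - a)).
  { rewrite RInt_const; unfold scal; simpl; unfold mult; simpl; ring. }
  rewrite <- Hk.
  replace (RInt F a b - RInt (fun _ => k) a b) with (RInt (fun x => F x - k) a b).
  - rewrite Rmult_comm; apply abs_RInt_le_const; [assumption| |assumption].
    apply @ex_RInt_minus; [assumption|apply ex_RInt_const].
  - exact (RInt_minus F (fun _ => k) a b HF (ex_RInt_const a b k)).
Qed.

(** Total differentiability with gradient [(a, b)]. The l1 norm of the increment is at most the sum
    of the two sides of any rectangle that contains both points. *)
Definition rdiff2 (P : R -> R -> R) (x y a b : R) : Prop :=
  forall eps, 0 < eps -> exists d, 0 < d /\ forall h k, Rabs h < d -> Rabs k < d ->
    Rabs (P (x + h) (y + k) - P x y - a * h - b * k) <= eps * (Rabs h + Rabs k).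

Lemma rdiff2_continuous (P : R -> R -> R) x y a b : rdiff2 P x y a b ->
  continuous (fun t => P t y) x /\ continuous (P x) y.
Proof.
  intro H. destruct (H 1 Rlt_0_1) as [d [Hd HP]].
  assert (Hmain : forall eps, 0 < eps -> exists e, 0 < e /\ e <= d /\
     forall h k, Rabs h < e -> Rabs k < e -> Rabs (P (x + h) (y + k) - P x y) < eps).
  { intros eps He.
    set (M := Rabs a + Rabs b + 2).
    assert (HM : 0 < M) by (unfold M; generalize (Rabs_pos a) (Rabs_pos b); lra).
    exists (Rmin d (eps / M)). split; [apply Rmin_pos; [lra|now apply Rdiv_lt_0_compat]|].
    split; [apply Rmin_l|]. intros h k Hh Hk.
    assert (Hh1 : Rabs h < d) by (eapply Rlt_le_trans; [apply Hh|apply Rmin_l]).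
    assert (Hk1 : Rabs k < d) by (eapply Rlt_le_trans; [apply Hk|apply Rmin_l]).
    assert (Hh2 : Rabs h < eps / M) by (eapply Rlt_le_trans; [apply Hh|apply Rmin_r]).
    assert (Hk2 : Rabs k < eps / M) by (eapply Rlt_le_trans; [apply Hk|apply Rmin_r]).
    specialize (HP h k Hh1 Hk1).
    replace (P (x + h) (y + k) - P x y)
      with ((P (x + h) (y + k) - P x y - a * h - b * k) + (a * h + b * k)) by ring.
    eapply Rle_lt_trans; [apply Rabs_triang|].
    assert (Rabs (a * h + b * k) <= Rabs a * Rabs h + Rabs b * Rabs k).
    { rewrite <- !Rabs_mult; apply Rabs_triang. }
    assert (Hm : eps = M * (eps / M)) by (field; lra).
    set (m := eps / M) in *. rewrite Hm. unfold M in *.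
    generalize (Rabs_pos a) (Rabs_pos b) (Rabs_pos h) (Rabs_pos k); intros.
    nra. }
  split; apply continuity_pt_filterlim; intros eps He;
    destruct (Hmain eps He) as [e [He1 [_ He2]]]; exists e; (split; [exact He1|]);
    intros t [_ Ht]; simpl in t, Ht |- *; unfold Rdist in *.
  - specialize (He2 (t - x) 0). replace (x + (t - x)) with t in He2 by ring.
    rewrite Rplus_0_r in He2. apply He2; [exact Ht|rewrite Rabs_R0; exact He1].
  - specialize (He2 0 (t - y)). replace (y + (t - y)) with t in He2 by ring.
    rewrite Rplus_0_r in He2. apply He2; [rewrite Rabs_R0; exact He1|exact Ht].
Qed.

(** The integral of P dx + Q dy around the rectangle, counterclockwise: bottom minus top, right
    minus left. *)
Definition circulation (P Q : R -> R -> R) (x1 x2 y1 y2 : R) : R :=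
  RInt (fun x => P x y1 - P x y2) x1 x2 + RInt (fun y => Q x2 y - Q x1 y) y1 y2.

Section Goursat.
Context (P Q : R -> R -> R) (X1 X2 Y1 Y2 : R).
(** The shared [b] is the closedness condition dP/dy = dQ/dx. Continuity of the partial derivatives
    is not assumed, which puts Green's formula out of reach. *)
Context (Hclosed : forall x y, X1 <= x <= X2 -> Y1 <= y <= Y2 ->
  exists a b c, rdiff2 P x y a b /\ rdiff2 Q x y b c).

Lemma closed_form_ex_RInt_x x1 x2 y : X1 <= x1 <= X2 -> X1 <= x2 <= X2 -> Y1 <= y <= Y2 ->
  ex_RInt (fun x => P x y) x1 x2.
Proof.
  intros H1 H2 Hy. apply (ex_RInt_continuous (fun x => P x y)). intros z Hz.
  destruct (Hclosed z y) as (a & b & c & HP & _); [|exact Hy|].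
  - revert Hz. unfold Rmin, Rmax; destruct Rle_dec; lra.
  - apply (rdiff2_continuous _ _ _ _ _ HP).
Qed.

Lemma closed_form_ex_RInt_y x y1 y2 : X1 <= x <= X2 -> Y1 <= y1 <= Y2 -> Y1 <= y2 <= Y2 ->
  ex_RInt (Q x) y1 y2.
Proof.
  intros Hx H1 H2. apply (ex_RInt_continuous (Q x)). intros z Hz.
  destruct (Hclosed x z) as (a & b & c & _ & HQ); [exact Hx| |].
  - revert Hz. unfold Rmin, Rmax; destruct Rle_dec; lra.
  - apply (rdiff2_continuous _ _ _ _ _ HQ).
Qed.

Lemma circulation_split_x x1 xm x2 y1 y2 :
  X1 <= x1 <= X2 -> X1 <= xm <= X2 -> X1 <= x2 <= X2 -> Y1 <= y1 <= Y2 -> Y1 <= y2 <= Y2 ->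
  circulation P Q x1 x2 y1 y2 = circulation P Q x1 xm y1 y2 + circulation P Q xm x2 y1 y2.
Proof.
  intros. unfold circulation.
  rewrite <- (RInt_Chasles (fun x => P x y1 - P x y2) x1 xm x2);
    try (apply @ex_RInt_minus; apply closed_form_ex_RInt_x; assumption).
  replace (RInt (fun y => Q x2 y - Q x1 y) y1 y2)
    with (RInt (fun y => Q xm y - Q x1 y) y1 y2 + RInt (fun y => Q x2 y - Q xm y) y1 y2).
  - unfold plus; simpl; ring.
  - rewrite <- (RInt_plus (fun y => Q xm y - Q x1 y) (fun y => Q x2 y - Q xm y));
      try (apply @ex_RInt_minus; apply closed_form_ex_RInt_y; assumption).
    apply RInt_ext; intros; unfold plus; simpl; ring.
Qed.

Lemma circulation_split_y x1 x2 y1 ym y2 :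
  X1 <= x1 <= X2 -> X1 <= x2 <= X2 -> Y1 <= y1 <= Y2 -> Y1 <= ym <= Y2 -> Y1 <= y2 <= Y2 ->
  circulation P Q x1 x2 y1 y2 = circulation P Q x1 x2 y1 ym + circulation P Q x1 x2 ym y2.
Proof.
  intros. unfold circulation.
  rewrite <- (RInt_Chasles (fun y => Q x2 y - Q x1 y) y1 ym y2);
    try (apply @ex_RInt_minus; apply closed_form_ex_RInt_y; assumption).
  replace (RInt (fun x => P x y1 - P x y2) x1 x2)
    with (RInt (fun x => P x y1 - P x ym) x1 x2 + RInt (fun x => P x ym - P x y2) x1 x2).
  - unfold plus; simpl; ring.
  - rewrite <- (RInt_plus (fun x => P x y1 - P x ym) (fun x => P x ym - P x y2));
      try (apply @ex_RInt_minus; apply closed_form_ex_RInt_x; assumption).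
    apply RInt_ext; intros; unfold plus; simpl; ring.
Qed.

(* Goursat: quartering keeps the circulation above a fixed multiple of the area, while
   differentiability at the limit point makes it o(area). *)
Theorem closed_form_circulation : X1 <= X2 -> Y1 <= Y2 -> circulation P Q X1 X2 Y1 Y2 = 0.
Proof.
  intros HX HY.
  set (a := X2 - X1). set (b := Y2 - Y1).
  set (J := fun n (s : R * R) =>
    circulation P Q (fst s) (fst s + a / 2 ^ n) (snd s) (snd s + b / 2 ^ n)).
  set (J0 := circulation P Q X1 X2 Y1 Y2).
  assert (Hpn : forall n, 0 <= a / 2 ^ n /\ 0 <= b / 2 ^ n).
  { intro n; split; apply Rmult_le_pos; unfold a, b; try lra;
      apply Rlt_le, Rinv_0_lt_compat, pow2_pos. }
  assert (Hhalf : forall t n, t / 2 ^ n = t / 2 ^ S n + t / 2 ^ S n).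
  { intros t n. simpl. field. apply Rgt_not_eq, pow2_pos. }
  destruct (dependent_choice
    (fun n s => X1 <= fst s /\ fst s + a / 2 ^ n <= X2 /\ Y1 <= snd s /\ snd s + b / 2 ^ n <= Y2
                /\ Rabs J0 / 4 ^ n <= Rabs (J n s))
    (fun n s s' => fst s <= fst s' <= fst s + a / 2 ^ S n /\ snd s <= snd s' <= snd s + b / 2 ^ S n)
    (X1, Y1)) as [u [_ Hu]].
  - simpl. unfold J, J0, a, b; simpl.
    replace (X1 + (X2 - X1) / 1) with X2 by field. replace (Y1 + (Y2 - Y1) / 1) with Y2 by field.
    unfold Rdiv; rewrite Rinv_1, Rmult_1_r. repeat split; lra.
  - intros n [x y]; cbn [fst snd]. intros (H1 & H2 & H3 & H4 & H5).
    destruct (Hpn (S n)) as [Ha Hb].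
    rewrite Hhalf in H2, H4.
    assert (Hsplit : J n (x, y) = J (S n) (x, y) + J (S n) (x, y + b / 2 ^ S n)
        + (J (S n) (x + a / 2 ^ S n, y) + J (S n) (x + a / 2 ^ S n, y + b / 2 ^ S n))).
    { unfold J, fst, snd. rewrite (Hhalf a n), (Hhalf b n).
      rewrite <- !Rplus_assoc.
      rewrite (circulation_split_x x (x + a / 2 ^ S n) (x + a / 2 ^ S n + a / 2 ^ S n)) by lra.
      rewrite (circulation_split_y x (x + a / 2 ^ S n) y (y + b / 2 ^ S n) (y + b / 2 ^ S n + b / 2 ^ S n)) by lra.
      rewrite (circulation_split_y (x + a / 2 ^ S n) _ y (y + b / 2 ^ S n) (y + b / 2 ^ S n + b / 2 ^ S n)) by lra.
      ring. }
    assert (H6 : Rabs J0 / 4 ^ n = 4 * (Rabs J0 / 4 ^ S n)).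
    { simpl. field. apply pow_nonzero; lra. }
    assert (H7 : Rabs J0 / 4 ^ S n <= Rabs (J (S n) (x, y))
       \/ Rabs J0 / 4 ^ S n <= Rabs (J (S n) (x, y + b / 2 ^ S n))
       \/ Rabs J0 / 4 ^ S n <= Rabs (J (S n) (x + a / 2 ^ S n, y))
       \/ Rabs J0 / 4 ^ S n <= Rabs (J (S n) (x + a / 2 ^ S n, y + b / 2 ^ S n))).
    { rewrite Hsplit in H5.
      apply NNPP; intro Hn.
      apply not_or_and in Hn as [N1 Hn]; apply not_or_and in Hn as [N2 Hn];
        apply not_or_and in Hn as [N3 N4].
      match type of H5 with _ <= Rabs (?A + ?B + (?C + ?D)) =>
        generalize (Rabs_triang (A + B) (C + D)) (Rabs_triang A B) (Rabs_triang C D) end.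
      lra. }
    destruct H7 as [H7|[H7|[H7|H7]]]; eexists; (split;
      [|match type of H7 with _ <= Rabs (J _ ?s) => instantiate (1 := s) end]); cbn [fst snd];
      repeat split; try lra.
  - destruct (nested_intervals (fun n => fst (u n)) (fun n => a / 2 ^ n)) as [xi Hxi].
    { intro n; apply Hpn. }
    { intro n; apply (Hu n). }
    { intro n; destruct (Hu n) as [_ [Hn _]]; rewrite (Hhalf a n); lra. }
    destruct (nested_intervals (fun n => snd (u n)) (fun n => b / 2 ^ n)) as [et Het].
    { intro n; apply Hpn. }
    { intro n; apply (Hu n). }
    { intro n; destruct (Hu n) as [_ [_ Hn]]; rewrite (Hhalf b n); lra. }
    destruct (Hclosed xi et) as (pa & pb & pc & HP & HQ).
    { generalize (Hxi 0%nat). destruct (Hu 0%nat) as [(H1 & H2 & _) _]. lra. }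
    { generalize (Het 0%nat). destruct (Hu 0%nat) as [(_ & _ & H1 & H2 & _) _]. lra. }
    assert (Hsmall : forall eps, 0 < eps -> Rabs J0 <= eps * (2 * (a + b) * (a + b))).
    { intros eps Heps.
      destruct (HP eps Heps) as [d1 [Hd1 HP1]]. destruct (HQ eps Heps) as [d2 [Hd2 HQ2]].
      destruct (half_pow_small (a + b) (Rmin d1 d2)) as [n Hn]; [now apply Rmin_pos|].
      destruct (Hu n) as [(H1 & H2 & H3 & H4 & H5) _].
      specialize (Hxi n). specialize (Het n). destruct (Hpn n) as [Ha Hb].
      simpl in Hxi, Het.
      set (x := fst (u n)) in *. set (y := snd (u n)) in *.
      assert (Hab : (a + b) / 2 ^ n = a / 2 ^ n + b / 2 ^ n) by (field; apply Rgt_not_eq, pow2_pos).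
      set (wa := a / 2 ^ n) in *. set (wb := b / 2 ^ n) in *.
      assert (Hlt : wa + wb < d1 /\ wa + wb < d2).
      { generalize (Rmin_l d1 d2) (Rmin_r d1 d2). lra. }
      assert (HPe : forall s t, x <= s <= x + wa -> y <= t <= y + wb ->
         Rabs (P s t - P xi et - pa * (s - xi) - pb * (t - et)) <= eps * (wa + wb)).
      { intros s t Hs Ht.
        assert (Rabs (s - xi) <= wa) by (apply Rabs_le; lra).
        assert (Rabs (t - et) <= wb) by (apply Rabs_le; lra).
        specialize (HP1 (s - xi) (t - et)). replace (xi + (s - xi)) with s in HP1 by ring.
        replace (et + (t - et)) with t in HP1 by ring.
        eapply Rle_trans; [apply HP1; lra|]. apply Rmult_le_compat_l; lra. }
      assert (HQe : forall s t, x <= s <= x + wa -> y <= t <= y + wb ->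
         Rabs (Q s t - Q xi et - pb * (s - xi) - pc * (t - et)) <= eps * (wa + wb)).
      { intros s t Hs Ht.
        assert (Rabs (s - xi) <= wa) by (apply Rabs_le; lra).
        assert (Rabs (t - et) <= wb) by (apply Rabs_le; lra).
        specialize (HQ2 (s - xi) (t - et)). replace (xi + (s - xi)) with s in HQ2 by ring.
        replace (et + (t - et)) with t in HQ2 by ring.
        eapply Rle_trans; [apply HQ2; lra|]. apply Rmult_le_compat_l; lra. }
      (* The first-order parts of the two integrals are - [pb] * [wb] * [wa] and [pb] * [wa] * [wb].
         They cancel because both come from the same mixed coefficient [pb], and only errors of
         order eps times the area scale remain. *)
      assert (HI1 : Rabs (RInt (fun s => P s y - P s (y + wb)) x (x + wa) - (- pb * wb) * (x + wa - x))
                    <= 2 * (eps * (wa + wb)) * (x + wa - x)).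
      { apply RInt_near_const; [lra| |].
        - apply @ex_RInt_minus; apply closed_form_ex_RInt_x; lra.
        - intros s Hs. generalize (HPe s y ltac:(lra) ltac:(lra)) (HPe s (y + wb) ltac:(lra) ltac:(lra)).
          intros E1 E2. apply Rabs_le_between in E1. apply Rabs_le_between in E2.
          apply Rabs_le. lra. }
      assert (HI2 : Rabs (RInt (fun t => Q (x + wa) t - Q x t) y (y + wb) - (pb * wa) * (y + wb - y))
                    <= 2 * (eps * (wa + wb)) * (y + wb - y)).
      { apply RInt_near_const; [lra| |].
        - apply @ex_RInt_minus; apply closed_form_ex_RInt_y; lra.
        - intros t Ht. generalize (HQe x t ltac:(lra) ltac:(lra)) (HQe (x + wa) t ltac:(lra) ltac:(lra)).
          intros E1 E2. apply Rabs_le_between in E1. apply Rabs_le_between in E2.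
          apply Rabs_le. lra. }
      assert (HJ : Rabs (J n (u n)) <= eps * (2 * (wa + wb) * (wa + wb))).
      { unfold J, circulation. fold x y wa wb.
        apply Rabs_le_between in HI1. apply Rabs_le_between in HI2. apply Rabs_le. lra. }
      assert (H4n : 4 ^ n = 2 ^ n * 2 ^ n) by (rewrite <- Rpow_mult_distr; f_equal; lra).
      assert (Hp4 : 0 < 4 ^ n) by (apply pow_lt; lra).
      assert (Hfin : Rabs J0 / 4 ^ n <= eps * (2 * (a + b) * (a + b)) / 4 ^ n).
      { eapply Rle_trans; [apply H5|]. eapply Rle_trans; [apply HJ|].
        rewrite <- Hab, H4n. right. field. apply Rgt_not_eq, pow2_pos. }
      apply Rmult_le_reg_r with (/ 4 ^ n); [now apply Rinv_0_lt_compat|exact Hfin]. }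
    assert (HJ0 : Rabs J0 <= 0).
    { apply Rnot_lt_le; intro Hpos.
      set (K := 2 * (a + b) * (a + b)) in *.
      assert (HK : 0 <= K) by (unfold K, a, b; nra).
      specialize (Hsmall (Rabs J0 / (2 * (K + 1))) ltac:(apply Rdiv_lt_0_compat; lra)).
      assert (Rabs J0 / (2 * (K + 1)) * K <= Rabs J0 / 2).
      { replace (Rabs J0 / 2) with (Rabs J0 / (2 * (K + 1)) * (K + 1)) by (field; lra).
        apply Rmult_le_compat_l; [|lra]. apply Rlt_le, Rdiv_lt_0_compat; lra. }
      lra. }
    generalize (Rabs_pos J0); intro. destruct (Req_dec J0 0) as [E|E]; [exact E|].
    apply Rabs_pos_lt in E; lra.
Qed.
End Goursat.

(** * Complex differentiability *)

Definition C1 : C := (1, 0).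
Definition Copp (a : C) : C := (- fst a, - snd a).
Definition Cconj (a : C) : C := (fst a, - snd a).
Definition Cinv (a : C) : C :=
  let n := fst a * fst a + snd a * snd a in (fst a / n, - snd a / n).

Lemma C_ring_theory : ring_theory C0 C1 Cadd Cmul Csub Copp eq.
Proof.
  constructor; intros; unfold C0, C1, Cadd, Cmul, Csub, Copp;
    repeat match goal with a : C |- _ => destruct a end; cbn [fst snd]; f_equal; ring.
Qed.
Add Ring C_ring : C_ring_theory.

Lemma Cmod_ge_0 a : 0 <= Cmod a.
Proof. apply sqrt_pos. Qed.

Lemma Cmod_sqr a : Cmod a * Cmod a = fst a * fst a + snd a * snd a.
Proof. apply sqrt_sqrt. nra. Qed.

Lemma Cmod_C0 : Cmod C0 = 0.
Proof. unfold Cmod, C0; cbn [fst snd]. rewrite Rmult_0_l, Rplus_0_l. apply sqrt_0. Qed.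

Lemma Cmod_C1 : Cmod C1 = 1.
Proof. unfold Cmod, C1; cbn [fst snd]. rewrite <- sqrt_1 at 3. f_equal; ring. Qed.

Lemma fst_le_Cmod a : Rabs (fst a) <= Cmod a.
Proof.
  generalize (Cmod_ge_0 a) (Cmod_sqr a); intros. apply Rabs_le. split; nra.
Qed.

Lemma snd_le_Cmod a : Rabs (snd a) <= Cmod a.
Proof.
  generalize (Cmod_ge_0 a) (Cmod_sqr a); intros. apply Rabs_le. split; nra.
Qed.

Lemma Cmod_le_abs a : Cmod a <= Rabs (fst a) + Rabs (snd a).
Proof.
  generalize (Cmod_ge_0 a) (Cmod_sqr a) (Rabs_pos (fst a)) (Rabs_pos (snd a)).
  assert (E1 : fst a * fst a = Rabs (fst a) * Rabs (fst a)) by (rewrite <- Rabs_mult, Rabs_pos_eq; nra).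
  assert (E2 : snd a * snd a = Rabs (snd a) * Rabs (snd a)) by (rewrite <- Rabs_mult, Rabs_pos_eq; nra).
  rewrite E1, E2. nra.
Qed.

Lemma Cmod_mul a b : Cmod (Cmul a b) = Cmod a * Cmod b.
Proof.
  unfold Cmod. rewrite <- sqrt_mult by nra. f_equal. unfold Cmul; cbn [fst snd]; ring.
Qed.

Lemma Cmod_opp a : Cmod (Copp a) = Cmod a.
Proof. unfold Cmod, Copp; cbn [fst snd]; f_equal; ring. Qed.

Lemma Cmod_conj a : Cmod (Cconj a) = Cmod a.
Proof. unfold Cmod, Cconj; cbn [fst snd]; f_equal; ring. Qed.

Lemma Cmod_add a b : Cmod (Cadd a b) <= Cmod a + Cmod b.
Proof.
  apply Rsqr_incr_0_var; [|generalize (Cmod_ge_0 a) (Cmod_ge_0 b); lra].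
  unfold Rsqr. rewrite Cmod_sqr.
  replace ((Cmod a + Cmod b) * (Cmod a + Cmod b))
    with (Cmod a * Cmod a + Cmod b * Cmod b + 2 * (Cmod a * Cmod b)) by ring.
  rewrite (Cmod_sqr a), (Cmod_sqr b), <- (Cmod_conj b), <- Cmod_mul.
  generalize (fst_le_Cmod (Cmul a (Cconj b))). intro H. apply Rabs_le_between in H.
  unfold Cmul, Cconj, Cadd in *; cbn [fst snd] in *. lra.
Qed.

Lemma Cmod_sub a b : Cmod (Csub a b) <= Cmod a + Cmod b.
Proof.
  replace (Csub a b) with (Cadd a (Copp b)) by ring. rewrite <- (Cmod_opp b). apply Cmod_add.
Qed.

Lemma Cmod_sub_sym a b : Cmod (Csub a b) = Cmod (Csub b a).
Proof. rewrite <- Cmod_opp. f_equal. ring. Qed.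

Lemma Cmod_eq_0 a : Cmod a <= 0 -> a = C0.
Proof.
  intro H. generalize (Cmod_ge_0 a) (Cmod_sqr a); intros. destruct a as [x y]; cbn [fst snd] in *.
  unfold C0. f_equal; nra.
Qed.

Lemma Cmod_pos a : a <> C0 -> 0 < Cmod a.
Proof. intro H. apply Rnot_le_lt. intro; now apply H, Cmod_eq_0. Qed.

Lemma Cmul_inv_l a : a <> C0 -> Cmul (Cinv a) a = C1.
Proof.
  intro H. assert (Hp : 0 < Cmod a) by now apply Cmod_pos.
  generalize (Cmod_sqr a). intro E. unfold Cmul, Cinv, C1; cbn [fst snd].
  f_equal; field; nra.
Qed.

Lemma C1_neq_C0 : C1 <> C0.
Proof. intro H; injection H; lra. Qed.

Definition RtoC (x : R) : C := (x, 0).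

Lemma Cmod_RtoC x : Cmod (RtoC x) = Rabs x.
Proof.
  unfold Cmod, RtoC; cbn [fst snd]. rewrite <- sqrt_Rsqr_abs. f_equal; unfold Rsqr; ring.
Qed.

Definition cdiff (f : C -> C) (z c : C) : Prop :=
  forall eps, 0 < eps -> exists d, 0 < d /\ forall h, Cmod h < d ->
    Cmod (Csub (Csub (f (Cadd z h)) (f z)) (Cmul c h)) <= eps * Cmod h.

Lemma cdiff_lipschitz f z c : cdiff f z c -> exists d, 0 < d /\ forall h, Cmod h < d ->
  Cmod (Csub (f (Cadd z h)) (f z)) <= (Cmod c + 1) * Cmod h.
Proof.
  intro H. destruct (H 1 Rlt_0_1) as [d [Hd Hf]]. exists d; split; [exact Hd|].
  intros h Hh. specialize (Hf h Hh).
  replace (Csub (f (Cadd z h)) (f z))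
    with (Cadd (Csub (Csub (f (Cadd z h)) (f z)) (Cmul c h)) (Cmul c h)) by ring.
  eapply Rle_trans; [apply Cmod_add|]. rewrite Cmod_mul. lra.
Qed.

Lemma cdiff_const k z : cdiff (fun _ => k) z C0.
Proof.
  intros eps He. exists 1; split; [lra|]. intros h _.
  replace (Csub (Csub k k) (Cmul C0 h)) with C0 by ring. rewrite Cmod_C0.
  apply Rmult_le_pos; [lra|apply Cmod_ge_0].
Qed.

Lemma cdiff_sub f g z c e : cdiff f z c -> cdiff g z e ->
  cdiff (fun w => Csub (f w) (g w)) z (Csub c e).
Proof.
  intros Hf Hg eps He.
  destruct (Hf (eps / 2) ltac:(lra)) as [d1 [Hd1 H1]].
  destruct (Hg (eps / 2) ltac:(lra)) as [d2 [Hd2 H2]].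
  exists (Rmin d1 d2). split; [now apply Rmin_pos|]. intros h Hh.
  assert (Hh1 : Cmod h < d1) by (eapply Rlt_le_trans; [apply Hh|apply Rmin_l]).
  assert (Hh2 : Cmod h < d2) by (eapply Rlt_le_trans; [apply Hh|apply Rmin_r]).
  specialize (H1 h Hh1). specialize (H2 h Hh2).
  match goal with |- Cmod ?t <= _ => replace t with
    (Csub (Csub (Csub (f (Cadd z h)) (f z)) (Cmul c h))
          (Csub (Csub (g (Cadd z h)) (g z)) (Cmul e h))) by ring end.
  eapply Rle_trans; [apply Cmod_sub|]. lra.
Qed.

Lemma cdiff_shift f a z c : cdiff f (Cadd z a) c -> cdiff (fun w => f (Cadd w a)) z c.
Proof.
  intros Hf eps He. destruct (Hf eps He) as [d [Hd H]]. exists d; split; [exact Hd|].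
  intros h Hh. replace (Cadd (Cadd z h) a) with (Cadd (Cadd z a) h) by ring. now apply H.
Qed.

Lemma cdiff_comp f g z c e : cdiff g z c -> cdiff f (g z) e ->
  cdiff (fun w => f (g w)) z (Cmul e c).
Proof.
  intros Hg Hf eps He.
  destruct (cdiff_lipschitz _ _ _ Hg) as [d0 [Hd0 H0]].
  assert (Pc := Cmod_ge_0 c). assert (Pe := Cmod_ge_0 e).
  set (K := Cmod c + 1) in *. assert (HK : 0 < K) by (unfold K; lra).
  destruct (Hf (eps / (2 * K))) as [d1 [Hd1 H1]]; [apply Rdiv_lt_0_compat; lra|].
  destruct (Hg (eps / (2 * (Cmod e + 1)))) as [d2 [Hd2 H2]]; [apply Rdiv_lt_0_compat; lra|].
  exists (Rmin d0 (Rmin (d1 / K) d2)).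
  split; [repeat apply Rmin_pos; try assumption; now apply Rdiv_lt_0_compat|].
  intros h Hh.
  assert (Hh0 : Cmod h < d0) by (eapply Rlt_le_trans; [apply Hh|apply Rmin_l]).
  assert (Hh' : Cmod h < Rmin (d1 / K) d2) by (eapply Rlt_le_trans; [apply Hh|apply Rmin_r]).
  assert (Hh1 : Cmod h < d1 / K) by (eapply Rlt_le_trans; [apply Hh'|apply Rmin_l]).
  assert (Hh2 : Cmod h < d2) by (eapply Rlt_le_trans; [apply Hh'|apply Rmin_r]).
  specialize (H0 h Hh0). specialize (H2 h Hh2).
  set (k := Csub (g (Cadd z h)) (g z)) in *.
  assert (Hk : Cmod k < d1).
  { eapply Rle_lt_trans; [apply H0|]. apply (Rmult_lt_compat_l K) in Hh1; [|exact HK].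
    replace (K * (d1 / K)) with d1 in Hh1 by (field; lra). exact Hh1. }
  specialize (H1 k Hk).
  replace (Cadd (g z) k) with (g (Cadd z h)) in H1 by (unfold k; ring).
  match goal with |- Cmod ?t <= _ => replace t with
    (Cadd (Csub (Csub (f (g (Cadd z h))) (f (g z))) (Cmul e k))
          (Cmul e (Csub k (Cmul c h)))) by ring end.
  eapply Rle_trans; [apply Cmod_add|]. rewrite Cmod_mul.
  assert (E1 : eps / (2 * K) * Cmod k <= eps / 2 * Cmod h).
  { replace (eps / 2 * Cmod h) with (eps / (2 * K) * (K * Cmod h)) by (field; lra).
    apply Rmult_le_compat_l; [apply Rlt_le, Rdiv_lt_0_compat; lra|exact H0]. }
  assert (E2 : Cmod e * Cmod (Csub k (Cmul c h)) <= eps / 2 * Cmod h).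
  { eapply Rle_trans; [apply Rmult_le_compat_l; [apply Cmod_ge_0|apply H2]|].
    replace (eps / 2 * Cmod h)
      with ((Cmod e + 1) * (eps / (2 * (Cmod e + 1)) * Cmod h)) by (field; lra).
    apply Rmult_le_compat_r; [|lra].
    apply Rmult_le_pos; [apply Rlt_le, Rdiv_lt_0_compat; lra|apply Cmod_ge_0]. }
  lra.
Qed.

Lemma cdiff_mul f g z c e : cdiff f z c -> cdiff g z e ->
  cdiff (fun w => Cmul (f w) (g w)) z (Cadd (Cmul c (g z)) (Cmul (f z) e)).
Proof.
  intros Hf Hg eps He.
  destruct (cdiff_lipschitz _ _ _ Hf) as [d0 [Hd0 H0]].
  destruct (cdiff_lipschitz _ _ _ Hg) as [d3 [Hd3 H3]].
  assert (Pc := Cmod_ge_0 c). assert (Pe := Cmod_ge_0 e).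
  assert (Pf := Cmod_ge_0 (f z)). assert (Pg := Cmod_ge_0 (g z)).
  set (K := Cmod c + 1) in *. set (K' := Cmod e + 1) in *.
  assert (HK : 0 < K * K') by (unfold K, K'; nra).
  destruct (Hf (eps / (4 * (Cmod (g z) + 1)))) as [d1 [Hd1 H1]]; [apply Rdiv_lt_0_compat; lra|].
  destruct (Hg (eps / (4 * (Cmod (f z) + 1)))) as [d2 [Hd2 H2]]; [apply Rdiv_lt_0_compat; lra|].
  set (d4 := eps / (2 * (K * K'))).
  assert (Hd4 : 0 < d4) by (apply Rdiv_lt_0_compat; lra).
  exists (Rmin (Rmin d0 d3) (Rmin (Rmin d1 d2) d4)).
  split; [repeat (assumption || apply Rmin_pos)|]. intros h Hh.
  assert (B1 := Rmin_l (Rmin d0 d3) (Rmin (Rmin d1 d2) d4)).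
  assert (B2 := Rmin_r (Rmin d0 d3) (Rmin (Rmin d1 d2) d4)).
  assert (B3 := Rmin_l d0 d3). assert (B4 := Rmin_r d0 d3).
  assert (B5 := Rmin_l (Rmin d1 d2) d4). assert (B6 := Rmin_r (Rmin d1 d2) d4).
  assert (B7 := Rmin_l d1 d2). assert (B8 := Rmin_r d1 d2).
  specialize (H0 h ltac:(lra)). specialize (H1 h ltac:(lra)).
  specialize (H2 h ltac:(lra)). specialize (H3 h ltac:(lra)).
  assert (Hh4 : Cmod h < d4) by lra.
  match goal with |- Cmod ?t <= _ => replace t with
    (Cadd (Cmul (Csub (f (Cadd z h)) (f z)) (Csub (g (Cadd z h)) (g z)))
      (Cadd (Cmul (f z) (Csub (Csub (g (Cadd z h)) (g z)) (Cmul e h)))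
            (Cmul (g z) (Csub (Csub (f (Cadd z h)) (f z)) (Cmul c h))))) by ring end.
  eapply Rle_trans; [apply Cmod_add|].
  eapply Rle_trans; [apply Rplus_le_compat_l, Cmod_add|]. rewrite !Cmod_mul.
  assert (Ph := Cmod_ge_0 h).
  assert (E1 : Cmod (Csub (f (Cadd z h)) (f z)) * Cmod (Csub (g (Cadd z h)) (g z)) <= eps / 2 * Cmod h).
  { eapply Rle_trans; [apply Rmult_le_compat; [apply Cmod_ge_0|apply Cmod_ge_0|apply H0|apply H3]|].
    replace (K * Cmod h * (K' * Cmod h)) with (K * K' * Cmod h * Cmod h) by ring.
    apply Rmult_le_compat_r; [exact Ph|].
    replace (eps / 2) with (K * K' * d4) by (unfold d4; field; unfold K, K'; lra).
    apply Rmult_le_compat_l; lra. }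
  assert (Haux : forall A B, 0 <= A -> B <= eps / (4 * (A + 1)) * Cmod h -> 
     A * B <= eps / 4 * Cmod h).
  { intros A B PA HB. eapply Rle_trans; [apply Rmult_le_compat_l; [exact PA|apply HB]|].
    replace (eps / 4 * Cmod h)
      with ((A + 1) * (eps / (4 * (A + 1)) * Cmod h)) by (field; lra).
    apply Rmult_le_compat_r; [|lra].
    apply Rmult_le_pos; [apply Rlt_le, Rdiv_lt_0_compat; lra|exact Ph]. }
  assert (E2 := Haux _ _ Pf H2). assert (E3 := Haux _ _ Pg H1). lra.
Qed.

Lemma cdiff_unique f z c e : cdiff f z c -> cdiff f z e -> c = e.
Proof.
  intros H1 H2.
  assert (E : Csub c e = C0).
  { apply Cmod_eq_0. apply Rnot_lt_le; intro Hp.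
    destruct (H1 (Cmod (Csub c e) / 4) ltac:(lra)) as [d1 [Hd1 K1]].
    destruct (H2 (Cmod (Csub c e) / 4) ltac:(lra)) as [d2 [Hd2 K2]].
    set (t := Rmin d1 d2 / 2). assert (Ht : 0 < Rmin d1 d2) by now apply Rmin_pos.
    assert (B1 := Rmin_l d1 d2). assert (B2 := Rmin_r d1 d2).
    assert (Hm : Cmod (RtoC t) = t) by (rewrite Cmod_RtoC, Rabs_pos_eq; unfold t; lra).
    specialize (K1 (RtoC t)). specialize (K2 (RtoC t)). rewrite Hm in K1, K2.
    specialize (K1 ltac:(unfold t; lra)). specialize (K2 ltac:(unfold t; lra)).
    assert (K3 : Cmod (Cmul (Csub c e) (RtoC t)) <= Cmod (Csub c e) / 4 * t + Cmod (Csub c e) / 4 * t).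
    { replace (Cmul (Csub c e) (RtoC t)) with
       (Csub (Csub (Csub (f (Cadd z (RtoC t))) (f z)) (Cmul e (RtoC t)))
             (Csub (Csub (f (Cadd z (RtoC t))) (f z)) (Cmul c (RtoC t)))) by ring.
      eapply Rle_trans; [apply Cmod_sub|]. lra. }
    rewrite Cmod_mul, Hm in K3.
    assert (0 < t) by (unfold t; lra). nra. }
  replace c with (Cadd (Csub c e) e) by ring. rewrite E; ring.
Qed.

(** * The complex exponential and periodic integrals *)

Definition cexp (z : C) : C := (exp (fst z) * cos (snd z), exp (fst z) * sin (snd z)).

Lemma cexp_add a b : cexp (Cadd a b) = Cmul (cexp a) (cexp b).
Proof.
  unfold cexp, Cadd, Cmul; cbn [fst snd]. rewrite exp_plus, cos_plus, sin_plus. f_equal; ring.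
Qed.

Lemma cexp_0 : cexp C0 = C1.
Proof. unfold cexp, C0, C1; cbn [fst snd]. rewrite exp_0, cos_0, sin_0. f_equal; ring. Qed.

Lemma Cmod_cexp z : Cmod (cexp z) = exp (fst z).
Proof.
  apply Rsqr_inj; [apply Cmod_ge_0|apply Rlt_le, exp_pos|]. unfold Rsqr. rewrite Cmod_sqr.
  unfold cexp; cbn [fst snd]. generalize (sin2_cos2 (snd z)); unfold Rsqr; intro H.
  replace (exp (fst z) * exp (fst z)) with
    (exp (fst z) * exp (fst z) * (sin (snd z) * sin (snd z) + cos (snd z) * cos (snd z)))
    by (rewrite H; ring). ring.
Qed.

Lemma is_derive_eps (f : R -> R) x l : is_derive f x l -> forall eps, 0 < eps ->
  exists d, 0 < d /\ forall h, Rabs h < d -> Rabs (f (x + h) - f x - l * h) <= eps * Rabs h.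
Proof.
  intros H eps He. apply is_derive_Reals in H. destruct (H eps He) as [d Hd].
  exists d; split; [apply cond_pos|]. intros h Hh.
  destruct (Req_dec h 0) as [->|Hn].
  - rewrite Rplus_0_r. replace (f x - f x - l * 0) with 0 by ring. rewrite Rabs_R0. lra.
  - specialize (Hd h Hn Hh).
    replace (f (x + h) - f x - l * h) with (((f (x + h) - f x) / h - l) * h) by (field; exact Hn).
    rewrite Rabs_mult. apply Rmult_le_compat_r; [apply Rabs_pos|lra].
Qed.

Lemma eps_is_derive (f : R -> R) x l : (forall eps, 0 < eps ->
  exists d, 0 < d /\ forall h, Rabs h < d -> Rabs (f (x + h) - f x - l * h) <= eps * Rabs h) ->
  is_derive f x l.
Proof.
  intro H. apply is_derive_Reals. intros eps He. destruct (H (eps / 2) ltac:(lra)) as [d [Hd Hf]].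
  exists (mkposreal d Hd). intros h Hn Hh. specialize (Hf h Hh).
  replace ((f (x + h) - f x) / h - l) with ((f (x + h) - f x - l * h) / h) by (field; exact Hn).
  unfold Rdiv. rewrite Rabs_mult, Rabs_inv.
  assert (0 < Rabs h) by now apply Rabs_pos_lt.
  apply Rle_lt_trans with (eps / 2); [|lra].
  apply Rmult_le_reg_r with (Rabs h); [assumption|].
  rewrite Rmult_assoc, Rinv_l, Rmult_1_r; lra.
Qed.

(** Real derivatives of [exp], [cos] and [sin] enter only at 0; the functional equation [cexp_add]
    carries the result to every other point. *)
Lemma cdiff_cexp_0 : cdiff cexp C0 C1.
Proof.
  intros eps He.
  assert (D1 : is_derive exp 0 1) by (auto_derive; [trivial|rewrite exp_0; ring]).
  assert (D2 : is_derive cos 0 0) by (auto_derive; [trivial|rewrite sin_0; ring]).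
  assert (D3 : is_derive sin 0 1) by (auto_derive; [trivial|rewrite cos_0; ring]).
  (* The error terms below add up to at most 9 * e * m, which eps / 20 absorbs. The bound e <= 1
     keeps the modulus of h below 1, hence exp x at most 3. *)
  set (e := Rmin (eps / 20) 1).
  assert (Hep : 0 < e) by (unfold e; apply Rmin_pos; lra).
  assert (He1 : e <= eps / 20) by apply Rmin_l.
  assert (He2 : e <= 1) by apply Rmin_r.
  destruct (is_derive_eps _ _ _ D1 e Hep) as [d1 [Hd1 H1]].
  destruct (is_derive_eps _ _ _ D2 e Hep) as [d2 [Hd2 H2]].
  destruct (is_derive_eps _ _ _ D3 e Hep) as [d3 [Hd3 H3]].
  exists (Rmin (Rmin d1 d2) (Rmin d3 e)). split; [repeat (assumption || apply Rmin_pos)|].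
  intros h Hh.
  assert (B1 := Rmin_l (Rmin d1 d2) (Rmin d3 e)). assert (B2 := Rmin_r (Rmin d1 d2) (Rmin d3 e)).
  assert (B3 := Rmin_l d1 d2). assert (B4 := Rmin_r d1 d2).
  assert (B5 := Rmin_l d3 e). assert (B6 := Rmin_r d3 e).
  assert (Bx := fst_le_Cmod h). assert (By := snd_le_Cmod h).
  destruct h as [x y]; cbn [fst snd] in Bx, By.
  set (m := Cmod (x, y)) in *.
  specialize (H1 x ltac:(lra)). specialize (H2 y ltac:(lra)). specialize (H3 y ltac:(lra)).
  rewrite Rplus_0_l, exp_0 in H1. rewrite Rplus_0_l, cos_0 in H2. rewrite Rplus_0_l, sin_0 in H3.
  replace (Cadd C0 (x, y)) with ((x, y) : C) by (unfold Cadd, C0; cbn [fst snd]; f_equal; ring).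
  rewrite cexp_0. eapply Rle_trans; [apply Cmod_le_abs|].
  unfold cexp, Csub, Cmul, C1; cbn [fst snd].
  set (E := exp x) in *. set (c := cos y) in *. set (s := sin y) in *.
  replace (E * c - 1 - (1 * x - 0 * y)) with ((E - 1 - 1 * x) + E * (c - 1 - 0 * y)) by ring.
  replace (E * s - 0 - (1 * y + 0 * x)) with (E * (s - 0 - 1 * y) + (E - 1) * y) by ring.
  assert (Hm : 0 <= m) by apply Cmod_ge_0.
  assert (HE : Rabs (E - 1) <= 2 * m).
  { replace (E - 1) with ((E - 1 - 1 * x) + x) by ring.
    eapply Rle_trans; [apply Rabs_triang|]. assert (e * Rabs x <= 1 * m) by (apply Rmult_le_compat; try lra; apply Rabs_pos). lra. }
  assert (HE2 : Rabs E <= 3).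
  { replace E with ((E - 1) + 1) by ring. eapply Rle_trans; [apply Rabs_triang|].
    rewrite Rabs_R1. lra. }
  assert (Q1 : Rabs (E - 1 - 1 * x) <= e * m).
  { eapply Rle_trans; [apply H1|]. apply Rmult_le_compat_l; lra. }
  assert (Q2 : Rabs (E * (c - 1 - 0 * y)) <= 3 * (e * m)).
  { rewrite Rabs_mult. apply Rmult_le_compat; try apply Rabs_pos; [exact HE2|].
    eapply Rle_trans; [apply H2|]. apply Rmult_le_compat_l; lra. }
  assert (Q3 : Rabs (E * (s - 0 - 1 * y)) <= 3 * (e * m)).
  { rewrite Rabs_mult. apply Rmult_le_compat; try apply Rabs_pos; [exact HE2|].
    eapply Rle_trans; [apply H3|]. apply Rmult_le_compat_l; lra. }
  assert (Q4 : Rabs ((E - 1) * y) <= 2 * (e * m)).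
  { rewrite Rabs_mult. apply Rle_trans with (2 * m * e); [|right; ring].
    apply Rmult_le_compat; try apply Rabs_pos; lra. }
  eapply Rle_trans; [apply Rplus_le_compat; apply Rabs_triang|].
  assert (e * m <= eps / 20 * m) by (apply Rmult_le_compat_r; lra).
  assert (0 <= eps * m) by (apply Rmult_le_pos; lra). lra.
Qed.

Lemma cdiff_cexp z : cdiff cexp z (cexp z).
Proof.
  intros eps He. assert (P := exp_pos (fst z)).
  destruct (cdiff_cexp_0 (eps / exp (fst z))) as [d [Hd H]]; [now apply Rdiv_lt_0_compat|].
  exists d; split; [exact Hd|]. intros h Hh. specialize (H h Hh).
  rewrite cexp_0 in H. replace (Cadd C0 h) with h in H by ring.
  replace (Csub (Csub (cexp (Cadd z h)) (cexp z)) (Cmul (cexp z) h))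
    with (Cmul (cexp z) (Csub (Csub (cexp h) C1) (Cmul C1 h))) by (rewrite cexp_add; ring).
  rewrite Cmod_mul, Cmod_cexp.
  apply (Rmult_le_compat_l (exp (fst z))) in H; [|lra].
  replace (exp (fst z) * (eps / exp (fst z) * Cmod h)) with (eps * Cmod h) in H by (field; lra).
  exact H.
Qed.

(** Cauchy-Riemann: the gradients (Re c, -Im c) of the real part and (Im c, Re c) of the imaginary
    part are what makes the real and imaginary parts of f dz closed. *)
Lemma cdiff_rdiff2_fst f x y c : cdiff f (x, y) c ->
  rdiff2 (fun s t => fst (f (s, t))) x y (fst c) (- snd c).
Proof.
  intros H eps He. destruct (H eps He) as [d [Hd Hf]]. exists (d / 2); split; [lra|].
  intros h k Hh Hk. assert (B := Cmod_le_abs (h, k)). cbn [fst snd] in B.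
  specialize (Hf (h, k) ltac:(lra)). eapply Rle_trans; [|eapply Rle_trans; [apply Hf|]].
  - eapply Rle_trans; [|apply fst_le_Cmod]. right. f_equal.
    unfold Csub, Cmul, Cadd; cbn [fst snd]. ring.
  - apply Rmult_le_compat_l; lra.
Qed.

Lemma cdiff_rdiff2_snd f x y c : cdiff f (x, y) c ->
  rdiff2 (fun s t => snd (f (s, t))) x y (snd c) (fst c).
Proof.
  intros H eps He. destruct (H eps He) as [d [Hd Hf]]. exists (d / 2); split; [lra|].
  intros h k Hh Hk. assert (B := Cmod_le_abs (h, k)). cbn [fst snd] in B.
  specialize (Hf (h, k) ltac:(lra)). eapply Rle_trans; [|eapply Rle_trans; [apply Hf|]].
  - eapply Rle_trans; [|apply snd_le_Cmod]. right. f_equal.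
    unfold Csub, Cmul, Cadd; cbn [fst snd]. ring.
  - apply Rmult_le_compat_l; lra.
Qed.

Lemma rdiff2_opp P x y a b : rdiff2 P x y a b -> rdiff2 (fun s t => - P s t) x y (- a) (- b).
Proof.
  intros H eps He. destruct (H eps He) as [d [Hd HP]]. exists d; split; [exact Hd|].
  intros h k Hh Hk. rewrite <- Rabs_Ropp.
  replace (- (- P (x + h) (y + k) - - P x y - - a * h - - b * k))
    with (P (x + h) (y + k) - P x y - a * h - b * k) by ring. now apply HP.
Qed.

Lemma ex_RInt_cdiff_fst f x y1 y2 : (forall y, exists c, cdiff f (x, y) c) ->
  ex_RInt (fun y => fst (f (x, y))) y1 y2.
Proof.
  intro H. apply (ex_RInt_continuous (fun y => fst (f (x, y)))). intros y _.
  destruct (H y) as [c Hc]. apply (rdiff2_continuous _ _ _ _ _ (cdiff_rdiff2_fst _ _ _ _ Hc)).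
Qed.

Lemma ex_RInt_cdiff_snd f x y1 y2 : (forall y, exists c, cdiff f (x, y) c) ->
  ex_RInt (fun y => snd (f (x, y))) y1 y2.
Proof.
  intro H. apply (ex_RInt_continuous (fun y => snd (f (x, y)))). intros y _.
  destruct (H y) as [c Hc]. apply (rdiff2_continuous _ _ _ _ _ (cdiff_rdiff2_snd _ _ _ _ Hc)).
Qed.

(** In the polar coordinates z -> s + cexp z, vertical segments of length 2 PI stand for circles
    about s. The integral of f dz = (u dx - v dy) + i (v dx + u dy) around the rectangle vanishes,
    the horizontal sides cancel by periodicity, and the vertical sides remain. The imaginary part of
    the form gives the first equality, the real part the second. *)
Lemma periodic_integral_const f x1 x2 :
  x1 <= x2 -> (forall x y, x <= x2 -> exists c, cdiff f (x, y) c) ->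
  (forall x, f (x, 2 * PI) = f (x, 0)) ->
  RInt (fun y => fst (f (x1, y))) 0 (2 * PI) = RInt (fun y => fst (f (x2, y))) 0 (2 * PI) /\
  RInt (fun y => snd (f (x1, y))) 0 (2 * PI) = RInt (fun y => snd (f (x2, y))) 0 (2 * PI).
Proof.
  intros Hx Hf Hp. assert (HPI := PI_RGT_0).
  assert (Z : forall g : R -> R, (forall x, g x = 0) -> RInt g x1 x2 = 0).
  { intros g Hg. rewrite (RInt_ext g (fun _ => 0)) by (intros; apply Hg).
    rewrite RInt_const. unfold scal; simpl; unfold mult; simpl; ring. }
  split.
  - generalize (closed_form_circulation (fun s t => snd (f (s, t))) (fun s t => fst (f (s, t)))
       x1 x2 0 (2 * PI)). intro G.
    unfold circulation in G. rewrite Z in G by (intro; rewrite Hp; ring).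
    rewrite (RInt_ext _ (fun y => minus (fst (f (x2, y))) (fst (f (x1, y))))) in G
      by (intros; unfold minus, plus, opp; simpl; ring).
    rewrite (RInt_minus (fun y => fst (f (x2, y))) (fun y => fst (f (x1, y)))) in G; [|apply ex_RInt_cdiff_fst; intro; apply Hf; lra
                             |apply ex_RInt_cdiff_fst; intro; apply Hf; lra].
    unfold minus, plus, opp in G; simpl in G.
    assert (E := G ltac:(idtac;
      intros x y Hxx _; destruct (Hf x y ltac:(lra)) as [c Hc];
      exists (snd c), (fst c), (- snd c); split;
      [now apply cdiff_rdiff2_snd|now apply cdiff_rdiff2_fst]) Hx ltac:(lra)). lra.
  - generalize (closed_form_circulation (fun s t => fst (f (s, t))) (fun s t => - snd (f (s, t)))
       x1 x2 0 (2 * PI)). intro G.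
    unfold circulation in G. rewrite Z in G by (intro; rewrite Hp; ring).
    rewrite (RInt_ext _ (fun y => minus (snd (f (x1, y))) (snd (f (x2, y))))) in G
      by (intros; unfold minus, plus, opp; simpl; ring).
    rewrite (RInt_minus (fun y => snd (f (x1, y))) (fun y => snd (f (x2, y)))) in G; [|apply ex_RInt_cdiff_snd; intro; apply Hf; lra
                             |apply ex_RInt_cdiff_snd; intro; apply Hf; lra].
    unfold minus, plus, opp in G; simpl in G.
    assert (E := G ltac:(idtac;
      intros x y Hxx _; destruct (Hf x y ltac:(lra)) as [c Hc];
      exists (fst c), (- snd c), (- fst c); split;
      [now apply cdiff_rdiff2_fst|apply rdiff2_opp; now apply cdiff_rdiff2_snd]) Hx ltac:(lra)). lra.
Qed.

(** Decreasing x shrinks the circle towards its centre. Since the integral does not depend on x, it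
    is enough that for each eps the values on one vertical line are close to [l]. *)
Lemma periodic_integral_limit f x2 l :
  (forall x y, x <= x2 -> exists c, cdiff f (x, y) c) ->
  (forall x, f (x, 2 * PI) = f (x, 0)) ->
  (forall eps, 0 < eps -> exists x, x <= x2 /\ forall y, Cmod (Csub (f (x, y)) l) <= eps) ->
  RInt (fun y => fst (f (x2, y))) 0 (2 * PI) = 2 * PI * fst l /\
  RInt (fun y => snd (f (x2, y))) 0 (2 * PI) = 2 * PI * snd l.
Proof.
  intros Hf Hp Hl. assert (HPI := PI_RGT_0).
  assert (Hz : forall A, (forall eps, 0 < eps -> Rabs A <= eps * (2 * PI)) -> A = 0).
  { intros A HA. destruct (Req_dec A 0) as [E|E]; [exact E|]. apply Rabs_pos_lt in E.
    specialize (HA (Rabs A / (4 * PI)) ltac:(apply Rdiv_lt_0_compat; lra)).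
    replace (Rabs A / (4 * PI) * (2 * PI)) with (Rabs A / 2) in HA by (field; lra). lra. }
  split; apply Rminus_diag_uniq, Hz; intros eps He;
    destruct (Hl eps He) as [x [Hx Hxl]];
    destruct (periodic_integral_const f x x2 Hx Hf Hp) as [E1 E2].
  - rewrite <- E1. generalize (RInt_near_const (fun y => fst (f (x, y))) 0 (2 * PI) (fst l) eps).
    rewrite Rminus_0_r, (Rmult_comm (fst l)). intro G; apply G; [lra| |].
    + apply ex_RInt_cdiff_fst; intro; now apply Hf.
    + intros y _. eapply Rle_trans; [apply (fst_le_Cmod (Csub (f (x, y)) l))|apply Hxl].
  - rewrite <- E2. generalize (RInt_near_const (fun y => snd (f (x, y))) 0 (2 * PI) (snd l) eps).
    rewrite Rminus_0_r, (Rmult_comm (snd l)). intro G; apply G; [lra| |].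
    + apply ex_RInt_cdiff_snd; intro; now apply Hf.
    + intros y _. eapply Rle_trans; [apply (snd_le_Cmod (Csub (f (x, y)) l))|apply Hxl].
Qed.

(** * Cauchy estimates in one variable *)

Lemma cdiff_translate g a z c : cdiff g z c -> cdiff (fun w => Cadd a (g w)) z c.
Proof.
  intros Hg eps He. destruct (Hg eps He) as [d [Hd H]]. exists d; split; [exact Hd|].
  intros h Hh. replace (Csub (Cadd a (g (Cadd z h))) (Cadd a (g z)))
    with (Csub (g (Cadd z h)) (g z)) by ring. now apply H.
Qed.

Lemma cdiff_opp z : cdiff Copp z (Copp C1).
Proof.
  intros eps He. exists 1; split; [lra|]. intros h _.
  replace (Csub (Csub (Copp (Cadd z h)) (Copp z)) (Cmul (Copp C1) h)) with C0 by ring.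
  rewrite Cmod_C0. apply Rmult_le_pos; [lra|apply Cmod_ge_0].
Qed.

Lemma cexp_period x : cexp (x, 2 * PI) = cexp (x, 0).
Proof. unfold cexp; cbn [fst snd]. now rewrite cos_2PI, sin_2PI, cos_0, sin_0. Qed.

Lemma cexp_opp_period x : cexp (Copp (x, 2 * PI)) = cexp (Copp (x, 0)).
Proof.
  unfold cexp, Copp; cbn [fst snd].
  now rewrite !cos_neg, !sin_neg, cos_2PI, sin_2PI, cos_0, sin_0.
Qed.

Definition cholo (f : C -> C) (s : C) (R : R) : Prop :=
  forall w, Cmod (Csub w s) < R -> exists c, cdiff f w c.

Lemma cholo_center f s R : 0 < R -> cholo f s R -> exists c, cdiff f s c.
Proof. intros HR H. apply H. replace (Csub s s) with C0 by ring. now rewrite Cmod_C0. Qed.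

Lemma cholo_sub f s R w r : cholo f s R -> Cmod (Csub w s) + r <= R -> cholo f w r.
Proof.
  intros H Hr v Hv. apply H.
  replace (Csub v s) with (Cadd (Csub v w) (Csub w s)) by ring.
  eapply Rle_lt_trans; [apply Cmod_add|]. lra.
Qed.

Lemma cdiff_polar f s R x y : cholo f s R -> exp x < R ->
  exists c, cdiff (fun z => f (Cadd s (cexp z))) (x, y) c.
Proof.
  intros Hf Hx. destruct (Hf (Cadd s (cexp (x, y)))) as [c Hc].
  - replace (Csub (Cadd s (cexp (x, y))) s) with (cexp (x, y)) by ring. now rewrite Cmod_cexp.
  - eexists. apply (cdiff_comp f (fun z => Cadd s (cexp z))); [|exact Hc].
    apply cdiff_translate, cdiff_cexp.
Qed.

Lemma exp_le_ln x r : 0 < r -> x <= ln r -> exp x <= r.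
Proof.
  intros Hr [H|H]; [left|right]; rewrite <- (exp_ln r Hr) by exact Hr.
  - now apply exp_increasing.
  - now f_equal.
Qed.

Lemma circle_mean f s R r : 0 < r < R -> cholo f s R ->
  RInt (fun y => fst (f (Cadd s (cexp (ln r, y))))) 0 (2 * PI) = 2 * PI * fst (f s) /\
  RInt (fun y => snd (f (Cadd s (cexp (ln r, y))))) 0 (2 * PI) = 2 * PI * snd (f s).
Proof.
  intros Hr Hf. apply (periodic_integral_limit (fun z => f (Cadd s (cexp z)))).
  - intros x y Hx. apply (cdiff_polar f s R); [exact Hf|].
    apply Rle_lt_trans with r; [apply exp_le_ln; lra|lra].
  - intro x; now rewrite cexp_period.
  - intros eps He. destruct (cholo_center f s R ltac:(lra) Hf) as [c Hc].
    destruct (cdiff_lipschitz _ _ _ Hc) as [d [Hd H]].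
    assert (Pc := Cmod_ge_0 c).
    set (q := Rmin (Rmin (d / 2) r) (eps / (Cmod c + 1))).
    assert (Hq : 0 < q).
    { unfold q; repeat apply Rmin_pos; try lra. apply Rdiv_lt_0_compat; lra. }
    assert (B1 := Rmin_l (Rmin (d / 2) r) (eps / (Cmod c + 1))). fold q in B1.
    assert (B2 := Rmin_r (Rmin (d / 2) r) (eps / (Cmod c + 1))). fold q in B2.
    assert (B3 := Rmin_l (d / 2) r). assert (B4 := Rmin_r (d / 2) r).
    exists (ln q); split.
    + destruct (Req_dec q r) as [->|Hn]; [lra|]. left. apply ln_increasing; lra.
    + intro y. assert (Hm : Cmod (cexp (ln q, y)) = q).
      { rewrite Cmod_cexp; cbn [fst]. now apply exp_ln. }
      eapply Rle_trans; [apply H; lra|]. rewrite Hm.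
      apply (Rmult_le_compat_l (Cmod c + 1)) in B2; [|lra].
      replace ((Cmod c + 1) * (eps / (Cmod c + 1))) with eps in B2 by (field; lra). exact B2.
Qed.

(* The first Taylor coefficient as the circle mean of (f(s + w) - f(s)) / w. *)
Lemma circle_mean_deriv f s R r c : 0 < r < R -> cholo f s R -> cdiff f s c ->
  let q z := Cmul (Csub (f (Cadd s (cexp z))) (f s)) (cexp (Copp z)) in
  RInt (fun y => fst (q (ln r, y))) 0 (2 * PI) = 2 * PI * fst c /\
  RInt (fun y => snd (q (ln r, y))) 0 (2 * PI) = 2 * PI * snd c /\
  forall y, exists e, cdiff q (ln r, y) e.
Proof.
  intros Hr Hf Hc q.
  assert (Hq : forall x y, x <= ln r -> exists c, cdiff q (x, y) c).
  { intros x y Hx. destruct (cdiff_polar f s R x y Hf) as [e He].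
    { apply Rle_lt_trans with r; [apply exp_le_ln; lra|lra]. }
    eexists. apply cdiff_mul.
    - apply cdiff_sub; [exact He|apply cdiff_const].
    - apply (cdiff_comp cexp Copp); [apply cdiff_opp|apply cdiff_cexp]. }
  assert (Hl : RInt (fun y => fst (q (ln r, y))) 0 (2 * PI) = 2 * PI * fst c /\
               RInt (fun y => snd (q (ln r, y))) 0 (2 * PI) = 2 * PI * snd c).
  { apply periodic_integral_limit; [exact Hq| |].
    - intro x; unfold q; now rewrite cexp_period, cexp_opp_period.
    - intros eps He. destruct (Hc eps He) as [d [Hd H]].
      set (p := Rmin (d / 2) r). assert (Hp : 0 < p) by (unfold p; apply Rmin_pos; lra).
      assert (B1 := Rmin_l (d / 2) r). assert (B2 := Rmin_r (d / 2) r). fold p in B1, B2.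
      exists (ln p); split.
      + destruct (Req_dec p r) as [->|Hn]; [lra|]. left. apply ln_increasing; lra.
      + intro y. set (w := cexp (ln p, y)).
        assert (Hm : Cmod w = p).
        { unfold w; rewrite Cmod_cexp; cbn [fst]. now apply exp_ln. }
        assert (Hw : Cmul w (cexp (Copp (ln p, y))) = C1).
        { unfold w; rewrite <- cexp_add.
          replace (Cadd (ln p, y) (Copp (ln p, y))) with C0 by ring. apply cexp_0. }
        specialize (H w ltac:(lra)).
        replace (Csub (q (ln p, y)) c)
          with (Cmul (Csub (Csub (f (Cadd s w)) (f s)) (Cmul c w)) (cexp (Copp (ln p, y)))).
        2:{ unfold q; fold w.
            replace c with (Cmul c (Cmul w (cexp (Copp (ln p, y))))) at 2 by (rewrite Hw; ring).
            ring. }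
        rewrite Cmod_mul. rewrite Hm in H.
        apply (f_equal Cmod) in Hw. rewrite Cmod_mul, Hm, Cmod_C1 in Hw.
        eapply Rle_trans; [apply Rmult_le_compat_r; [apply Cmod_ge_0|apply H]|].
        rewrite Rmult_assoc, Hw. lra. }
  destruct Hl as [H1 H2]. repeat split; [exact H1|exact H2|].
  intro y; apply Hq; lra.
Qed.

(** The constant 8 is three factors 2: the circle has radius R / 2, the difference f(s + w) - f(s)
    is bounded by 2 M, and real and imaginary parts are estimated separately. *)
Lemma cauchy_estimate f s R M c : 0 < R -> cholo f s R ->
  (forall w, Cmod (Csub w s) < R -> Cmod (f w) <= M) -> cdiff f s c -> Cmod c <= 8 * M / R.
Proof.
  intros HR Hf HM Hc. assert (HPI := PI_RGT_0).
  set (r := R / 2). assert (Hr : 0 < r < R) by (unfold r; lra).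
  destruct (circle_mean_deriv f s R r c Hr Hf Hc) as (E1 & E2 & Hq).
  set (q := fun z => Cmul (Csub (f (Cadd s (cexp z))) (f s)) (cexp (Copp z))) in *.
  assert (HB : forall y, Cmod (q (ln r, y)) <= 4 * M / R).
  { intro y. unfold q. rewrite Cmod_mul, Cmod_cexp. unfold Copp; cbn [fst snd].
    rewrite exp_Ropp, exp_ln by lra.
    replace (4 * M / R) with ((M + M) * / r) by (unfold r; field; lra).
    apply Rmult_le_compat_r; [apply Rlt_le, Rinv_0_lt_compat; lra|].
    eapply Rle_trans; [apply Cmod_sub|]. apply Rplus_le_compat; apply HM.
    - replace (Csub (Cadd s (cexp (ln r, y))) s) with (cexp (ln r, y)) by ring.
      rewrite Cmod_cexp; cbn [fst]. rewrite exp_ln; lra.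
    - replace (Csub s s) with C0 by ring. now rewrite Cmod_C0. }
  assert (K : forall a I, I = 2 * PI * a -> Rabs (I - 0 * (2 * PI - 0)) <= 4 * M / R * (2 * PI - 0) ->
     Rabs a <= 4 * M / R).
  { intros a I -> H. rewrite Rmult_0_l, Rminus_0_r, Rminus_0_r, Rabs_mult, Rabs_pos_eq in H by lra.
    apply Rmult_le_reg_l with (2 * PI); [lra|]. lra. }
  assert (F1 : Rabs (fst c) <= 4 * M / R).
  { eapply K; [exact E1|]. apply (RInt_near_const (fun y => fst (q (ln r, y))) 0 (2 * PI) 0 (4 * M / R)); [lra|now apply (ex_RInt_cdiff_fst q)|].
    intros y _. rewrite Rminus_0_r. eapply Rle_trans; [apply fst_le_Cmod|apply HB]. }
  assert (F2 : Rabs (snd c) <= 4 * M / R).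
  { eapply K; [exact E2|]. apply (RInt_near_const (fun y => snd (q (ln r, y))) 0 (2 * PI) 0 (4 * M / R)); [lra|now apply (ex_RInt_cdiff_snd q)|].
    intros y _. rewrite Rminus_0_r. eapply Rle_trans; [apply snd_le_Cmod|apply HB]. }
  eapply Rle_trans; [apply Cmod_le_abs|]. replace (8 * M / R) with (4 * M / R + 4 * M / R) by (field; lra).
  lra.
Qed.

(** Multiplication by conj(f(0)) turns the comparison of moduli into one of real parts: at the
    centre the real part is |f(0)|^2, on the circle of radius R / 2 it is strictly smaller, and this
    contradicts the mean value property. *)
Lemma strict_maximum_principle f R : 0 < R -> cholo f C0 R ->
  ~ (forall s, 0 < Cmod s < R -> Cmod (f s) < Cmod (f C0)).
Proof.
  intros HR Hf Hmax. assert (HPI := PI_RGT_0).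
  set (r := R / 2). assert (Hr : 0 < r < R) by (unfold r; lra).
  set (a := Cconj (f C0)).
  set (g := fun z => Cmul a (f z)).
  assert (Hg : cholo g C0 R).
  { intros w Hw. destruct (Hf w Hw) as [c Hc]. eexists. apply cdiff_mul; [apply cdiff_const|exact Hc]. }
  destruct (circle_mean g C0 R r Hr Hg) as [E _].
  assert (Ha : fst (g C0) = Cmod (f C0) * Cmod (f C0)).
  { unfold g, a. rewrite Cmod_sqr. unfold Cmul, Cconj; cbn [fst snd]; ring. }
  assert (Hlt : RInt (fun y => fst (g (Cadd C0 (cexp (ln r, y))))) 0 (2 * PI)
                < RInt (fun _ => fst (g C0)) 0 (2 * PI)).
  { assert (Hpol : forall y, exists c, cdiff (fun z => g (Cadd C0 (cexp z))) (ln r, y) c).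
    { intro y. apply (cdiff_polar g C0 R); [exact Hg|]. rewrite exp_ln; lra. }
    apply RInt_lt; [lra| | |].
    - intros; apply continuous_const.
    - intros y _. destruct (Hpol y) as [c Hc].
      apply (rdiff2_continuous _ _ _ _ _ (cdiff_rdiff2_fst _ _ _ _ Hc)).
    - intros y _. replace (Cadd C0 (cexp (ln r, y))) with (cexp (ln r, y)) by ring.
      specialize (Hmax (cexp (ln r, y))). rewrite Cmod_cexp in Hmax; cbn [fst] in Hmax.
      rewrite exp_ln in Hmax by lra. specialize (Hmax Hr). rewrite Ha.
      apply Rle_lt_trans with (Cmod (g (cexp (ln r, y)))).
      + eapply Rle_trans; [apply Rle_abs|apply fst_le_Cmod].
      + unfold g, a. rewrite Cmod_mul, Cmod_conj.
        assert (P := Cmod_ge_0 (f (cexp (ln r, y)))). apply Rmult_lt_compat_l; lra. }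
  rewrite E, RInt_const in Hlt. unfold scal in Hlt; simpl in Hlt; unfold mult in Hlt; simpl in Hlt.
  lra.
Qed.

(** * Taylor estimates along segments and the identity principle *)

Lemma cdiff_is_derive_line f a h t c : cdiff f (Cadd a (Cmul (RtoC t) h)) c ->
  is_derive (fun u => fst (f (Cadd a (Cmul (RtoC u) h)))) t (fst (Cmul c h)) /\
  is_derive (fun u => snd (f (Cadd a (Cmul (RtoC u) h)))) t (snd (Cmul c h)).
Proof.
  intro Hc. assert (Ph := Cmod_ge_0 h).
  assert (K : forall eps, 0 < eps -> exists d, 0 < d /\ forall k, Rabs k < d ->
     Cmod (Csub (Csub (f (Cadd a (Cmul (RtoC (t + k)) h))) (f (Cadd a (Cmul (RtoC t) h))))
                (Cmul (RtoC k) (Cmul c h))) <= eps * Rabs k).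
  { intros eps He. destruct (Hc (eps / (Cmod h + 1))) as [d [Hd H]]; [apply Rdiv_lt_0_compat; lra|].
    exists (d / (Cmod h + 1)). split; [apply Rdiv_lt_0_compat; lra|]. intros k Hk.
    assert (Pk := Rabs_pos k).
    specialize (H (Cmul (RtoC k) h)). rewrite Cmod_mul, Cmod_RtoC in H.
    assert (Hk2 : Rabs k * (Cmod h + 1) < d).
    { apply (Rmult_lt_compat_r (Cmod h + 1)) in Hk; [|lra].
      replace (d / (Cmod h + 1) * (Cmod h + 1)) with d in Hk by (field; lra). exact Hk. }
    specialize (H ltac:(nra)).
    replace (Cadd (Cadd a (Cmul (RtoC t) h)) (Cmul (RtoC k) h))
      with (Cadd a (Cmul (RtoC (t + k)) h)) in H.
    2:{ replace (RtoC (t + k)) with (Cadd (RtoC t) (RtoC k));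
          [ring|unfold Cadd, RtoC; cbn [fst snd]; f_equal; ring]. }
    replace (Cmul (RtoC k) (Cmul c h)) with (Cmul c (Cmul (RtoC k) h)) by ring.
    eapply Rle_trans; [apply H|].
    replace (eps * Rabs k) with (eps / (Cmod h + 1) * (Rabs k * (Cmod h + 1))) by (field; lra).
    apply Rmult_le_compat_l; [apply Rlt_le, Rdiv_lt_0_compat; lra|nra]. }
  split; apply eps_is_derive; intros eps He; destruct (K eps He) as [d [Hd H]];
    exists d; (split; [exact Hd|]); intros k Hk; (eapply Rle_trans; [|apply (H k Hk)]).
  - eapply Rle_trans; [|apply fst_le_Cmod]. right; f_equal.
    unfold Csub, Cmul, RtoC; cbn [fst snd]; ring.
  - eapply Rle_trans; [|apply snd_le_Cmod]. right; f_equal.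
    unfold Csub, Cmul, RtoC; cbn [fst snd]; ring.
Qed.

(** One integration in Taylor's estimate. With n = 0 it is the mean value inequality; iterated, it
    produces the factorials in [identity_principle]. The mean value theorem is used instead of an
    integral because [du] need not be continuous. *)
Lemma derive_power_bound (u du : R -> R) A n : 0 <= A -> u 0 = 0 ->
  (forall t, 0 <= t <= 1 -> is_derive u t (du t) /\ Rabs (du t) <= A * t ^ n) ->
  forall t, 0 <= t <= 1 -> Rabs (u t) <= A * t ^ S n / INR (S n).
Proof.
  intros HA H0 Hu t Ht. assert (Hn : 0 < INR (S n)) by (apply lt_0_INR; lia).
  assert (K : forall e, e = 1 \/ e = -1 -> e * u t <= A * t ^ S n / INR (S n)).
  { intros e He.
    set (w := fun x => A * x ^ S n / INR (S n) - e * u x).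
    assert (Hw : forall x, 0 <= x <= t -> is_derive w x (A * x ^ n - e * du x)).
    { intros x Hx. destruct (Hu x ltac:(lra)) as [D _]. unfold w.
      apply (is_derive_minus (fun x => A * x ^ S n / INR (S n)) (fun x => e * u x)).
      - auto_derive; [trivial|]. replace (match n with 0%nat => 1 | S _ => INR n + 1 end) with (INR (S n)).
        + simpl Nat.pred. field. lra.
        + reflexivity.
      - now apply is_derive_scal. }
    destruct (MVT_gen w 0 t (fun x => A * x ^ n - e * du x)) as [x [Hx E]].
    - intros x Hx. apply Hw. rewrite Rmin_left, Rmax_right in Hx; lra.
    - intros x Hx. rewrite Rmin_left, Rmax_right in Hx by lra.
      apply continuity_pt_filterlim. apply (ex_derive_continuous w). eexists; now apply Hw.
    - rewrite Rmin_left, Rmax_right in Hx by lra.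
      assert (w 0 = 0) by (unfold w; rewrite H0, pow_i by lia; unfold Rdiv; ring).
      destruct (Hu x ltac:(lra)) as [_ B]. apply Rabs_le_between in B.
      assert (0 <= A * x ^ n - e * du x) by (destruct He as [-> | ->]; lra).
      assert (0 <= w t) by nra. unfold w in *. lra. }
  apply Rabs_le. generalize (K 1 ltac:(lra)) (K (-1) ltac:(lra)). lra.
Qed.

Lemma segment_mean_value f a h B : 
  (forall t, 0 <= t <= 1 -> exists c, cdiff f (Cadd a (Cmul (RtoC t) h)) c /\ Cmod c <= B) ->
  Cmod (Csub (f (Cadd a h)) (f a)) <= 2 * B * Cmod h.
Proof.
  intro H.
  assert (HB : 0 <= B).
  { destruct (H 0 ltac:(lra)) as [c [_ Hc]]. generalize (Cmod_ge_0 c); lra. }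
  set (der := fun t => epsilon (inhabits C0) (fun c => cdiff f (Cadd a (Cmul (RtoC t) h)) c /\ Cmod c <= B)).
  assert (Hd : forall t, 0 <= t <= 1 -> cdiff f (Cadd a (Cmul (RtoC t) h)) (der t) /\ Cmod (der t) <= B).
  { intros t Ht. exact (epsilon_spec (inhabits C0) _ (H t Ht)). }
  assert (Ph := Cmod_ge_0 h).
  assert (Hb : forall t, 0 <= t <= 1 -> Cmod (Cmul (der t) h) <= B * Cmod h * t ^ 0).
  { intros t Ht. rewrite Cmod_mul; simpl; rewrite Rmult_1_r.
    apply Rmult_le_compat_r; [exact Ph|]. now apply Hd. }
  assert (E0 : Cadd a (Cmul (RtoC 0) h) = a) by (change (RtoC 0) with C0; ring).
  assert (E1 : Cadd a (Cmul (RtoC 1) h) = Cadd a h) by (change (RtoC 1) with C1; ring).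
  eapply Rle_trans; [apply Cmod_le_abs|].
  assert (F1 := derive_power_bound
    (fun u => fst (f (Cadd a (Cmul (RtoC u) h))) - fst (f a)) (fun t => fst (Cmul (der t) h)) (B * Cmod h) 0
    ltac:(nra) ltac:(cbv beta; rewrite E0; ring)).
  assert (F2 := derive_power_bound
    (fun u => snd (f (Cadd a (Cmul (RtoC u) h))) - snd (f a)) (fun t => snd (Cmul (der t) h)) (B * Cmod h) 0
    ltac:(nra) ltac:(cbv beta; rewrite E0; ring)).
  assert (Z : forall (u : R -> R) k t l, is_derive u t l -> is_derive (fun x => u x - k) t l).
  { intros u k t l Hu. replace l with (minus l 0) by (unfold minus, plus, opp; simpl; ring).
    apply (is_derive_minus u (fun _ => k)); [exact Hu|exact (is_derive_const k t)]. }
  specialize (F1 ltac:(intros t Ht; split;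
    [apply Z; apply cdiff_is_derive_line; now apply Hd
    |eapply Rle_trans; [apply fst_le_Cmod|now apply Hb]]) 1 ltac:(lra)).
  specialize (F2 ltac:(intros t Ht; split;
    [apply Z; apply cdiff_is_derive_line; now apply Hd
    |eapply Rle_trans; [apply snd_le_Cmod|now apply Hb]]) 1 ltac:(lra)).
  cbv beta in F1, F2. rewrite E1 in F1, F2. simpl in F1, F2.
  unfold Csub; cbn [fst snd]. lra.
Qed.

(** The second derivative is avoided. The difference f'(w) - f'(0) is the derivative at 0 of v ->
    f(v + w) - f(v), a function of size O(|w|) by the mean value inequality, so Cauchy's estimate
    bounds it by a multiple of |w|. The mean value inequality for f(w) - c w then gives the
    quadratic bound, with 2048 rounded up to 10000. *)
Lemma cauchy_second_order f R M c : 0 < R -> cholo f C0 R ->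
  (forall w, Cmod w < R -> Cmod (f w) <= M) -> cdiff f C0 c ->
  forall h, Cmod h <= R / 8 ->
    Cmod (Csub (Csub (f h) (f C0)) (Cmul c h)) <= 10000 * M / (R * R) * (Cmod h * Cmod h).
Proof.
  intros HR Hf HM Hc h Hh.
  assert (HM0 : 0 <= M).
  { apply Rle_trans with (Cmod (f C0)); [apply Cmod_ge_0|apply HM; now rewrite Cmod_C0]. }
  assert (Z : forall w, Csub w C0 = w) by (intro; ring).
  assert (D1 : forall w e, Cmod w <= R / 2 -> cdiff f w e -> Cmod e <= 16 * M / R).
  { intros w e Hw He. replace (16 * M / R) with (8 * M / (R / 2)) by (field; lra).
    apply (cauchy_estimate f w); [lra| | |exact He].
    - apply (cholo_sub f C0 R); [exact Hf|rewrite Z; lra].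
    - intros v Hv. apply HM. replace v with (Cadd (Csub v w) w) by ring.
      eapply Rle_lt_trans; [apply Cmod_add|lra]. }
  assert (D2 : forall w e, Cmod w <= R / 8 -> cdiff f w e ->
     Cmod (Csub e c) <= 1024 * M / (R * R) * Cmod w).
  { intros w e Hw He.
    replace (1024 * M / (R * R) * Cmod w)
      with (8 * (2 * (16 * M / R) * Cmod w) / (R / 4)) by (field; lra).
    apply (cauchy_estimate (fun v => Csub (f (Cadd v w)) (f v)) C0); [lra| | |].
    - intros v Hv. rewrite Z in Hv.
      destruct (Hf (Cadd v w)) as [e1 He1].
      { rewrite Z. eapply Rle_lt_trans; [apply Cmod_add|lra]. }
      destruct (Hf v) as [e2 He2]; [rewrite Z; lra|].
      eexists. apply cdiff_sub; [|exact He2]. apply cdiff_shift, He1.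
    - intros v Hv. rewrite Z in Hv. apply segment_mean_value. intros t Ht.
      assert (Hvt : Cmod (Cadd v (Cmul (RtoC t) w)) <= R / 2).
      { eapply Rle_trans; [apply Cmod_add|]. rewrite Cmod_mul, Cmod_RtoC, Rabs_pos_eq by lra.
        generalize (Cmod_ge_0 w); nra. }
      destruct (Hf (Cadd v (Cmul (RtoC t) w))) as [e1 He1]; [rewrite Z; lra|].
      exists e1; split; [exact He1|]. now apply (D1 _ _ Hvt).
    - apply cdiff_sub; [|exact Hc]. apply cdiff_shift.
      replace (Cadd C0 w) with w by ring. exact He. }
  assert (S := segment_mean_value (fun w => Csub (f w) (Cmul c w)) C0 h (1024 * M / (R * R) * Cmod h)).
  replace (Cadd C0 h) with h in S by ring.
  replace (Csub (Csub (f h) (f C0)) (Cmul c h))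
    with (Csub (Csub (f h) (Cmul c h)) (Csub (f C0) (Cmul c C0))) by ring.
  eapply Rle_trans; [apply S|].
  - intros t Ht. replace (Cadd C0 (Cmul (RtoC t) h)) with (Cmul (RtoC t) h) by ring.
    assert (Hth : Cmod (Cmul (RtoC t) h) <= Cmod h).
    { rewrite Cmod_mul, Cmod_RtoC, Rabs_pos_eq by lra. generalize (Cmod_ge_0 h); nra. }
    destruct (Hf (Cmul (RtoC t) h)) as [e He]; [rewrite Z; lra|].
    exists (Csub e c). split.
    + apply cdiff_sub; [exact He|].
      intros eps Hep. exists 1; split; [lra|]. intros k _.
      replace (Csub (Csub (Cmul c (Cadd (Cmul (RtoC t) h) k)) (Cmul c (Cmul (RtoC t) h))) (Cmul c k))
        with C0 by ring. rewrite Cmod_C0. apply Rmult_le_pos; [lra|apply Cmod_ge_0].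
    + eapply Rle_trans; [apply (D2 (Cmul (RtoC t) h) e); [lra|exact He]|].
      apply Rmult_le_compat_l; [|exact Hth].
      apply Rmult_le_pos; [lra|]. apply Rlt_le, Rinv_0_lt_compat; nra.
  - assert (K : 0 <= M / (R * R) * (Cmod h * Cmod h)).
    { apply Rmult_le_pos; [|apply Rmult_le_pos; apply Cmod_ge_0].
      apply Rmult_le_pos; [lra|]. apply Rlt_le, Rinv_0_lt_compat; nra. }
    unfold Rdiv in *. nra.
Qed.

(** A weak Stirling bound, from (1 + 1/m)^m <= exp 1 <= 3. It plays the n^n of
    [iterated_cauchy_estimate] off against the n! of Taylor's estimate. *)
Lemma pow_self_le_fact n : INR n ^ n <= 3 ^ n * INR (fact n).
Proof.
  induction n as [|n IH]; [simpl; lra|].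
  destruct n as [|n]; [simpl; lra|].
  set (m := S n) in *. assert (Hm : 0 < INR m) by (apply lt_0_INR; lia).
  assert (E : (1 + / INR m) ^ m <= 3).
  { apply Rle_trans with (exp 1); [|apply exp_le_3].
    apply Rle_trans with (exp (/ INR m) ^ m).
    - apply pow_incr. assert (0 < / INR m) by now apply Rinv_0_lt_compat.
      split; [lra|]. left; apply exp_ineq1; lra.
    - rewrite <- Rpower_pow by apply exp_pos. unfold Rpower. rewrite ln_exp.
      rewrite Rinv_r; lra. }
  change (fact (S m)) with ((S m) * fact m)%nat. rewrite mult_INR.
  change (INR (S m) ^ S m) with (INR (S m) * INR (S m) ^ m).
  replace (INR (S m)) with (INR m * (1 + / INR m)) at 2 by (rewrite S_INR; field; lra).
  rewrite Rpow_mult_distr. change (3 ^ S m) with (3 * 3 ^ m).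
  assert (0 <= INR (S m)) by apply pos_INR.
  replace (3 * 3 ^ m * (INR (S m) * INR (fact m))) with (INR (S m) * (3 ^ m * INR (fact m) * 3)) by ring.
  apply Rmult_le_compat_l; [assumption|].
  apply Rmult_le_compat; [apply pow_le; lra| |exact IH|exact E].
  apply pow_le. assert (0 < / INR m) by now apply Rinv_0_lt_compat. lra.
Qed.

(** The n differentiations share the available radius R / 2 equally. Each gives up R / (2 n) of it
    and costs a factor 8 / (R / (2 n)) = 16 n / R. *)
Lemma iterated_cauchy_estimate (F : nat -> C -> C) R M n : 0 < R ->
  (forall k w, Cmod w < R -> cdiff (F k) w (F (S k) w)) ->
  (forall w, Cmod w < R -> Cmod (F 0%nat w) <= M) ->
  forall w, Cmod w < R / 2 -> Cmod (F n w) <= M * (16 * INR n / R) ^ n.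
Proof.
  intros HR HF HM.
  destruct n as [|n].
  { intros w Hw. simpl. rewrite Rmult_1_r. apply HM. lra. }
  set (m := S n). assert (Hm : 0 < INR m) by (apply lt_0_INR; unfold m; lia).
  set (d := R / (2 * INR m)). assert (Hd : 0 < d) by (apply Rdiv_lt_0_compat; lra).
  assert (K : forall k, (k <= m)%nat -> forall w, Cmod w < R - INR k * d ->
     Cmod (F k w) <= M * (16 * INR m / R) ^ k).
  { induction k as [|k IH]; intros Hk w Hw.
    - simpl. rewrite Rmult_1_r. apply HM. simpl in Hw. lra.
    - rewrite S_INR in Hw. assert (0 <= INR k) by apply pos_INR.
      replace (M * (16 * INR m / R) ^ S k) with (8 * (M * (16 * INR m / R) ^ k) / d)
        by (unfold d; rewrite <- tech_pow_Rmult; field; repeat split; lra).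
      apply (cauchy_estimate (F k) w).
      + exact Hd.
      + intros v Hv. eexists. apply HF.
        replace v with (Cadd (Csub v w) w) by ring. eapply Rle_lt_trans; [apply Cmod_add|nra].
      + intros v Hv. apply IH; [lia|].
        replace v with (Cadd (Csub v w) w) by ring. eapply Rle_lt_trans; [apply Cmod_add|nra].
      + apply HF. nra. }
  intros w Hw. apply K; [lia|]. unfold d.
  replace (INR m * (R / (2 * INR m))) with (R / 2) by (field; lra). lra.
Qed.

(** Here [F k] is the k-th derivative. Integrating the bound on [F n] n times along the segment from
    0 gives |F 0 s| <= M (16 n / R)^n (2 |s|)^n / n!, where the 2 again accounts for real and
    imaginary parts. As n^n <= 3^n n!, this is at most M (96 |s| / R)^n, and |s| <= R / 200 makes
    the base smaller than 1/2. *)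
Lemma identity_principle (F : nat -> C -> C) R M : 0 < R ->
  (forall k w, Cmod w < R -> cdiff (F k) w (F (S k) w)) ->
  (forall w, Cmod w < R -> Cmod (F 0%nat w) <= M) ->
  (forall k, F k C0 = C0) ->
  forall s, Cmod s <= R / 200 -> F 0%nat s = C0.
Proof.
  intros HR HF HM H0 s Hs.
  assert (HM0 : 0 <= M).
  { apply Rle_trans with (Cmod (F 0%nat C0)); [apply Cmod_ge_0|apply HM; now rewrite Cmod_C0]. }
  assert (Ps := Cmod_ge_0 s).
  assert (Hseg : forall t, 0 <= t <= 1 -> Cmod (Cmul (RtoC t) s) <= R / 200).
  { intros t Ht. rewrite Cmod_mul, Cmod_RtoC, Rabs_pos_eq by lra. nra. }
  assert (Hn : forall n, Cmod (F 0%nat s) <= M * (/ 2) ^ n).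
  { intro n. set (B := M * (16 * INR n / R) ^ n).
    assert (HB0 : 0 <= B).
    { unfold B. apply Rmult_le_pos; [lra|]. apply pow_le.
      apply Rmult_le_pos; [|apply Rlt_le, Rinv_0_lt_compat; lra].
      generalize (pos_INR n); lra. }
    assert (K : forall k, (k <= n)%nat -> forall t, 0 <= t <= 1 ->
       Cmod (F (n - k)%nat (Cmul (RtoC t) s)) <= B * (2 * Cmod s) ^ k / INR (fact k) * t ^ k).
    { induction k as [|k IH]; intros Hk t Ht.
      - rewrite Nat.sub_0_r. simpl. unfold Rdiv; rewrite Rinv_1, !Rmult_1_r.
        apply (iterated_cauchy_estimate F R M n HR HF HM). specialize (Hseg t Ht). lra.
      - set (j := (n - S k)%nat). assert (Ej : (n - k)%nat = S j) by (unfold j; lia).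
        rewrite Ej in IH. specialize (IH ltac:(lia)).
        set (A := B * (2 * Cmod s) ^ k / INR (fact k)) in *.
        assert (Hf : 0 < INR (fact k)) by (apply lt_0_INR, lt_O_fact).
        assert (HA : 0 <= A).
        { unfold A. apply Rmult_le_pos; [|apply Rlt_le, Rinv_0_lt_compat; lra].
          apply Rmult_le_pos; [exact HB0|apply pow_le; lra]. }
        assert (Hd : forall u, 0 <= u <= 1 -> cdiff (F j) (Cadd C0 (Cmul (RtoC u) s)) (F (S j) (Cmul (RtoC u) s))).
        { intros u Hu. replace (Cadd C0 (Cmul (RtoC u) s)) with (Cmul (RtoC u) s) by ring.
          apply HF. specialize (Hseg u Hu). lra. }
        assert (Hb : forall u, 0 <= u <= 1 -> Cmod (Cmul (F (S j) (Cmul (RtoC u) s)) s) <= A * Cmod s * u ^ k).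
        { intros u Hu. rewrite Cmod_mul. specialize (IH u Hu).
          apply (Rmult_le_compat_r (Cmod s)) in IH; [|exact Ps]. lra. }
        assert (E0 : Cadd C0 (Cmul (RtoC 0) s) = C0) by (change (RtoC 0) with C0; ring).
        assert (F1 := derive_power_bound (fun u => fst (F j (Cadd C0 (Cmul (RtoC u) s))))
          (fun u => fst (Cmul (F (S j) (Cmul (RtoC u) s)) s)) (A * Cmod s) k
          ltac:(nra) ltac:(cbv beta; rewrite E0, H0; reflexivity)).
        assert (F2 := derive_power_bound (fun u => snd (F j (Cadd C0 (Cmul (RtoC u) s))))
          (fun u => snd (Cmul (F (S j) (Cmul (RtoC u) s)) s)) (A * Cmod s) k
          ltac:(nra) ltac:(cbv beta; rewrite E0, H0; reflexivity)).
        specialize (F1 ltac:(intros u Hu; split;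
          [apply cdiff_is_derive_line; now apply Hd
          |eapply Rle_trans; [apply fst_le_Cmod|now apply Hb]]) t Ht).
        specialize (F2 ltac:(intros u Hu; split;
          [apply cdiff_is_derive_line; now apply Hd
          |eapply Rle_trans; [apply snd_le_Cmod|now apply Hb]]) t Ht).
        cbv beta in F1, F2.
        replace (Cadd C0 (Cmul (RtoC t) s)) with (Cmul (RtoC t) s) in F1, F2 by ring.
        eapply Rle_trans; [apply Cmod_le_abs|].
        eapply Rle_trans; [apply Rplus_le_compat; [apply F1|apply F2]|]. right.
        assert (Hk1 : INR (S k) <> 0) by (apply not_0_INR; lia).
        change (fact (S k)) with ((S k) * fact k)%nat. rewrite mult_INR. unfold A.
        rewrite <- !tech_pow_Rmult. field. split; [lra|exact Hk1]. }
    specialize (K n (Nat.le_refl n) 1 ltac:(lra)). rewrite Nat.sub_diag, pow1, Rmult_1_r in K.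
    replace (Cmul (RtoC 1) s) with s in K by (change (RtoC 1) with C1; ring).
    eapply Rle_trans; [apply K|]. unfold B.
    assert (Hf : 0 < INR (fact n)) by (apply lt_0_INR, lt_O_fact).
    apply Rmult_le_reg_r with (INR (fact n)); [exact Hf|].
    replace (M * (16 * INR n / R) ^ n * (2 * Cmod s) ^ n / INR (fact n) * INR (fact n))
      with (M * (INR n ^ n * (32 * (Cmod s / R)) ^ n)).
    2:{ unfold Rdiv. rewrite !Rpow_mult_distr. replace 32 with (16 * 2) by lra.
        rewrite Rpow_mult_distr. field. lra. }
    rewrite !Rmult_assoc. apply Rmult_le_compat_l; [exact HM0|].
    assert (Hq : 0 <= Cmod s / R <= / 200).
    { split; [apply Rmult_le_pos; [exact Ps|apply Rlt_le, Rinv_0_lt_compat; lra]|].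
      apply Rmult_le_reg_r with R; [lra|]. unfold Rdiv. rewrite Rmult_assoc, Rinv_l by lra. lra. }
    apply Rle_trans with (3 ^ n * INR (fact n) * (32 * (Cmod s / R)) ^ n).
    - apply Rmult_le_compat_r; [apply pow_le; lra|apply pow_self_le_fact].
    - replace (3 ^ n * INR (fact n) * (32 * (Cmod s / R)) ^ n)
        with ((3 * (32 * (Cmod s / R))) ^ n * INR (fact n)) by (rewrite Rpow_mult_distr; ring).
      apply Rmult_le_compat_r; [lra|]. apply pow_incr; lra. }
  apply Cmod_eq_0. apply Rnot_lt_le; intro Hp.
  destruct (half_pow_small M (Cmod (F 0%nat s)) Hp) as [n Hlt].
  specialize (Hn n). rewrite pow_inv in Hn. unfold Rdiv in Hlt. lra.
Qed.

(** * Points of C^N *)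

Lemma sumR_ext f g n : (forall i, (i < n)%nat -> f i = g i) -> sumR f n = sumR g n.
Proof.
  induction n as [|n IH]; intro H; simpl; [reflexivity|].
  rewrite IH by (intros; apply H; lia). now rewrite H by lia.
Qed.

Lemma sumR_le f g n : (forall i, (i < n)%nat -> f i <= g i) -> sumR f n <= sumR g n.
Proof.
  induction n as [|n IH]; intro H; simpl; [lra|].
  generalize (IH ltac:(intros; apply H; lia)) (H n ltac:(lia)). lra.
Qed.

Lemma sumR_scal k f n : sumR (fun i => k * f i) n = k * sumR f n.
Proof. induction n as [|n IH]; simpl; [ring|rewrite IH; ring]. Qed.

Lemma sumR_nonneg f n : (forall i, (i < n)%nat -> 0 <= f i) -> 0 <= sumR f n.
Proof.
  induction n as [|n IH]; intro H; simpl; [lra|].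
  generalize (IH ltac:(intros; apply H; lia)) (H n ltac:(lia)). lra.
Qed.

Lemma sumR_const x n : sumR (fun _ => x) n = INR n * x.
Proof. induction n as [|n IH]; [simpl; ring|]. rewrite S_INR. simpl sumR. rewrite IH. ring. Qed.

Lemma sumC_ext f g n : (forall i, (i < n)%nat -> f i = g i) -> sumC f n = sumC g n.
Proof.
  induction n as [|n IH]; intro H; simpl; [reflexivity|].
  rewrite IH by (intros; apply H; lia). now rewrite H by lia.
Qed.

Lemma sumC_add f g n : sumC (fun i => Cadd (f i) (g i)) n = Cadd (sumC f n) (sumC g n).
Proof. induction n as [|n IH]; simpl; [ring|rewrite IH; ring]. Qed.

Lemma sumC_scal k f n : sumC (fun i => Cmul k (f i)) n = Cmul k (sumC f n).
Proof. induction n as [|n IH]; simpl; [ring|rewrite IH; ring]. Qed.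

Lemma sumC_zero f n : (forall i, (i < n)%nat -> f i = C0) -> sumC f n = C0.
Proof.
  induction n as [|n IH]; intro H; simpl; [reflexivity|].
  rewrite IH by (intros; apply H; lia). rewrite H by lia. ring.
Qed.

Lemma sumC_single f n i : (i < n)%nat ->
  (forall j, (j < n)%nat -> j <> i -> f j = C0) -> sumC f n = f i.
Proof.
  induction n as [|n IH]; intros Hi H; [lia|]. simpl.
  destruct (Nat.eq_dec i n) as [->|Hn].
  - rewrite sumC_zero by (intros j Hj; apply H; lia). ring.
  - rewrite IH by (try lia; intros j Hj; apply H; lia). rewrite (H n) by lia. ring.
Qed.

Lemma sumC_swap (f : nat -> nat -> C) n m :
  sumC (fun i => sumC (fun j => f i j) m) n = sumC (fun j => sumC (fun i => f i j) n) m.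
Proof.
  induction n as [|n IH]; simpl.
  - symmetry. now apply sumC_zero.
  - now rewrite IH, sumC_add.
Qed.

Lemma Cmod_sumC f n : Cmod (sumC f n) <= sumR (fun i => Cmod (f i)) n.
Proof.
  induction n as [|n IH]; simpl; [rewrite Cmod_C0; lra|].
  eapply Rle_trans; [apply Cmod_add|]. lra.
Qed.

Definition pzero : pt := fun _ => C0.
Definition pscal (s : C) (v : pt) : pt := fun i => Cmul s (v i).
Definition punit (i : nat) : pt := fun j => if Nat.eq_dec j i then C1 else C0.
Definition upd (z : pt) (i : nat) (w : C) : pt := fun j => if Nat.eq_dec j i then w else z j.

Lemma padd_zero z : padd z pzero = z.
Proof. apply functional_extensionality; intro i. unfold padd, pzero; ring. Qed.

Lemma padd_psub z w : padd z (psub w z) = w.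
Proof. apply functional_extensionality; intro i. unfold padd, psub; ring. Qed.

Lemma psub_padd z h : psub (padd z h) z = h.
Proof. apply functional_extensionality; intro i. unfold padd, psub; ring. Qed.

Lemma padd_assoc a b c : padd (padd a b) c = padd a (padd b c).
Proof. apply functional_extensionality; intro i. unfold padd; ring. Qed.

Lemma pscal_0 v : pscal C0 v = pzero.
Proof. apply functional_extensionality; intro i. unfold pscal, pzero; ring. Qed.

Lemma pscal_1 v : pscal C1 v = v.
Proof. apply functional_extensionality; intro i. unfold pscal; ring. Qed.

Lemma pscal_add s t v : pscal (Cadd s t) v = padd (pscal s v) (pscal t v).
Proof. apply functional_extensionality; intro i. unfold pscal, padd; ring. Qed.

Lemma pscal_mul s t v : pscal (Cmul s t) v = pscal s (pscal t v).
Proof. apply functional_extensionality; intro i. unfold pscal; ring. Qed.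

Lemma upd_upd z i w v : upd (upd z i w) i v = upd z i v.
Proof.
  apply functional_extensionality; intro j. unfold upd. now destruct Nat.eq_dec.
Qed.

Lemma upd_self z i : upd z i (z i) = z.
Proof.
  apply functional_extensionality; intro j. unfold upd. now destruct Nat.eq_dec as [->|].
Qed.

Lemma upd_at z i w : upd z i w i = w.
Proof. unfold upd. now destruct Nat.eq_dec. Qed.

Lemma upd_other z i w j : j <> i -> upd z i w j = z j.
Proof. unfold upd. now destruct Nat.eq_dec. Qed.

(* Eliminating a coordinate removes an index from the list and stays inside C^N. *)
Definition supp (L : list nat) (z : pt) : Prop := forall i, ~ In i L -> z i = C0.

Lemma supp_zero L : supp L pzero.
Proof. now intros i _. Qed.

Lemma supp_add L z w : supp L z -> supp L w -> supp L (padd z w).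
Proof. intros Hz Hw i Hi. unfold padd. rewrite Hz, Hw by exact Hi. ring. Qed.

Lemma supp_sub L z w : supp L z -> supp L w -> supp L (psub z w).
Proof. intros Hz Hw i Hi. unfold psub. rewrite Hz, Hw by exact Hi. ring. Qed.

Lemma supp_scal L s v : supp L v -> supp L (pscal s v).
Proof. intros Hv i Hi. unfold pscal. rewrite Hv by exact Hi. ring. Qed.

Lemma supp_unit L i : In i L -> supp L (punit i).
Proof. intros Hi j Hj. unfold punit. destruct Nat.eq_dec as [->|]; [contradiction|reflexivity]. Qed.

Lemma supp_upd L z i w : In i L -> supp L z -> supp L (upd z i w).
Proof.
  intros Hi Hz j Hj. rewrite upd_other by (intros ->; contradiction). now apply Hz.
Qed.

Lemma supp_incl L L' z : incl L' L -> supp L' z -> supp L z.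
Proof. intros H Hz i Hi. apply Hz. intro; now apply Hi, H. Qed.

Lemma supp_remove_upd L z i : supp L z -> supp (remove Nat.eq_dec i L) (upd z i C0).
Proof.
  intros Hz j Hj. unfold upd. destruct Nat.eq_dec as [|Hn]; [reflexivity|].
  apply Hz. intro Hin. apply Hj. now apply in_in_remove.
Qed.

Lemma supp_remove_at L z i : supp (remove Nat.eq_dec i L) z -> z i = C0.
Proof. intro Hz. apply Hz. apply remove_In. Qed.

Lemma incl_remove L i : incl (remove Nat.eq_dec i L) L.
Proof. intros j Hj. now apply in_remove in Hj. Qed.

Lemma supp_seq N z : supp (seq 0 N) z <-> inCN N z.
Proof.
  split.
  - intros H i Hi. apply H. rewrite in_seq. lia.
  - intros H i Hi. apply H. rewrite in_seq in Hi. lia.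
Qed.

(** Completeness with a rate: the limit is approached with the same error [b n] that controls the
    differences. *)
Lemma C_complete (a : nat -> C) (b : nat -> R) :
  (forall n m, Cmod (Csub (a n) (a m)) <= b n + b m) ->
  (forall eps, 0 < eps -> exists n0, forall n, (n0 <= n)%nat -> b n < eps) ->
  exists l, forall n, Cmod (Csub (a n) l) <= b n.
Proof.
  intros Ha Hb.
  assert (K : forall p : C -> R, (forall z w, p (Csub z w) = p z - p w) -> (forall z, Rabs (p z) <= Cmod z) ->
     exists l, forall eps, 0 < eps -> exists n0, forall n, (n0 <= n)%nat -> Rabs (p (a n) - l) < eps).
  { intros p Hp Hp2. destruct (Rcomplete.R_complete (fun n => p (a n))) as [l Hl].
    - intros eps He. destruct (Hb (eps / 2) ltac:(lra)) as [n0 Hn0]. exists n0. intros n m Hn Hm.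
      unfold Rdist. rewrite <- Hp. eapply Rle_lt_trans; [apply Hp2|].
      eapply Rle_lt_trans; [apply Ha|]. generalize (Hn0 n Hn) (Hn0 m Hm). lra.
    - exists l. intros eps He. destruct (Hl eps He) as [n0 Hn0]. exists n0. intros n Hn. now apply Hn0. }
  destruct (K fst) as [x Hx]; [reflexivity|apply fst_le_Cmod|].
  destruct (K snd) as [y Hy]; [reflexivity|apply snd_le_Cmod|].
  exists (x, y). intro n. apply Rnot_lt_le; intro Hlt.
  set (e := Cmod (Csub (a n) (x, y)) - b n) in *. assert (He : 0 < e) by (unfold e; lra).
  destruct (Hx (e / 4) ltac:(lra)) as [n1 H1]. destruct (Hy (e / 4) ltac:(lra)) as [n2 H2].
  destruct (Hb (e / 4) ltac:(lra)) as [n3 H3].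
  set (m := (n1 + n2 + n3)%nat).
  specialize (H1 m ltac:(unfold m; lia)). specialize (H2 m ltac:(unfold m; lia)).
  specialize (H3 m ltac:(unfold m; lia)). specialize (Ha n m).
  assert (Q : Cmod (Csub (a n) (x, y)) <= Cmod (Csub (a n) (a m)) + Cmod (Csub (a m) (x, y))).
  { replace (Csub (a n) (x, y)) with (Cadd (Csub (a n) (a m)) (Csub (a m) (x, y))) by ring.
    apply Cmod_add. }
  assert (Q2 := Cmod_le_abs (Csub (a m) (x, y))). unfold Csub in Q2 at 2 3; cbn [fst snd] in Q2.
  unfold e in *. lra.
Qed.

Lemma Cmod_pair_mono a b a' b' : 0 <= a <= a' -> 0 <= b <= b' -> Cmod (a, b) <= Cmod (a', b').
Proof. intros. unfold Cmod; cbn [fst snd]. apply sqrt_le_1_alt. nra. Qed.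

Lemma cnorm_ge_0 n z : 0 <= cnorm n z.
Proof. apply sqrt_pos. Qed.

(** Presents the norm recursively as the modulus of a pair of reals, so that norm inequalities
    follow from those of [Cmod] by induction on the dimension. *)
Lemma cnorm_S n z : cnorm (S n) z = Cmod (cnorm n z, Cmod (z n)).
Proof.
  unfold Cmod at 1; cbn [fst snd]. rewrite Cmod_sqr. unfold cnorm at 2 3. rewrite sqrt_sqrt.
  - reflexivity.
  - apply sumR_nonneg; intros; nra.
Qed.

Lemma cnorm_padd n z w : cnorm n (padd z w) <= cnorm n z + cnorm n w.
Proof.
  induction n as [|n IH].
  - unfold cnorm; simpl. rewrite sqrt_0; lra.
  - rewrite !cnorm_S.
    apply Rle_trans with (Cmod (Cadd (cnorm n z, Cmod (z n)) (cnorm n w, Cmod (w n)))); [|apply Cmod_add].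
    apply Cmod_pair_mono; cbn [fst snd]; (split; [apply cnorm_ge_0 || apply Cmod_ge_0|]);
      [exact IH|apply Cmod_add].
Qed.

Lemma cnorm_pscal n s v : cnorm n (pscal s v) = Cmod s * cnorm n v.
Proof.
  unfold cnorm. replace (Cmod s) with (sqrt (Cmod s * Cmod s)).
  2:{ rewrite sqrt_square; [reflexivity|apply Cmod_ge_0]. }
  rewrite <- sqrt_mult; [|apply Rmult_le_pos; apply Cmod_ge_0|apply sumR_nonneg; intros; nra].
  rewrite <- sumR_scal. f_equal. apply sumR_ext. intros i _. rewrite Cmod_sqr.
  unfold pscal, Cmul; cbn [fst snd]. ring.
Qed.

Lemma cnorm_pzero n : cnorm n pzero = 0.
Proof.
  unfold cnorm. rewrite (sumR_ext _ (fun i => 0 * 0)) by (intros; unfold pzero, C0; cbn [fst snd]; ring).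
  rewrite sumR_scal, Rmult_0_l. apply sqrt_0.
Qed.

Lemma coord_le_cnorm n z i : (i < n)%nat -> Cmod (z i) <= cnorm n z.
Proof.
  induction n as [|n IH]; intro Hi; [lia|]. rewrite cnorm_S.
  assert (P1 := cnorm_ge_0 n z). assert (P2 := Cmod_ge_0 (z n)).
  destruct (Nat.eq_dec i n) as [->|Hn].
  - eapply Rle_trans; [|apply snd_le_Cmod]. cbn [snd]. apply Rle_abs.
  - eapply Rle_trans; [apply IH; lia|]. eapply Rle_trans; [|apply fst_le_Cmod]. cbn [fst]. apply Rle_abs.
Qed.

Lemma cnorm_le_sum n z : cnorm n z <= sumR (fun i => Cmod (z i)) n.
Proof.
  induction n as [|n IH]; [unfold cnorm; simpl; rewrite sqrt_0; lra|].
  rewrite cnorm_S. eapply Rle_trans; [apply Cmod_le_abs|]. cbn [fst snd]. simpl sumR.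
  rewrite !Rabs_pos_eq; [lra|apply Cmod_ge_0|apply cnorm_ge_0].
Qed.

(** Only an inequality, because [punit i] has norm 0 when i >= n. *)
Lemma cnorm_punit_le n i w : cnorm n (pscal w (punit i)) <= Cmod w.
Proof.
  rewrite cnorm_pscal. rewrite <- (Rmult_1_r (Cmod w)) at 2.
  apply Rmult_le_compat_l; [apply Cmod_ge_0|].
  assert (K : forall m, cnorm m (punit i) <= 1 /\ ((m <= i)%nat -> cnorm m (punit i) = 0)).
  { induction m as [|m [IH1 IH2]].
    - unfold cnorm; simpl; rewrite sqrt_0; split; lra.
    - rewrite cnorm_S. unfold punit at 2 4. destruct (Nat.eq_dec m i) as [->|Hn].
      + rewrite IH2 by lia. rewrite Cmod_C1. split; [|lia].
        eapply Rle_trans; [apply Cmod_le_abs|]. cbn [fst snd]. rewrite Rabs_R0, Rabs_R1. lra.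
      + rewrite Cmod_C0. assert (E : Cmod (cnorm m (punit i), 0) = cnorm m (punit i)).
        { change (cnorm m (punit i), 0) with (RtoC (cnorm m (punit i))).
          rewrite Cmod_RtoC, Rabs_pos_eq; [reflexivity|apply cnorm_ge_0]. }
        rewrite E. split; [exact IH1|intro; apply IH2; lia]. }
  apply K.
Qed.

Lemma cdist_sym n z w : cdist n z w = cdist n w z.
Proof.
  unfold cdist. replace (psub w z) with (pscal (Copp C1) (psub z w)).
  - rewrite cnorm_pscal, Cmod_opp, Cmod_C1. ring.
  - apply functional_extensionality; intro i. unfold pscal, psub; ring.
Qed.

Lemma cdist_triangle n x y z : cdist n x z <= cdist n x y + cdist n y z.
Proof.
  unfold cdist. replace (psub x z) with (padd (psub x y) (psub y z)).
  - apply cnorm_padd.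
  - apply functional_extensionality; intro i. unfold padd, psub; ring.
Qed.

Lemma cdist_refl n z : cdist n z z = 0.
Proof.
  unfold cdist. replace (psub z z) with pzero; [apply cnorm_pzero|].
  apply functional_extensionality; intro i. unfold pzero, psub; ring.
Qed.

Lemma cdist_ge_0 n z w : 0 <= cdist n z w.
Proof. apply cnorm_ge_0. Qed.

Lemma cdist_padd n z h : cdist n (padd z h) z = cnorm n h.
Proof. unfold cdist. now rewrite psub_padd. Qed.

Lemma cdist_padd_le n z h p : cdist n (padd z h) p <= cdist n z p + cnorm n h.
Proof.
  eapply Rle_trans; [apply (cdist_triangle n _ z)|]. rewrite cdist_padd. lra.
Qed.

Lemma cnorm_0_eq n z : inCN n z -> cnorm n z <= 0 -> z = pzero.
Proof.
  intros Hz H. apply functional_extensionality; intro i. unfold pzero.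
  destruct (Nat.le_gt_cases n i) as [Hi|Hi]; [now apply Hz|].
  apply Cmod_eq_0. generalize (coord_le_cnorm n z i Hi); lra.
Qed.

Lemma cdist_0_eq n z w : inCN n z -> inCN n w -> cdist n z w <= 0 -> z = w.
Proof.
  intros Hz Hw H. rewrite <- (padd_psub w z). rewrite (cnorm_0_eq n (psub z w)).
  - apply padd_zero.
  - intros i Hi. unfold psub. rewrite Hz, Hw by exact Hi. ring.
  - exact H.
Qed.

Lemma coord_le_cdist n z w i : (i < n)%nat -> Cmod (Csub (z i) (w i)) <= cdist n z w.
Proof. intro Hi. apply (coord_le_cnorm n (psub z w) i Hi). Qed.

Lemma cnorm_upd0_le n z i : cnorm n (upd z i C0) <= cnorm n z.
Proof.
  unfold cnorm. apply sqrt_le_1_alt, sumR_le. intros j _. unfold upd.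
  destruct Nat.eq_dec; unfold C0; cbn [fst snd]; nra.
Qed.

Lemma cdist_upd0_le n z w i : cdist n (upd z i C0) (upd w i C0) <= cdist n z w.
Proof.
  unfold cdist. replace (psub (upd z i C0) (upd w i C0)) with (upd (psub z w) i C0).
  - apply cnorm_upd0_le.
  - apply functional_extensionality; intro j. unfold upd, psub. destruct Nat.eq_dec; [ring|reflexivity].
Qed.

(** * Holomorphic functions of several variables *)

Lemma small_multiple (K eps : R) : 0 <= K -> 0 < eps -> exists d, 0 < d /\ forall x, 0 <= x < d -> K * x <= eps.
Proof.
  intros HK He. exists (eps / (K + 1)). split; [apply Rdiv_lt_0_compat; lra|].
  intros x Hx. assert (E : (K + 1) * (eps / (K + 1)) = eps) by (field; lra). nra.
Qed.

Lemma Rle_of_small (x y B : R) : 0 <= B -> (forall e, 0 < e -> x <= y + B * e) -> x <= y.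
Proof.
  intros HB H. apply Rnot_lt_le; intro Hlt.
  destruct (small_multiple B ((x - y) / 2) HB ltac:(lra)) as [d [Hd Hs]].
  specialize (H (d / 2) ltac:(lra)). specialize (Hs (d / 2) ltac:(lra)). lra.
Qed.

Section SeveralVariables.
Context (N : nat).

Definition lin (c : nat -> C) (h : pt) : C := sumC (fun i => Cmul (c i) (h i)) N.

Lemma lin_add c h k : lin c (padd h k) = Cadd (lin c h) (lin c k).
Proof.
  unfold lin. rewrite <- sumC_add. apply sumC_ext. intros; unfold padd; ring.
Qed.

Lemma lin_scal c s h : lin c (pscal s h) = Cmul s (lin c h).
Proof.
  unfold lin. rewrite <- sumC_scal. apply sumC_ext. intros; unfold pscal; ring.
Qed.

Lemma lin_sub_l c d h : lin (fun i => Csub (c i) (d i)) h = Csub (lin c h) (lin d h).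
Proof.
  replace (Csub (lin c h) (lin d h)) with (Cadd (lin c h) (Cmul (Copp C1) (lin d h))) by ring.
  unfold lin. rewrite <- sumC_scal, <- sumC_add. apply sumC_ext. intros; ring.
Qed.

Lemma lin_scal_l k c h : lin (fun i => Cmul k (c i)) h = Cmul k (lin c h).
Proof. unfold lin. rewrite <- sumC_scal. apply sumC_ext. intros; ring. Qed.

Lemma lin_punit c i : (i < N)%nat -> lin c (punit i) = c i.
Proof.
  intro Hi. unfold lin. rewrite (sumC_single _ N i Hi).
  - unfold punit. destruct Nat.eq_dec; [ring|contradiction].
  - intros j _ Hj. unfold punit. destruct Nat.eq_dec; [contradiction|ring].
Qed.

Lemma lin_pzero c : lin c pzero = C0.
Proof. apply sumC_zero. intros; unfold pzero; ring. Qed.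

Lemma lin_bound c h B : (forall i, (i < N)%nat -> Cmod (c i) * Cmod (h i) <= B) ->
  Cmod (lin c h) <= INR N * B.
Proof.
  intro H. unfold lin. eapply Rle_trans; [apply Cmod_sumC|].
  apply Rle_trans with (sumR (fun _ => B) N).
  - apply sumR_le. intros i Hi. rewrite Cmod_mul. now apply H.
  - rewrite sumR_const. lra.
Qed.

Lemma lin_norm c : exists K, 0 <= K /\ forall h, Cmod (lin c h) <= K * cnorm N h.
Proof.
  exists (sumR (fun i => Cmod (c i)) N). split; [apply sumR_nonneg; intros; apply Cmod_ge_0|].
  intro h. unfold lin. eapply Rle_trans; [apply Cmod_sumC|].
  rewrite Rmult_comm, <- sumR_scal. apply sumR_le. intros i Hi. rewrite Cmod_mul, Rmult_comm.
  apply Rmult_le_compat_r; [apply Cmod_ge_0|now apply coord_le_cnorm].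
Qed.

(** Differentiability along the coordinate subspace of the indices in [L]. The entries of [c]
    outside [L] are arbitrary, since every admissible increment vanishes there. *)
Definition hderiv (L : list nat) (f : pt -> C) (z : pt) (c : nat -> C) : Prop :=
  forall eps, 0 < eps -> exists d, 0 < d /\ forall h, supp L h -> cnorm N h < d ->
    Cmod (Csub (Csub (f (padd z h)) (f z)) (lin c h)) <= eps * cnorm N h.

Definition hol (L : list nat) (p : pt) (r : R) (f : pt -> C) : Prop :=
  forall z, supp L z -> cdist N z p < r -> exists c, hderiv L f z c.

Definition below (L : list nat) : Prop := forall i, In i L -> (i < N)%nat.

Lemma supp_inCN L z : below L -> supp L z -> inCN N z.
Proof. intros HL Hz i Hi. apply Hz. intro H. apply HL in H. lia. Qed.

Lemma hderiv_lipschitz L f z c : hderiv L f z c -> exists K d, 0 <= K /\ 0 < d /\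
  forall h, supp L h -> cnorm N h < d -> Cmod (Csub (f (padd z h)) (f z)) <= K * cnorm N h.
Proof.
  intro H. destruct (H 1 Rlt_0_1) as [d [Hd Hf]]. destruct (lin_norm c) as [K [HK Hl]].
  exists (K + 1), d. split; [lra|]. split; [exact Hd|]. intros h Hh Hn. specialize (Hf h Hh Hn).
  replace (Csub (f (padd z h)) (f z))
    with (Cadd (Csub (Csub (f (padd z h)) (f z)) (lin c h)) (lin c h)) by ring.
  eapply Rle_trans; [apply Cmod_add|]. specialize (Hl h). lra.
Qed.

Lemma hderiv_continuous L f z c : supp L z -> hderiv L f z c -> forall eps, 0 < eps -> exists d, 0 < d /\
  forall w, supp L w -> cdist N w z < d -> Cmod (Csub (f w) (f z)) <= eps.
Proof.
  intros Hz H eps He. destruct (hderiv_lipschitz _ _ _ _ H) as (K & d & HK & Hd & Hf).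
  destruct (small_multiple K eps HK He) as [e [Hep Hs]].
  exists (Rmin d e). split; [now apply Rmin_pos|]. intros w Hw Hd'.
  assert (B1 := Rmin_l d e). assert (B2 := Rmin_r d e).
  specialize (Hf (psub w z) (supp_sub _ _ _ Hw Hz) ltac:(fold (cdist N w z); lra)).
  rewrite padd_psub in Hf. fold (cdist N w z) in Hf.
  eapply Rle_trans; [apply Hf|]. apply Hs. split; [apply cdist_ge_0|lra].
Qed.

Lemma hderiv_of_quadratic L f z c A d : 0 <= A -> 0 < d ->
  (forall h, supp L h -> cnorm N h < d ->
    Cmod (Csub (Csub (f (padd z h)) (f z)) (lin c h)) <= A * (cnorm N h * cnorm N h)) ->
  hderiv L f z c.
Proof.
  intros HA Hd H eps He. destruct (small_multiple A eps HA He) as [e [Hep Hs]].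
  exists (Rmin d e). split; [now apply Rmin_pos|]. intros h Hh Hn.
  assert (B1 := Rmin_l d e). assert (B2 := Rmin_r d e). assert (P := cnorm_ge_0 N h).
  eapply Rle_trans; [apply H; [exact Hh|lra]|]. rewrite <- Rmult_assoc.
  apply Rmult_le_compat_r; [exact P|]. apply Hs; lra.
Qed.

Lemma hol_sub L p r f q s : hol L p r f -> cdist N q p + s <= r -> hol L q s f.
Proof.
  intros H Hs z Hz Hd. apply H; [exact Hz|].
  eapply Rle_lt_trans; [apply (cdist_triangle N z q p)|lra].
Qed.

Lemma hderiv_line L f z v s c : supp L v -> hderiv L f (padd z (pscal s v)) c ->
  cdiff (fun t => f (padd z (pscal t v))) s (lin c v).
Proof.
  intros Hv H eps He. assert (P := cnorm_ge_0 N v). set (K := cnorm N v + 1).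
  destruct (H (eps / K)) as [d [Hd Hf]]; [apply Rdiv_lt_0_compat; unfold K; lra|].
  exists (d / K). split; [apply Rdiv_lt_0_compat; unfold K; lra|]. intros t Ht.
  assert (Pt := Cmod_ge_0 t).
  assert (Ht2 : Cmod t * K < d).
  { apply (Rmult_lt_compat_r K) in Ht; [|unfold K; lra].
    replace (d / K * K) with d in Ht by (field; unfold K; lra). exact Ht. }
  specialize (Hf (pscal t v) (supp_scal _ _ _ Hv)). rewrite cnorm_pscal in Hf.
  specialize (Hf ltac:(unfold K in *; nra)).
  rewrite padd_assoc, <- pscal_add, lin_scal in Hf.
  replace (Cmul (lin c v) t) with (Cmul t (lin c v)) by ring.
  eapply Rle_trans; [apply Hf|].
  replace (eps * Cmod t) with (eps / K * (Cmod t * K)) by (field; unfold K; lra).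
  apply Rmult_le_compat_l; [apply Rlt_le, Rdiv_lt_0_compat; unfold K; lra|unfold K; nra].
Qed.

Lemma hol_local_bound L p r f : supp L p -> 0 < r -> hol L p r f ->
  exists M s, 0 < s <= r /\ 0 <= M /\ forall z, supp L z -> cdist N z p < s -> Cmod (f z) <= M.
Proof.
  intros Hp Hr Hf. destruct (Hf p Hp) as [c Hc]; [now rewrite cdist_refl|].
  destruct (hderiv_continuous _ _ _ _ Hp Hc 1 Rlt_0_1) as [d [Hd H]].
  exists (Cmod (f p) + 1), (Rmin d r). assert (B1 := Rmin_l d r).
  split; [split; [now apply Rmin_pos|apply Rmin_r]|].
  split; [generalize (Cmod_ge_0 (f p)); lra|]. intros z Hz Hd'.
  specialize (H z Hz ltac:(lra)). replace (f z) with (Cadd (Csub (f z) (f p)) (f p)) by ring.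
  eapply Rle_trans; [apply Cmod_add|]. lra.
Qed.

Lemma hol_cholo_line L p r f z v R : hol L p r f -> supp L z -> supp L v ->
  cdist N z p + R * cnorm N v <= r -> 0 < cnorm N v -> cholo (fun s => f (padd z (pscal s v))) C0 R.
Proof.
  intros Hf Hz Hv HR Hn s Hs. replace (Csub s C0) with s in Hs by ring.
  destruct (Hf (padd z (pscal s v))) as [c Hc].
  - apply supp_add; [exact Hz|now apply supp_scal].
  - eapply Rle_lt_trans; [apply cdist_padd_le|]. rewrite cnorm_pscal.
    apply Rlt_le_trans with (cdist N z p + R * cnorm N v); [|exact HR].
    apply Rplus_lt_compat_l. now apply Rmult_lt_compat_r.
  - eexists. now apply (hderiv_line L f z v s c).
Qed.

(** The one-variable estimates on complex lines through z in unit directions, on discs of radius r /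
    2. Their constants depend neither on the direction nor on z in the half ball, and this
    uniformity is what later limits rely on. *)
Lemma hol_second_order L p r f M z c : 0 < r -> hol L p r f ->
  (forall w, supp L w -> cdist N w p < r -> Cmod (f w) <= M) ->
  supp L z -> cdist N z p < r / 2 -> hderiv L f z c ->
  (forall h, supp L h -> cnorm N h <= r / 16 ->
    Cmod (Csub (Csub (f (padd z h)) (f z)) (lin c h)) <= 40000 * M / (r * r) * (cnorm N h * cnorm N h)) /\
  (forall h, supp L h -> Cmod (lin c h) <= 16 * M / r * cnorm N h).
Proof.
  intros Hr Hf HM Hz Hzp Hc.
  assert (HM0 : 0 <= M).
  { apply Rle_trans with (Cmod (f z)); [apply Cmod_ge_0|apply HM; [exact Hz|lra]]. }
  assert (Hline : forall u, supp L u -> cnorm N u = 1 ->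
     cholo (fun s => f (padd z (pscal s u))) C0 (r / 2) /\
     (forall s, Cmod s < r / 2 -> Cmod (f (padd z (pscal s u))) <= M) /\
     cdiff (fun s => f (padd z (pscal s u))) C0 (lin c u)).
  { intros u Hu Hu1. repeat split.
    - apply (hol_cholo_line L p r); try assumption; rewrite Hu1; lra.
    - intros s Hs. apply HM; [apply supp_add; [exact Hz|now apply supp_scal]|].
      eapply Rle_lt_trans; [apply cdist_padd_le|]. rewrite cnorm_pscal, Hu1. lra.
    - apply (hderiv_line L); [exact Hu|]. now rewrite pscal_0, padd_zero. }
  assert (Hnz : forall h, supp L h -> 0 < cnorm N h -> exists u, supp L u /\ cnorm N u = 1 /\
     h = pscal (RtoC (cnorm N h)) u).
  { intros h Hh Hp. exists (pscal (RtoC (/ cnorm N h)) h). split; [now apply supp_scal|].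
    assert (0 < / cnorm N h) by now apply Rinv_0_lt_compat. split.
    - rewrite cnorm_pscal, Cmod_RtoC, Rabs_pos_eq by lra. apply Rinv_l. lra.
    - rewrite <- pscal_mul. replace (Cmul (RtoC (cnorm N h)) (RtoC (/ cnorm N h))) with C1.
      + now rewrite pscal_1.
      + unfold Cmul, RtoC, C1; cbn [fst snd]. f_equal; field; lra. }
  split.
  - intros h Hh Hhr. destruct (cnorm_ge_0 N h) as [Hp|Hp].
    + destruct (Hnz h Hh Hp) as (u & Hu & Hu1 & E).
      destruct (Hline u Hu Hu1) as (L1 & L2 & L3).
      assert (S := cauchy_second_order _ (r / 2) M (lin c u) ltac:(lra) L1 L2 L3 (RtoC (cnorm N h))).
      rewrite Cmod_RtoC, Rabs_pos_eq in S by lra. specialize (S ltac:(lra)).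
      cbv beta in S. rewrite <- E, pscal_0, padd_zero in S.
      replace (Cmul (lin c u) (RtoC (cnorm N h))) with (lin c h) in S
        by (rewrite E at 1; rewrite lin_scal; ring).
      eapply Rle_trans; [apply S|]. right. field. lra.
    (* [L] may contain indices from N on, so a vanishing norm does not force h to be zero. The
       differentiability bound at h itself settles the case. *)
    + assert (E : forall i, (i < N)%nat -> h i = C0).
      { intros i Hi. apply Cmod_eq_0. generalize (coord_le_cnorm N h i Hi). lra. }
      assert (El : lin c h = C0) by (apply sumC_zero; intros i Hi; rewrite E by exact Hi; ring).
      destruct (Hc 1 Rlt_0_1) as [d [Hd Hcd]]. specialize (Hcd h Hh ltac:(lra)).
      rewrite <- Hp in Hcd |- *. lra.
  - intros h Hh. destruct (cnorm_ge_0 N h) as [Hp|Hp].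
    + destruct (Hnz h Hh Hp) as (u & Hu & Hu1 & E).
      destruct (Hline u Hu Hu1) as (L1 & L2 & L3).
      assert (S := cauchy_estimate _ C0 (r / 2) M (lin c u) ltac:(lra) L1).
      specialize (S ltac:(intros w Hw; replace (Csub w C0) with w in Hw by ring; now apply L2) L3).
      rewrite E at 1. rewrite lin_scal, Cmod_mul, Cmod_RtoC, Rabs_pos_eq by lra.
      rewrite Rmult_comm. apply Rmult_le_compat_r; [lra|].
      eapply Rle_trans; [apply S|]. right; field; lra.
    + assert (El : lin c h = C0).
      { apply sumC_zero; intros i Hi. replace (h i) with C0; [ring|].
        symmetry. apply Cmod_eq_0. generalize (coord_le_cnorm N h i Hi). lra. }
      rewrite El, Cmod_C0, <- Hp. lra.
Qed.

Lemma hderiv_sub L f g z c d : hderiv L f z c -> hderiv L g z d ->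
  hderiv L (fun w => Csub (f w) (g w)) z (fun i => Csub (c i) (d i)).
Proof.
  intros Hf Hg eps He.
  destruct (Hf (eps / 2) ltac:(lra)) as [d1 [Hd1 H1]].
  destruct (Hg (eps / 2) ltac:(lra)) as [d2 [Hd2 H2]].
  exists (Rmin d1 d2). split; [now apply Rmin_pos|]. intros h Hh Hn.
  assert (B1 := Rmin_l d1 d2). assert (B2 := Rmin_r d1 d2).
  specialize (H1 h Hh ltac:(lra)). specialize (H2 h Hh ltac:(lra)).
  rewrite lin_sub_l.
  match goal with |- Cmod ?t <= _ => replace t with
    (Csub (Csub (Csub (f (padd z h)) (f z)) (lin c h))
          (Csub (Csub (g (padd z h)) (g z)) (lin d h))) by ring end.
  eapply Rle_trans; [apply Cmod_sub|]. lra.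
Qed.

Lemma hderiv_scal L k f z c : hderiv L f z c -> hderiv L (fun w => Cmul k (f w)) z (fun i => Cmul k (c i)).
Proof.
  intros Hf eps He. assert (Pk := Cmod_ge_0 k).
  destruct (Hf (eps / (Cmod k + 1))) as [d [Hd H]]; [apply Rdiv_lt_0_compat; lra|].
  exists d. split; [exact Hd|]. intros h Hh Hn. specialize (H h Hh Hn). rewrite lin_scal_l.
  match goal with |- Cmod ?t <= _ => replace t with
    (Cmul k (Csub (Csub (f (padd z h)) (f z)) (lin c h))) by ring end.
  rewrite Cmod_mul. eapply Rle_trans; [apply Rmult_le_compat_l; [exact Pk|apply H]|].
  replace (eps * cnorm N h) with ((Cmod k + 1) * (eps / (Cmod k + 1) * cnorm N h)) by (field; lra).
  apply Rmult_le_compat_r; [|lra].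
  apply Rmult_le_pos; [apply Rlt_le, Rdiv_lt_0_compat; lra|apply cnorm_ge_0].
Qed.

Lemma hderiv_translate L f z v c : hderiv L f (padd z v) c -> hderiv L (fun w => f (padd w v)) z c.
Proof.
  intros Hf eps He. destruct (Hf eps He) as [d [Hd H]]. exists d; split; [exact Hd|].
  intros h Hh Hn. specialize (H h Hh Hn).
  replace (padd (padd z h) v) with (padd (padd z v) h); [exact H|].
  apply functional_extensionality; intro i; unfold padd; ring.
Qed.

(** The derivative along [v], chosen by [epsilon]: it is meaningful only where f is differentiable
    along [v], and there [dv_eq] expresses it through the gradient. *)
Definition dv (v : pt) (f : pt -> C) (z : pt) : C :=
  epsilon (inhabits C0) (fun c => cdiff (fun s => f (padd z (pscal s v))) C0 c).

Lemma dv_eq L v f z c : supp L v -> hderiv L f z c -> dv v f z = lin c v.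
Proof.
  intros Hv Hc. assert (H : cdiff (fun s => f (padd z (pscal s v))) C0 (lin c v)).
  { apply (hderiv_line L); [exact Hv|]. now rewrite pscal_0, padd_zero. }
  apply (cdiff_unique (fun s => f (padd z (pscal s v))) C0); [|exact H].
  apply (epsilon_spec (inhabits C0) (fun c => cdiff (fun s => f (padd z (pscal s v))) C0 c)). eexists; exact H.
Qed.

Lemma geometric_small (t : R) : 0 <= t -> forall eps, 0 < eps ->
  exists n0, forall n, (n0 <= n)%nat -> t / 2 ^ n < eps.
Proof.
  intros Ht eps He. destruct (half_pow_small t eps He) as [n0 H0]. exists n0. intros n Hn.
  eapply Rle_lt_trans; [|apply H0]. apply Rmult_le_compat_l; [exact Ht|].
  apply Rinv_le_contravar; [apply pow2_pos|]. apply Rle_pow; [lra|exact Hn].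
Qed.

(* The difference quotients of f along v converge uniformly to [dv v f] near the point, and
   the uniform second-order estimate passes to the limit. *)
Lemma hol_dv L p r f v : below L -> supp L v -> hol L p r f -> hol L p r (dv v f).
Proof.
  intros HL Hv Hf z0 Hz0 Hd0.
  assert (Hf0 : hol L z0 (r - cdist N z0 p) f) by (apply (hol_sub L p r); [exact Hf|lra]).
  destruct (hol_local_bound L z0 (r - cdist N z0 p) f Hz0 ltac:(lra) Hf0) as (M & r0 & Hr0 & HM0 & HM).
  assert (Hf1 : hol L z0 r0 f) by (apply (hol_sub L z0 _ f _ _ Hf0); rewrite cdist_refl; lra).
  clear Hf0 Hf.
  set (nv := cnorm N v). assert (Pv : 0 <= nv) by apply cnorm_ge_0.
  set (K := 40000 * M / (r0 * r0) * (nv * nv)).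
  assert (HC0 : 0 <= 40000 * M / (r0 * r0)).
  { apply Rmult_le_pos; [lra|]. apply Rlt_le, Rinv_0_lt_compat. nra. }
  assert (HK : 0 <= K) by (unfold K; apply Rmult_le_pos; [exact HC0|nra]).
  (* Steps t * v with t <= t0 have length at most r0 / 16, the range of the second-order estimate;
     the added 1 covers v = 0. *)
  set (t0 := r0 / (16 * (nv + 1))).
  assert (Ht0 : 0 < t0) by (apply Rdiv_lt_0_compat; lra).
  assert (Htv : t0 * nv <= r0 / 16).
  { unfold t0. replace (r0 / 16) with (r0 / (16 * (nv + 1)) * (nv + 1)) by (field; lra).
    apply Rmult_le_compat_l; [apply Rlt_le, Rdiv_lt_0_compat; lra|lra]. }
  set (G := fun t z => Cmul (RtoC (/ t)) (Csub (f (padd z (pscal (RtoC t) v))) (f z))).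
  assert (HG : forall t z, 0 < t <= t0 -> supp L z -> cdist N z z0 < r0 / 2 ->
     Cmod (Csub (G t z) (dv v f z)) <= K * t).
  { intros t z Ht Hz Hzd. destruct (Hf1 z Hz ltac:(lra)) as [c Hc].
    destruct (hol_second_order L z0 r0 f M z c ltac:(lra) Hf1 HM Hz Hzd Hc) as [S _].
    specialize (S (pscal (RtoC t) v) (supp_scal _ _ _ Hv)).
    rewrite cnorm_pscal, Cmod_RtoC, Rabs_pos_eq in S by lra. fold nv in S.
    specialize (S ltac:(nra)). rewrite (dv_eq L v f z c Hv Hc).
    assert (E : Cmul (RtoC (/ t)) (RtoC t) = C1).
    { unfold Cmul, RtoC, C1; cbn [fst snd]. f_equal; field; lra. }
    replace (Csub (G t z) (lin c v))
      with (Cmul (RtoC (/ t)) (Csub (Csub (f (padd z (pscal (RtoC t) v))) (f z)) (lin c (pscal (RtoC t) v)))).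
    2:{ unfold G. rewrite lin_scal.
        replace (lin c v) with (Cmul (Cmul (RtoC (/ t)) (RtoC t)) (lin c v)) at 2 by (rewrite E; ring).
        ring. }
    assert (0 < / t) by (apply Rinv_0_lt_compat; lra).
    rewrite Cmod_mul, Cmod_RtoC, Rabs_pos_eq by lra.
    eapply Rle_trans; [apply Rmult_le_compat_l; [lra|apply S]|]. right. unfold K. field. lra. }
  assert (HGd : forall t z, 0 < t <= t0 -> supp L z -> cdist N z z0 < r0 / 2 ->
     exists c, hderiv L (G t) z c).
  { intros t z Ht Hz Hzd. destruct (Hf1 z Hz ltac:(lra)) as [c Hc].
    destruct (Hf1 (padd z (pscal (RtoC t) v))) as [c' Hc'].
    - apply supp_add; [exact Hz|now apply supp_scal].
    - eapply Rle_lt_trans; [apply cdist_padd_le|].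
      rewrite cnorm_pscal, Cmod_RtoC, Rabs_pos_eq by lra. fold nv. nra.
    - eexists. apply hderiv_scal. apply (hderiv_sub L (fun w => f (padd w (pscal (RtoC t) v))) f).
      + apply hderiv_translate. exact Hc'.
      + exact Hc. }
  set (D := 16 * M / r0 * nv).
  assert (HD : forall z, supp L z -> cdist N z z0 < r0 / 2 -> Cmod (dv v f z) <= D).
  { intros z Hz Hzd. destruct (Hf1 z Hz ltac:(lra)) as [c Hc].
    rewrite (dv_eq L v f z c Hv Hc).
    destruct (hol_second_order L z0 r0 f M z c ltac:(lra) Hf1 HM Hz Hzd Hc) as [_ S].
    now apply S. }
  set (M1 := D + K * t0).
  assert (HGM : forall t z, 0 < t <= t0 -> supp L z -> cdist N z z0 < r0 / 2 -> Cmod (G t z) <= M1).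
  { intros t z Ht Hz Hzd. replace (G t z) with (Cadd (Csub (G t z) (dv v f z)) (dv v f z)) by ring.
    eapply Rle_trans; [apply Cmod_add|]. generalize (HG t z Ht Hz Hzd) (HD z Hz Hzd).
    assert (K * t <= K * t0) by (apply Rmult_le_compat_l; lra). unfold M1. lra. }
  set (tn := fun n : nat => t0 / 2 ^ n).
  assert (Htn : forall n, 0 < tn n <= t0).
  { intro n. unfold tn. assert (P := pow2_pos n). split; [now apply Rdiv_lt_0_compat|].
    rewrite <- (Rdiv_1_r t0) at 2. apply Rmult_le_compat_l; [lra|].
    apply Rinv_le_contravar; [lra|]. apply pow_R1_Rle; lra. }
  set (cn := fun n => epsilon (inhabits (fun _ : nat => C0)) (fun c => hderiv L (G (tn n)) z0 c)).
  assert (Hz00 : cdist N z0 z0 < r0 / 2) by (rewrite cdist_refl; lra).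
  assert (Hcn : forall n, hderiv L (G (tn n)) z0 (cn n)).
  { intro n. apply (epsilon_spec (inhabits (fun _ : nat => C0)) (fun c => hderiv L (G (tn n)) z0 c)).
    now apply HGd. }
  set (b := fun n => 32 * K / r0 * tn n).
  assert (Hr0i : 0 < / r0) by (apply Rinv_0_lt_compat; lra).
  assert (HQ : 0 <= 32 * K / r0) by (apply Rmult_le_pos; lra).
  (* The difference of the quotients for [tn n] and [tn m] is at most K * (tn n + tn m) on a fixed
     ball, so Cauchy's estimate makes their gradients at z0 a Cauchy sequence with rate [b]. *)
  assert (Hdiff : forall i, In i L -> forall n m, Cmod (Csub (cn n i) (cn m i)) <= b n + b m).
  { intros i Hi n m.
    assert (Hin := HL i Hi).
    assert (Hsub := hderiv_sub L _ _ z0 _ _ (Hcn n) (Hcn m)).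
    destruct (hol_second_order L z0 (r0 / 2) (fun w => Csub (G (tn n) w) (G (tn m) w))
      (K * tn n + K * tn m) z0 (fun i => Csub (cn n i) (cn m i))) as [_ S].
    - lra.
    - intros z Hz Hzd. destruct (HGd (tn n) z (Htn n) Hz Hzd) as [c1 Hc1].
      destruct (HGd (tn m) z (Htn m) Hz Hzd) as [c2 Hc2]. eexists; exact (hderiv_sub L _ _ z _ _ Hc1 Hc2).
    - intros z Hz Hzd.
      replace (Csub (G (tn n) z) (G (tn m) z))
        with (Csub (Csub (G (tn n) z) (dv v f z)) (Csub (G (tn m) z) (dv v f z))) by ring.
      eapply Rle_trans; [apply Cmod_sub|].
      generalize (HG _ z (Htn n) Hz Hzd) (HG _ z (Htn m) Hz Hzd). lra.
    - exact Hz0.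
    - rewrite cdist_refl. lra.
    - exact Hsub.
    - specialize (S (punit i) (supp_unit _ _ Hi)). rewrite lin_punit in S by exact Hin.
      assert (U := cnorm_punit_le N i C1). rewrite pscal_1, Cmod_C1 in U.
      eapply Rle_trans; [apply S|].
      replace (b n + b m) with (16 * (K * tn n + K * tn m) / (r0 / 2) * 1)
        by (unfold b; field; lra).
      apply Rmult_le_compat_l; [|exact U]. 
      assert (A1 := Htn n). assert (A2 := Htn m).
      apply Rmult_le_pos; [|apply Rlt_le, Rinv_0_lt_compat; lra].
      assert (0 <= K * tn n) by (apply Rmult_le_pos; lra).
      assert (0 <= K * tn m) by (apply Rmult_le_pos; lra). lra. }
  assert (Hbs : forall eps, 0 < eps -> exists n0, forall n, (n0 <= n)%nat -> b n < eps).
  { intros eps He. destruct (geometric_small (32 * K / r0 * t0) ltac:(apply Rmult_le_pos; lra) eps He) as [n0 H0].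
    exists n0. intros n Hn. specialize (H0 n Hn). unfold b, tn. unfold Rdiv in *. lra. }
  set (l := fun i => epsilon (inhabits C0) (fun w => forall n, Cmod (Csub (cn n i) w) <= b n)).
  assert (Hl : forall i, In i L -> forall n, Cmod (Csub (cn n i) (l i)) <= b n).
  { intros i Hi. apply (epsilon_spec (inhabits C0) (fun w => forall n, Cmod (Csub (cn n i) w) <= b n)).
    apply C_complete; [now apply Hdiff|exact Hbs]. }
  exists l.
  assert (HA : 0 <= 40000 * M1 / (r0 / 2 * (r0 / 2))).
  { apply Rmult_le_pos; [|apply Rlt_le, Rinv_0_lt_compat; nra].
    assert (0 <= M1); [|lra].
    apply Rle_trans with (Cmod (G t0 z0)); [apply Cmod_ge_0|apply HGM; [lra|exact Hz0|exact Hz00]]. }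
  apply (hderiv_of_quadratic L _ _ _ (40000 * M1 / (r0 / 2 * (r0 / 2))) (r0 / 32)); [exact HA|lra|].
  intros h Hh Hhn. assert (Ph := cnorm_ge_0 N h).
  assert (Hzh : supp L (padd z0 h)) by now apply supp_add.
  assert (Hzhd : cdist N (padd z0 h) z0 < r0 / 2) by (rewrite cdist_padd; lra).
  (* With h fixed, replacing G (tn n) by the derivative costs at most 2 * K * tn n in the values and
     a multiple of tn n in the linear term. Both disappear as n grows, and the quadratic bound is
     left. *)
  apply (Rle_of_small _ _ (2 * K + INR N * (32 * K / r0) * cnorm N h)).
  { assert (0 <= INR N * (32 * K / r0) * cnorm N h).
    { apply Rmult_le_pos; [|exact Ph]. apply Rmult_le_pos; [apply pos_INR|exact HQ]. }
    lra. }
  intros e He.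
  destruct (geometric_small t0 ltac:(lra) e He) as [n Hn]. specialize (Hn n (Nat.le_refl n)).
  fold (tn n) in Hn. assert (Htnn := Htn n).
  destruct (hol_second_order L z0 (r0 / 2) (G (tn n)) M1 z0 (cn n)) as [S _].
  - lra.
  - intros z Hz Hzd. now apply HGd.
  - intros z Hz Hzd. now apply HGM.
  - exact Hz0.
  - rewrite cdist_refl; lra.
  - apply Hcn.
  - specialize (S h Hh ltac:(lra)).
    assert (E1 := HG (tn n) (padd z0 h) Htnn Hzh Hzhd).
    assert (E2 := HG (tn n) z0 Htnn Hz0 Hz00).
    assert (E3 : Cmod (lin (fun i => Csub (cn n i) (l i)) h) <= INR N * (b n * cnorm N h)).
    { apply lin_bound. intros i Hi. destruct (classic (In i L)) as [Hin|Hout].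
      - apply Rmult_le_compat; try apply Cmod_ge_0; [now apply Hl|now apply coord_le_cnorm].
      - rewrite (Hh i Hout), Cmod_C0, Rmult_0_r. apply Rmult_le_pos; [|exact Ph].
        unfold b. apply Rmult_le_pos; lra. }
    rewrite lin_sub_l in E3.
    match goal with |- Cmod ?t <= _ => replace t with
      (Cadd (Csub (Csub (G (tn n) (padd z0 h)) (G (tn n) z0)) (lin (cn n) h))
        (Cadd (Csub (lin (cn n) h) (lin l h))
          (Csub (Csub (G (tn n) z0) (dv v f z0)) (Csub (G (tn n) (padd z0 h)) (dv v f (padd z0 h)))))) by ring end.
    eapply Rle_trans; [apply Cmod_add|].
    eapply Rle_trans; [apply Rplus_le_compat_l, Cmod_add|].
    eapply Rle_trans; [apply Rplus_le_compat_l, Rplus_le_compat_l, Cmod_sub|].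
    assert (E4 : K * tn n <= K * e) by (apply Rmult_le_compat_l; lra).
    assert (E5 : INR N * (b n * cnorm N h) <= INR N * (32 * K / r0) * cnorm N h * e).
    { unfold b. replace (INR N * (32 * K / r0 * tn n * cnorm N h))
        with (INR N * (32 * K / r0) * cnorm N h * tn n) by ring.
      apply Rmult_le_compat_l; [|lra].
      apply Rmult_le_pos; [|exact Ph]. apply Rmult_le_pos; [apply pos_INR|exact HQ]. }
    lra.
Qed.

End SeveralVariables.

(** * Compactness in C^N *)

Definition extraction (phi : nat -> nat) : Prop := forall n, (phi n < phi (S n))%nat.

Lemma extraction_ge phi : extraction phi -> forall n, (n <= phi n)%nat.
Proof. intros H n. induction n as [|n IH]; [lia|]. specialize (H n). lia. Qed.

Lemma extraction_lt phi : extraction phi -> forall n m, (n < m)%nat -> (phi n < phi m)%nat.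
Proof.
  intros H n m Hm. induction m as [|m IH]; [lia|]. specialize (H m).
  destruct (Nat.eq_dec n m) as [->|]; [lia|]. specialize (IH ltac:(lia)). lia.
Qed.

Lemma extraction_comp phi psi : extraction phi -> extraction psi -> extraction (fun n => phi (psi n)).
Proof. intros H1 H2 n. apply extraction_lt; [exact H1|apply H2]. Qed.

Lemma bounded_subsequence (u : nat -> R) M : (forall n, Rabs (u n) <= M) ->
  exists phi l, extraction phi /\ Un_cv (fun n => u (phi n)) l.
Proof.
  intro HM.
  destruct (Bolzano_Weierstrass u (fun c => - M <= c <= M)) as [l Hl].
  - apply compact_P3.
  - intro n. apply Rabs_le_between, HM.
  - assert (K : forall n k, exists k', (k < k')%nat /\ Rabs (u k' - l) < / (INR n + 1)).
    { intros n k. assert (P : 0 < / (INR n + 1)) by (apply Rinv_0_lt_compat; generalize (pos_INR n); lra).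
      destruct (Hl (disc l (mkposreal _ P)) (S k)) as [k' [H1 H2]].
      - now exists (mkposreal _ P).
      - exists k'. split; [lia|exact H2]. }
    destruct (K 0%nat 0%nat) as [k0 [_ Hk0]].
    destruct (dependent_choice (fun n k => Rabs (u k - l) < / (INR n + 1)) (fun n k k' => (k < k')%nat) k0)
      as [phi [_ Hphi]].
    + exact Hk0.
    + intros n k _. destruct (K (S n) k) as [k' [H1 H2]]. exists k'. now split.
    + exists phi, l. split; [intro n; apply Hphi|].
      intros eps He. destruct (archimed_cor1 eps He) as [n0 [Hn0 Hp]]. exists n0. intros n Hn.
      unfold Rdist. eapply Rlt_trans; [apply Hphi|]. eapply Rle_lt_trans; [|apply Hn0].
      assert (0 < INR n0) by now apply lt_0_INR.
      apply Rinv_le_contravar; [assumption|]. apply le_INR in Hn. lra.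
Qed.

Lemma Un_cv_extraction u l phi : extraction phi -> Un_cv u l -> Un_cv (fun n => u (phi n)) l.
Proof.
  intros Hp Hu eps He. destruct (Hu eps He) as [n0 H]. exists n0. intros n Hn. apply H.
  generalize (extraction_ge phi Hp n). lia.
Qed.

Section Compactness.
Context (N : nat).

Definition pcvg (u : nat -> pt) (l : pt) : Prop := Un_cv (fun n => cdist N (u n) l) 0.

Lemma pcvg_eps u l : pcvg u l -> forall eps, 0 < eps -> exists n0, forall n, (n0 <= n)%nat -> cdist N (u n) l < eps.
Proof.
  intros H eps He. destruct (H eps He) as [n0 Hn]. exists n0. intros n Hnn. specialize (Hn n Hnn).
  unfold Rdist in Hn. rewrite Rminus_0_r, Rabs_pos_eq in Hn; [exact Hn|apply cdist_ge_0].
Qed.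

Lemma eps_pcvg u l : (forall eps, 0 < eps -> exists n0, forall n, (n0 <= n)%nat -> cdist N (u n) l < eps) -> pcvg u l.
Proof.
  intros H eps He. destruct (H eps He) as [n0 Hn]. exists n0. intros n Hnn. specialize (Hn n Hnn).
  unfold Rdist. rewrite Rminus_0_r, Rabs_pos_eq; [exact Hn|apply cdist_ge_0].
Qed.

(** Sequential compactness. Membership in C^N is included because [cdist N] does not see the
    coordinates from N on. *)
Definition pcompact (A : pt -> Prop) : Prop :=
  (forall z, A z -> inCN N z) /\
  forall u, (forall n, A (u n)) -> exists phi l, extraction phi /\ A l /\ pcvg (fun n => u (phi n)) l.

Lemma bounded_points_subsequence (u : nat -> pt) M :
  (forall n, inCN N (u n)) -> (forall n, cnorm N (u n) <= M) ->
  exists phi l, extraction phi /\ inCN N l /\ pcvg (fun n => u (phi n)) l.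
Proof.
  intros Hu HM.
  assert (K : forall m, (m <= N)%nat -> exists phi (l : pt), extraction phi /\ (forall i, (m <= i)%nat -> l i = C0) /\
     forall i, (i < m)%nat -> Un_cv (fun n => fst (u (phi n) i)) (fst (l i)) /\
                              Un_cv (fun n => snd (u (phi n) i)) (snd (l i))).
  { induction m as [|m IH]; intro Hm.
    - exists (fun n => n), pzero. split; [intro n; lia|]. split; [reflexivity|]. intros; lia.
    - destruct (IH ltac:(lia)) as (phi & l & Hp & Hl0 & Hl).
      assert (Hb : forall n, Cmod (u n m) <= M).
      { intro n. eapply Rle_trans; [apply (coord_le_cnorm N); lia|apply HM]. }
      destruct (bounded_subsequence (fun n => fst (u (phi n) m)) M) as (psi & x & Hpsi & Hx).
      { intro n. eapply Rle_trans; [apply fst_le_Cmod|apply Hb]. }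
      destruct (bounded_subsequence (fun n => snd (u (phi (psi n)) m)) M) as (chi & y & Hchi & Hy).
      { intro n. eapply Rle_trans; [apply snd_le_Cmod|apply Hb]. }
      exists (fun n => phi (psi (chi n))), (upd l m (x, y)).
      split; [apply (extraction_comp phi (fun n => psi (chi n))); [exact Hp|now apply extraction_comp]|].
      split.
      + intros i Hi. rewrite upd_other by lia. apply Hl0. lia.
      + intros i Hi. destruct (Nat.eq_dec i m) as [->|Hn].
        * rewrite upd_at. split; [|exact Hy].
          exact (Un_cv_extraction _ _ chi Hchi Hx).
        * rewrite upd_other by exact Hn. destruct (Hl i ltac:(lia)) as [H1 H2].
          assert (He : extraction (fun n => psi (chi n))) by now apply extraction_comp.
          split; [exact (Un_cv_extraction _ _ _ He H1)|exact (Un_cv_extraction _ _ _ He H2)]. }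
  destruct (K N (Nat.le_refl N)) as (phi & l & Hp & Hl0 & Hl). clear K.
  exists phi, l. split; [exact Hp|]. split; [exact Hl0|]. apply eps_pcvg.
  intros eps He.
  assert (Q : forall m, (m <= N)%nat -> forall e, 0 < e -> exists n0, forall n, (n0 <= n)%nat ->
     sumR (fun i => Cmod (psub (u (phi n)) l i)) m < e).
  { induction m as [|m IH]; intros Hm e Hep.
    - exists 0%nat. intros. simpl. lra.
    - destruct (IH ltac:(lia) (e / 2) ltac:(lra)) as [n0 H0].
      destruct (Hl m ltac:(lia)) as [H1 H2].
      destruct (H1 (e / 4) ltac:(lra)) as [n1 Hn1]. destruct (H2 (e / 4) ltac:(lra)) as [n2 Hn2].
      exists (n0 + n1 + n2)%nat. intros n Hn. simpl.
      specialize (H0 n ltac:(lia)). specialize (Hn1 n ltac:(lia)). specialize (Hn2 n ltac:(lia)).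
      unfold Rdist in *. assert (B := Cmod_le_abs (psub (u (phi n)) l m)).
      unfold psub at 2 3 in B. unfold Csub in B; cbn [fst snd] in B. lra. }
  destruct (Q N (Nat.le_refl N) eps He) as [n0 Hn0]. exists n0. intros n Hn.
  eapply Rle_lt_trans; [apply cnorm_le_sum|]. now apply Hn0.
Qed.

Lemma closed_bounded_pcompact (A : pt -> Prop) M :
  (forall z, A z -> inCN N z) -> (forall z, A z -> cnorm N z <= M) ->
  (forall u l, (forall n, A (u n)) -> inCN N l -> pcvg u l -> A l) -> pcompact A.
Proof.
  intros H1 H2 H3. split; [exact H1|]. intros u Hu.
  destruct (bounded_points_subsequence u M) as (phi & l & Hp & Hl & Hc); try (intro; auto).
  exists phi, l. split; [exact Hp|]. split; [|exact Hc].
  apply (H3 (fun n => u (phi n))); auto.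
Qed.

Definition pcontinuous_on (A : pt -> Prop) (F : pt -> R) : Prop :=
  forall l, A l -> forall eps, 0 < eps -> exists d, 0 < d /\
    forall w, A w -> cdist N w l < d -> Rabs (F w - F l) < eps.

Lemma pcompact_max (A : pt -> Prop) F a : pcompact A -> pcontinuous_on A F -> A a ->
  exists m, A m /\ forall w, A w -> F w <= F m.
Proof.
  intros [_ HA] HF Ha.
  (* A single sequence that eventually exceeds every value of F up to 1 / (n + 1), whether F is
     bounded or not; boundedness then need not be settled before compactness is used. *)
  assert (K : exists u : nat -> pt, (forall n, A (u n)) /\
     forall w, A w -> exists n0, forall n, (n0 <= n)%nat -> F w <= F (u n) + / (INR n + 1)).
  { assert (Pn : forall n : nat, 0 < / (INR n + 1)).
    { intro n. apply Rinv_0_lt_compat. generalize (pos_INR n); lra. }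
    destruct (classic (bound (fun r => exists w, A w /\ r = F w))) as [Hb|Hb].
    - destruct (completeness _ Hb) as [s [Hs1 Hs2]]; [now exists (F a), a|].
      assert (Hn : forall n : nat, exists w, A w /\ s - / (INR n + 1) < F w).
      { intro n. apply NNPP; intro Hno. specialize (Pn n).
        assert (s <= s - / (INR n + 1)); [|lra]. apply Hs2. intros r [w [Hw ->]].
        apply Rnot_lt_le; intro; apply Hno; now exists w. }
      exists (fun n => epsilon (inhabits a) (fun w => A w /\ s - / (INR n + 1) < F w)).
      assert (Hu := fun n => epsilon_spec (inhabits a) _ (Hn n)). cbv beta in Hu.
      split; [intro n; apply Hu|]. intros w Hw. exists 0%nat. intros n _.
      assert (F w <= s) by (apply Hs1; now exists w). generalize (proj2 (Hu n)). lra.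
    - assert (Hn : forall n : nat, exists w, A w /\ INR n < F w).
      { intro n. apply NNPP; intro Hno. apply Hb. exists (INR n). intros r [w [Hw ->]].
        apply Rnot_lt_le; intro; apply Hno; now exists w. }
      exists (fun n => epsilon (inhabits a) (fun w => A w /\ INR n < F w)).
      assert (Hu := fun n => epsilon_spec (inhabits a) _ (Hn n)). cbv beta in Hu.
      split; [intro n; apply Hu|]. intros w Hw.
      destruct (INR_unbounded (F w)) as [n0 Hn0]. exists n0. intros n Hnn. apply le_INR in Hnn.
      generalize (proj2 (Hu n)) (Pn n). lra. }
  destruct K as [u [Hu Hw]]. destruct (HA u Hu) as (phi & l & Hp & Hl & Hc).
  exists l. split; [exact Hl|]. intros w Hw'. destruct (Hw w Hw') as [n0 Hn0].
  apply Rnot_lt_le; intro Hlt. set (e := (F w - F l) / 2).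
  assert (He : 0 < e) by (unfold e; lra).
  destruct (HF l Hl e He) as [d [Hd Hcd]]. destruct (pcvg_eps _ _ Hc d Hd) as [n1 Hn1].
  destruct (archimed_cor1 e He) as [n2 [Hn2 Hp2]].
  set (n := (n0 + n1 + n2)%nat).
  specialize (Hn1 n ltac:(unfold n; lia)). cbv beta in Hn1.
  specialize (Hcd _ (Hu (phi n)) Hn1). apply Rabs_def2 in Hcd.
  assert (Hphi := extraction_ge phi Hp n).
  specialize (Hn0 (phi n) ltac:(unfold n in *; lia)).
  assert (0 < INR n2) by now apply lt_0_INR.
  assert (/ (INR (phi n) + 1) <= / INR n2).
  { apply Rinv_le_contravar; [assumption|]. assert (INR n2 <= INR (phi n)) by (apply le_INR; unfold n in *; lia). lra. }
  unfold e in *. lra.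
Qed.

End Compactness.

(** * Chain rule and implicit functions *)

Section Implicit.
Context (N : nat).

Lemma finite_delta (L : list nat) (P : nat -> pt -> Prop) n :
  (forall j, (j < n)%nat -> exists d, 0 < d /\ forall h, supp L h -> cnorm N h < d -> P j h) ->
  exists d, 0 < d /\ forall j, (j < n)%nat -> forall h, supp L h -> cnorm N h < d -> P j h.
Proof.
  induction n as [|n IH]; intro H.
  - exists 1. split; [lra|]. intros; lia.
  - destruct IH as [d1 [Hd1 H1]]; [intros; apply H; lia|].
    destruct (H n ltac:(lia)) as [d2 [Hd2 H2]].
    exists (Rmin d1 d2). split; [now apply Rmin_pos|]. intros j Hj h Hh Hn.
    assert (B1 := Rmin_l d1 d2). assert (B2 := Rmin_r d1 d2).
    destruct (Nat.eq_dec j n) as [->|]; [apply H2|apply H1]; try assumption; try lra; lia.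
Qed.

Lemma lin_sub c a b : lin N c (psub a b) = Csub (lin N c a) (lin N c b).
Proof.
  rewrite <- (padd_psub b a) at 2. rewrite lin_add. ring.
Qed.

(** The support condition keeps the increments of G among those that the derivative of g along [L]
    controls. *)
Lemma hderiv_comp L L' g (G : pt -> pt) z c (d : nat -> nat -> C) e : 0 < e ->
  (forall h, supp L' h -> cnorm N h < e -> supp L (psub (G (padd z h)) (G z))) ->
  (forall j, (j < N)%nat -> hderiv N L' (fun w => G w j) z (d j)) ->
  hderiv N L g (G z) c ->
  hderiv N L' (fun w => g (G w)) z (fun l => sumC (fun j => Cmul (c j) (d j l)) N).
Proof.
  intros He Hs Hd Hg eps Heps.
  destruct (lin_norm N c) as [Kc [HKc Hlc]].
  set (D := fun h j => lin N (d j) h).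
  assert (HD : exists K, 0 <= K /\ forall h, cnorm N (D h) <= K * cnorm N h).
  { set (k := fun j => epsilon (inhabits 0) (fun K => 0 <= K /\ forall h, Cmod (lin N (d j) h) <= K * cnorm N h)).
    assert (Hk : forall j, 0 <= k j /\ forall h, Cmod (lin N (d j) h) <= k j * cnorm N h).
    { intro j. exact (epsilon_spec (inhabits 0) _ (lin_norm N (d j))). }
    exists (sumR k N). split; [apply sumR_nonneg; intros; apply Hk|]. intro h.
    eapply Rle_trans; [apply cnorm_le_sum|]. rewrite Rmult_comm, <- sumR_scal.
    apply sumR_le. intros j _. rewrite Rmult_comm. apply Hk. }
  destruct HD as [K [HK HDK]].
  assert (PN := pos_INR N).
  set (B := K + INR N + 1). assert (HB : 0 < B) by (unfold B; lra).
  set (e1 := eps / (2 * B)). assert (He1 : 0 < e1) by (apply Rdiv_lt_0_compat; lra).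
  destruct (Hg e1 He1) as [d1 [Hd1 Hg1]].
  set (Q := (Kc + 1) * (INR N + 1)). assert (HQ : 0 < Q) by (unfold Q; nra).
  set (e2 := Rmin 1 (eps / (2 * Q))).
  assert (He2 : 0 < e2) by (unfold e2; apply Rmin_pos; [lra|apply Rdiv_lt_0_compat; lra]).
  assert (He2a : e2 <= 1) by apply Rmin_l. assert (He2b : e2 <= eps / (2 * Q)) by apply Rmin_r.
  destruct (finite_delta L' (fun j h =>
    Cmod (Csub (Csub (G (padd z h) j) (G z j)) (lin N (d j) h)) <= e2 * cnorm N h) N) as [d2 [Hd2 H2]].
  { intros j Hj. exact (Hd j Hj e2 He2). }
  exists (Rmin (Rmin e d2) (d1 / B)).
  split; [repeat apply Rmin_pos; try assumption; now apply Rdiv_lt_0_compat|].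
  intros h Hh Hn.
  assert (B1 := Rmin_l (Rmin e d2) (d1 / B)). assert (B2 := Rmin_r (Rmin e d2) (d1 / B)).
  assert (B3 := Rmin_l e d2). assert (B4 := Rmin_r e d2). assert (Ph := cnorm_ge_0 N h).
  set (k := psub (G (padd z h)) (G z)).
  assert (Hks : supp L k) by (apply Hs; [exact Hh|lra]).
  assert (Hkd : cnorm N (psub k (D h)) <= INR N * (e2 * cnorm N h)).
  { eapply Rle_trans; [apply cnorm_le_sum|].
    apply Rle_trans with (sumR (fun _ => e2 * cnorm N h) N).
    - apply sumR_le. intros j Hj. apply (H2 j Hj h Hh). lra.
    - rewrite sumR_const. lra. }
  assert (Hk : cnorm N k <= B * cnorm N h).
  { rewrite <- (padd_psub (D h) k). eapply Rle_trans; [apply cnorm_padd|].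
    specialize (HDK h). assert (e2 * cnorm N h <= 1 * cnorm N h) by (apply Rmult_le_compat_r; lra).
    assert (INR N * (e2 * cnorm N h) <= INR N * (1 * cnorm N h)) by (apply Rmult_le_compat_l; lra).
    unfold B. lra. }
  specialize (Hg1 k Hks).
  assert (Hkd1 : cnorm N k < d1).
  { eapply Rle_lt_trans; [apply Hk|]. apply Rlt_le_trans with (B * (d1 / B)).
    - apply Rmult_lt_compat_l; lra.
    - right; field; lra. }
  specialize (Hg1 Hkd1).
  replace (padd (G z) k) with (G (padd z h)) in Hg1 by (unfold k; now rewrite padd_psub).
  assert (Hswap : lin N (fun l => sumC (fun j => Cmul (c j) (d j l)) N) h = lin N c (D h)).
  { unfold lin at 1. transitivity (sumC (fun i => sumC (fun j => Cmul (Cmul (c j) (d j i)) (h i)) N) N).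
    - apply sumC_ext. intros i _.
      transitivity (Cmul (h i) (sumC (fun j => Cmul (c j) (d j i)) N)); [ring|].
      rewrite <- sumC_scal. apply sumC_ext. intros; ring.
    - rewrite sumC_swap. unfold lin. apply sumC_ext. intros j _. unfold D, lin.
      rewrite <- sumC_scal. apply sumC_ext. intros; ring. }
  rewrite Hswap.
  replace (Csub (Csub (g (G (padd z h))) (g (G z))) (lin N c (D h)))
    with (Cadd (Csub (Csub (g (G (padd z h))) (g (G z))) (lin N c k)) (lin N c (psub k (D h))))
    by (rewrite lin_sub; ring).
  eapply Rle_trans; [apply Cmod_add|].
  assert (E1 : e1 * cnorm N k <= eps / 2 * cnorm N h).
  { apply Rle_trans with (e1 * (B * cnorm N h)); [apply Rmult_le_compat_l; lra|].
    right. unfold e1. field. lra. }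
  assert (E2 : Cmod (lin N c (psub k (D h))) <= eps / 2 * cnorm N h).
  { eapply Rle_trans; [apply Hlc|].
    apply Rle_trans with (Q * (e2 * cnorm N h)).
    - eapply Rle_trans; [apply Rmult_le_compat_l; [exact HKc|apply Hkd]|].
      rewrite <- Rmult_assoc. apply Rmult_le_compat_r; [nra|]. unfold Q; nra.
    - apply Rle_trans with (Q * (eps / (2 * Q) * cnorm N h)).
      + apply Rmult_le_compat_l; [lra|]. now apply Rmult_le_compat_r.
      + right. field. lra. }
  lra.
Qed.

Lemma hderiv_coord L z j : (j < N)%nat -> exists c, hderiv N L (fun w => w j) z c.
Proof.
  intro Hj. exists (fun i => if Nat.eq_dec i j then C1 else C0).
  intros eps He. exists 1. split; [lra|]. intros h _ _.
  replace (lin N (fun i => if Nat.eq_dec i j then C1 else C0) h) with (h j).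
  - replace (Csub (Csub (padd z h j) (z j)) (h j)) with C0 by (unfold padd; ring).
    rewrite Cmod_C0. apply Rmult_le_pos; [lra|apply cnorm_ge_0].
  - unfold lin. rewrite (sumC_single _ N j Hj).
    + destruct Nat.eq_dec; [ring|contradiction].
    + intros i _ Hi. destruct Nat.eq_dec; [contradiction|ring].
Qed.

Lemma hderiv_const L k z : hderiv N L (fun _ => k) z (fun _ => C0).
Proof.
  intros eps He. exists 1. split; [lra|]. intros h _ _.
  replace (lin N (fun _ => C0) h) with C0 by (symmetry; apply sumC_zero; intros; ring).
  replace (Csub (Csub k k) C0) with C0 by ring. rewrite Cmod_C0.
  apply Rmult_le_pos; [lra|apply cnorm_ge_0].
Qed.

Lemma upd_add z i w h : padd (upd z i w) (pscal h (punit i)) = upd z i (Cadd w h).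
Proof.
  apply functional_extensionality; intro j. unfold padd, upd, pscal, punit.
  destruct Nat.eq_dec; ring.
Qed.

Lemma upd_padd z i w k : k i = C0 -> padd (upd z i w) k = upd (padd z k) i w.
Proof.
  intro Hk. apply functional_extensionality; intro j. unfold padd, upd.
  destruct Nat.eq_dec as [->|]; [rewrite Hk; ring|reflexivity].
Qed.

Lemma cdist_upd_le z p i w : z i = C0 ->
  cdist N (upd z i w) p <= cdist N z (upd p i C0) + Cmod (Csub w (p i)).
Proof.
  intro Hz. unfold cdist.
  replace (psub (upd z i w) p) with (padd (psub z (upd p i C0)) (pscal (Csub w (p i)) (punit i))).
  - eapply Rle_trans; [apply cnorm_padd|]. generalize (cnorm_punit_le N i (Csub w (p i))). lra.
  - apply functional_extensionality; intro j. unfold padd, psub, upd, pscal, punit.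
    destruct Nat.eq_dec as [->|]; [rewrite Hz|]; ring.
Qed.

(** Minimizing |G| over a closed disc in the i-th coordinate replaces a fixed-point iteration. G is
    affine with slope [a] on this disc up to an error |a| / 2, which makes |G| larger on the
    boundary than at the centre and leaves room to decrease any nonzero interior value. *)
Lemma hol_zero_on_fibre L i p r G a eta z :
  below N L -> In i L -> 0 < eta -> a <> C0 -> supp (remove Nat.eq_dec i L) z ->
  cdist N z (upd p i C0) + eta < r ->
  hol N L p r G ->
  (forall w h, Cmod (Csub w (p i)) <= eta -> Cmod (Csub (Cadd w h) (p i)) <= eta ->
     Cmod (Csub (Csub (G (upd z i (Cadd w h))) (G (upd z i w))) (Cmul a h)) <= Cmod a / 2 * Cmod h) ->
  Cmod (G (upd z i (p i))) < Cmod a * eta / 4 ->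
  exists w, Cmod (Csub w (p i)) <= eta /\ G (upd z i w) = C0.
Proof.
  intros HL Hi Heta Ha Hz Hr HG Hlip Hsmall.
  assert (Pa := Cmod_pos a Ha).
  assert (Hzi := supp_remove_at _ _ _ Hz).
  assert (HzL : supp L z) by (apply (supp_incl L _ _ (incl_remove L i)); exact Hz).
  assert (HiN := HL i Hi).
  set (A := fun x => exists w, Cmod (Csub w (p i)) <= eta /\ x = upd z i w).
  assert (HAs : forall x, A x -> supp L x /\ cdist N x p < r).
  { intros x [w [Hw ->]]. split; [now apply supp_upd|].
    eapply Rle_lt_trans; [now apply cdist_upd_le|]. lra. }
  assert (Hcomp : pcompact N A).
  { apply (closed_bounded_pcompact N A (r + cnorm N p)).
    - intros x Hx. apply (supp_inCN N L x HL). now apply HAs.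
    - intros x Hx. destruct (HAs x Hx) as [_ Hd].
      rewrite <- (padd_psub p x). eapply Rle_trans; [apply cnorm_padd|]. unfold cdist in Hd. lra.
    - intros u l Hu Hl Hc. exists (l i). split.
      + apply le_epsilon. intros e He. destruct (pcvg_eps _ _ _ Hc e He) as [n Hn].
        specialize (Hn n (Nat.le_refl n)). destruct (Hu n) as [w [Hw E]].
        assert (Hco := coord_le_cdist N (u n) l i HiN). rewrite E, upd_at, Cmod_sub_sym in Hco.
        rewrite E in Hn.
        replace (Csub (l i) (p i)) with (Cadd (Csub (l i) w) (Csub w (p i))) by ring.
        eapply Rle_trans; [apply Cmod_add|]. lra.
      + apply (cdist_0_eq N); [exact Hl|apply (supp_inCN N L); [exact HL|now apply supp_upd]|].
        apply le_epsilon. intros e He. destruct (pcvg_eps _ _ _ Hc (e / 2) ltac:(lra)) as [n Hn].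
        specialize (Hn n (Nat.le_refl n)). destruct (Hu n) as [w [Hw E]]. rewrite E in Hn.
        assert (Hco := coord_le_cdist N (upd z i w) l i HiN). rewrite upd_at in Hco.
        rewrite Rplus_0_l. eapply Rle_trans; [apply (cdist_triangle N l (upd z i w))|].
        rewrite (cdist_sym N l).
        assert (cdist N (upd z i w) (upd z i (l i)) <= Cmod (Csub w (l i))).
        { unfold cdist. replace (psub (upd z i w) (upd z i (l i))) with (pscal (Csub w (l i)) (punit i)).
          - apply cnorm_punit_le.
          - apply functional_extensionality; intro j. unfold psub, upd, pscal, punit.
            destruct Nat.eq_dec; ring. }
        lra. }
  assert (Hcont : pcontinuous_on N A (fun x => - Cmod (G x))).
  { intros l Hl eps He. destruct (HAs l Hl) as [Hl1 Hl2]. destruct (HG l Hl1 Hl2) as [c Hc].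
    destruct (hderiv_continuous N L G l c Hl1 Hc (eps / 2) ltac:(lra)) as [d [Hd H]].
    exists d. split; [exact Hd|]. intros w Hw Hwd. specialize (H w (proj1 (HAs w Hw)) Hwd).
    assert (Q1 : Cmod (G w) <= Cmod (Csub (G w) (G l)) + Cmod (G l)).
    { eapply Rle_trans; [|apply Cmod_add]. right; f_equal; ring. }
    assert (Q2 : Cmod (G l) <= Cmod (Csub (G w) (G l)) + Cmod (G w)).
    { rewrite Cmod_sub_sym. eapply Rle_trans; [|apply Cmod_add]. right; f_equal; ring. }
    apply Rabs_def1; lra. }
  assert (Hcenter : Cmod (Csub (p i) (p i)) <= eta).
  { replace (Csub (p i) (p i)) with C0 by ring. rewrite Cmod_C0. lra. }
  destruct (pcompact_max N A _ (upd z i (p i)) Hcomp Hcont) as [x [[w [Hw ->]] Hmin]].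
  { now exists (p i). }
  exists w. split; [exact Hw|]. apply NNPP; intro Hne.
  assert (Pg := Cmod_pos _ Hne).
  (* the minimum is not on the boundary circle *)
  assert (Hint : Cmod (Csub w (p i)) < eta).
  { destruct Hw as [Hw|Hw]; [exact Hw|exfalso].
    specialize (Hlip (p i) (Csub w (p i)) Hcenter).
    replace (Cadd (p i) (Csub w (p i))) with w in Hlip by ring. specialize (Hlip (Req_le _ _ Hw)).
    rewrite Hw in Hlip.
    assert (Hm := Hmin (upd z i (p i)) ltac:(now exists (p i))). cbv beta in Hm.
    assert (Q : Cmod a * eta <= Cmod a / 2 * eta + Cmod (G (upd z i w)) + Cmod (G (upd z i (p i)))).
    { rewrite <- Hw at 1. rewrite <- Cmod_mul.
      replace (Cmul a (Csub w (p i))) with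
        (Csub (Csub (G (upd z i w)) (G (upd z i (p i))))
          (Csub (Csub (G (upd z i w)) (G (upd z i (p i)))) (Cmul a (Csub w (p i))))) by ring.
      eapply Rle_trans; [apply Cmod_sub|].
      generalize (Cmod_sub (G (upd z i w)) (G (upd z i (p i)))). lra. }
    nra. }
  (* a Newton step decreases |G| *)
  set (g := G (upd z i w)) in *.
  set (q := Cmul (Copp (Cinv a)) g).
  assert (Hq : Cmul a q = Copp g).
  { unfold q. replace (Cmul a (Cmul (Copp (Cinv a)) g)) with (Copp (Cmul (Cmul (Cinv a) a) g)) by ring.
    rewrite Cmul_inv_l by exact Ha. ring. }
  assert (Pq := Cmod_ge_0 q).
  (* The full Newton step q may leave the disc. The fraction t of it stays inside and still
     multiplies |G| by at most 1 - t / 2. *)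
  set (t := Rmin 1 ((eta - Cmod (Csub w (p i))) / (Cmod q + 1))).
  assert (Ht : 0 < t) by (unfold t; apply Rmin_pos; [lra|apply Rdiv_lt_0_compat; lra]).
  assert (Ht1 : t <= 1) by apply Rmin_l.
  assert (Ht2 : t * Cmod q <= eta - Cmod (Csub w (p i))).
  { apply Rle_trans with ((eta - Cmod (Csub w (p i))) / (Cmod q + 1) * (Cmod q + 1)).
    - apply Rmult_le_compat; try lra. apply Rmin_r.
    - right; field; lra. }
  set (h := Cmul (RtoC t) q).
  assert (Hh : Cmod h = t * Cmod q) by (unfold h; rewrite Cmod_mul, Cmod_RtoC, Rabs_pos_eq; lra).
  assert (Hwh : Cmod (Csub (Cadd w h) (p i)) <= eta).
  { replace (Csub (Cadd w h) (p i)) with (Cadd (Csub w (p i)) h) by ring.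
    eapply Rle_trans; [apply Cmod_add|]. lra. }
  specialize (Hlip w h Hw Hwh). fold g in Hlip.
  assert (Haq : Cmod a * Cmod q = Cmod g) by (rewrite <- Cmod_mul, Hq; apply Cmod_opp).
  assert (Hm := Hmin (upd z i (Cadd w h)) ltac:(now exists (Cadd w h))). cbv beta in Hm.
  assert (Eah : Cmul a h = Cmul (RtoC (- t)) g).
  { unfold h. replace (Cmul a (Cmul (RtoC t) q)) with (Cmul (RtoC t) (Cmul a q)) by ring. rewrite Hq.
    replace (RtoC (- t)) with (Copp (RtoC t)) by (unfold Copp, RtoC; cbn [fst snd]; f_equal; ring). ring. }
  assert (Q : Cmod (G (upd z i (Cadd w h))) <= Cmod a / 2 * Cmod h + (1 - t) * Cmod g).
  { replace (G (upd z i (Cadd w h))) with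
      (Cadd (Csub (Csub (G (upd z i (Cadd w h))) g) (Cmul a h)) (Cadd g (Cmul a h))) by ring.
    eapply Rle_trans; [apply Cmod_add|]. apply Rplus_le_compat; [exact Hlip|]. rewrite Eah.
    replace (Cadd g (Cmul (RtoC (- t)) g)) with (Cmul (RtoC (1 - t)) g).
    - rewrite Cmod_mul, Cmod_RtoC, Rabs_pos_eq; lra.
    - replace (RtoC (1 - t)) with (Cadd C1 (RtoC (- t)));
        [ring|unfold Cadd, RtoC, C1; cbn [fst snd]; f_equal; ring]. }
  rewrite Hh in Q. assert (Cmod a / 2 * (t * Cmod q) = t / 2 * Cmod g) by (rewrite <- Haq; field).
  fold g in Hm. nra.
Qed.

(** H lives on the subspace with the i-th coordinate set to 0 and returns that coordinate. The last
    clause is what confinement needs: every zero of G near p lies on the graph of H. *)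
Lemma implicit_function L i p r G c :
  below N L -> In i L -> supp L p -> 0 < r -> hol N L p r G -> G p = C0 ->
  hderiv N L G p c -> c i <> C0 ->
  exists rho H, 0 < rho /\
    (forall z, supp (remove Nat.eq_dec i L) z -> cdist N z (upd p i C0) < rho ->
       cdist N (upd z i (H z)) p < r /\ G (upd z i (H z)) = C0 /\
       exists d, hderiv N (remove Nat.eq_dec i L) H z d) /\
    H (upd p i C0) = p i /\
    (forall z, supp L z -> cdist N z p < rho -> G z = C0 -> H (upd z i C0) = z i).
Proof.
  intros HL Hi Hp Hr HG Gp Hc Hci.
  assert (HiN := HL i Hi). set (L' := remove Nat.eq_dec i L).
  destruct (hol_local_bound N L p r G Hp Hr HG) as (M & r0 & Hr0 & HM0 & HM).
  assert (HG0 : hol N L p r0 G) by (apply (hol_sub N L p r); [exact HG|rewrite cdist_refl; lra]).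
  set (a := c i). set (al := Cmod a). assert (Pal : 0 < al) by now apply Cmod_pos.
  assert (Hu : supp L (punit i)) by now apply supp_unit.
  assert (Hdv : dv (punit i) G p = a) by (rewrite (dv_eq N L _ _ _ c Hu Hc); now apply lin_punit).
  destruct (hol_dv N L p r G (punit i) HL Hu HG p Hp) as [c' Hc']; [rewrite cdist_refl; lra|].
  destruct (hderiv_continuous N L _ p c' Hp Hc' (al / 4) ltac:(lra)) as [r1 [Hr1 Hdvc]].
  set (A := 40000 * M / (r0 * r0)).
  assert (HA : 0 <= A).
  { unfold A. apply Rmult_le_pos; [lra|]. apply Rlt_le, Rinv_0_lt_compat; nra. }
  destruct (small_multiple A (al / 4) HA ltac:(lra)) as [s1 [Hs1 HAs]].
  (* Three constraints: r0 / 64 keeps steps of length 2 * sg within reach of the second-order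
     estimate, r1 keeps the i-th partial derivative within al / 4 of its value at p, and s1 / 4
     bounds the quadratic error by al / 4 times the step. *)
  set (sg := Rmin (Rmin (r0 / 64) r1) (s1 / 4)).
  assert (Hsg : 0 < sg) by (unfold sg; repeat apply Rmin_pos; lra).
  assert (Hsg1 : sg <= r0 / 64 /\ sg <= r1 /\ sg <= s1 / 4).
  { unfold sg. assert (B1 := Rmin_l (Rmin (r0 / 64) r1) (s1 / 4)).
    assert (B2 := Rmin_r (Rmin (r0 / 64) r1) (s1 / 4)).
    assert (B3 := Rmin_l (r0 / 64) r1). assert (B4 := Rmin_r (r0 / 64) r1). lra. }
  assert (Hpart : forall z e, supp L z -> cdist N z p < sg -> hderiv N L G z e -> Cmod (Csub (e i) a) <= al / 4).
  { intros z e Hz Hd He. specialize (Hdvc z Hz ltac:(lra)).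
    rewrite (dv_eq N L _ _ _ e Hu He), lin_punit, Hdv in Hdvc by exact HiN. exact Hdvc. }
  assert (Hlip : forall z h, supp L z -> cdist N z p < sg -> Cmod h <= 2 * sg ->
     Cmod (Csub (Csub (G (padd z (pscal h (punit i)))) (G z)) (Cmul a h)) <= al / 2 * Cmod h).
  { intros z h Hz Hd Hh. destruct (HG0 z Hz ltac:(lra)) as [e He].
    destruct (hol_second_order N L p r0 G M z e ltac:(lra) HG0 HM Hz ltac:(lra) He) as [S _].
    assert (Un := cnorm_punit_le N i h).
    specialize (S (pscal h (punit i)) (supp_scal _ _ _ Hu) ltac:(lra)).
    rewrite lin_scal, lin_punit in S by exact HiN. fold A in S.
    specialize (Hpart z e Hz Hd He).
    assert (Pn := cnorm_ge_0 N (pscal h (punit i))). assert (Ph := Cmod_ge_0 h).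
    assert (E1 : A * (cnorm N (pscal h (punit i)) * cnorm N (pscal h (punit i))) <= al / 4 * Cmod h).
    { rewrite <- Rmult_assoc. apply Rmult_le_compat; try lra.
      - apply Rmult_le_pos; lra.
      - apply HAs. lra. }
    replace (Csub (Csub (G (padd z (pscal h (punit i)))) (G z)) (Cmul a h))
      with (Cadd (Csub (Csub (G (padd z (pscal h (punit i)))) (G z)) (Cmul h (e i))) (Cmul h (Csub (e i) a))) by ring.
    eapply Rle_trans; [apply Cmod_add|]. rewrite Cmod_mul. nra. }
  set (eta := sg / 4).
  assert (Heta : 0 < eta) by (unfold eta; lra).
  destruct (hderiv_continuous N L G p c Hp Hc (al * eta / 8)) as [r2 [Hr2 Hsm]].
  { unfold Rdiv. repeat apply Rmult_lt_0_compat; lra. }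
  set (rho := Rmin (sg / 4) r2).
  assert (Hrho : 0 < rho) by (unfold rho; apply Rmin_pos; lra).
  assert (Hrho1 : rho <= sg / 4) by apply Rmin_l. assert (Hrho2 : rho <= r2) by apply Rmin_r.
  assert (HL' : forall z, supp L' z -> supp L z /\ z i = C0).
  { intros z Hz. split; [apply (supp_incl L L'); [apply incl_remove|exact Hz]|now apply (supp_remove_at L)]. }
  assert (Hin : forall z w, supp L' z -> cdist N z (upd p i C0) < rho -> Cmod (Csub w (p i)) <= eta ->
     supp L (upd z i w) /\ cdist N (upd z i w) p < sg).
  { intros z w Hz Hd Hw. destruct (HL' z Hz) as [H1 H2]. split; [now apply supp_upd|].
    eapply Rle_lt_trans; [now apply cdist_upd_le|]. unfold eta in Hw. lra. }
  assert (Hlip2 : forall z w h, supp L' z -> cdist N z (upd p i C0) < rho ->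
     Cmod (Csub w (p i)) <= eta -> Cmod (Csub (Cadd w h) (p i)) <= eta ->
     Cmod (Csub (Csub (G (upd z i (Cadd w h))) (G (upd z i w))) (Cmul a h)) <= al / 2 * Cmod h).
  { intros z w h Hz Hd H1 H2. destruct (Hin z w Hz Hd H1) as [H3 H4]. rewrite <- upd_add.
    apply Hlip; [exact H3|exact H4|].
    replace h with (Csub (Csub (Cadd w h) (p i)) (Csub w (p i))) by ring.
    eapply Rle_trans; [apply Cmod_sub|]. unfold eta in *. lra. }
  (* A lower Lipschitz bound in the i-th coordinate. It gives uniqueness of the zero, and below it
     bounds the increment of H by the change of G. *)
  assert (Hinj : forall z w w', supp L' z -> cdist N z (upd p i C0) < rho ->
     Cmod (Csub w (p i)) <= eta -> Cmod (Csub w' (p i)) <= eta ->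
     al / 2 * Cmod (Csub w' w) <= Cmod (Csub (G (upd z i w')) (G (upd z i w)))).
  { intros z w w' Hz Hd H1 H2. assert (E : Cadd w (Csub w' w) = w') by ring.
    generalize (Hlip2 z w (Csub w' w) Hz Hd H1). rewrite E. intro H3. specialize (H3 H2).
    assert (Q : al * Cmod (Csub w' w) <= Cmod (Csub (G (upd z i w')) (G (upd z i w))) + al / 2 * Cmod (Csub w' w)).
    { unfold al at 1. rewrite <- Cmod_mul.
      eapply Rle_trans; [|apply Rplus_le_compat_l, H3].
      eapply Rle_trans; [|apply Cmod_sub]. right; f_equal; ring. }
    lra. }
  set (H := fun z => epsilon (inhabits C0) (fun w => Cmod (Csub w (p i)) <= eta /\ G (upd z i w) = C0)).
  assert (HH : forall z, supp L' z -> cdist N z (upd p i C0) < rho ->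
     Cmod (Csub (H z) (p i)) <= eta /\ G (upd z i (H z)) = C0).
  { intros z Hz Hd.
    apply (epsilon_spec (inhabits C0) (fun w => Cmod (Csub w (p i)) <= eta /\ G (upd z i w) = C0)).
    apply (hol_zero_on_fibre L i p r G a eta z); try assumption.
    - unfold eta; lra.
    - intros w h Hw Hwh. now apply Hlip2.
    - destruct (HL' z Hz) as [Hz1 Hz2].
      assert (Hcc : Cmod (Csub (p i) (p i)) = 0).
      { replace (Csub (p i) (p i)) with C0 by ring. apply Cmod_C0. }
      specialize (Hsm (upd z i (p i)) (supp_upd _ _ _ _ Hi Hz1)).
      assert (Hdd : cdist N (upd z i (p i)) p < r2).
      { eapply Rle_lt_trans; [now apply cdist_upd_le|]. lra. }
      specialize (Hsm Hdd). rewrite Gp in Hsm.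
      replace (Csub (G (upd z i (p i))) C0) with (G (upd z i (p i))) in Hsm by ring.
      fold al. assert (0 < al * eta) by (apply Rmult_lt_0_compat; lra). lra. }
  assert (Huniq : forall z w, supp L' z -> cdist N z (upd p i C0) < rho -> Cmod (Csub w (p i)) <= eta ->
     G (upd z i w) = C0 -> H z = w).
  { intros z w Hz Hd Hw Hgw. destruct (HH z Hz Hd) as [H1 H2].
    specialize (Hinj z w (H z) Hz Hd Hw H1). rewrite H2, Hgw in Hinj.
    replace (Csub C0 C0) with C0 in Hinj by ring. rewrite Cmod_C0 in Hinj.
    assert (E : Csub (H z) w = C0) by (apply Cmod_eq_0; generalize (Cmod_ge_0 (Csub (H z) w)); nra).
    replace (H z) with (Cadd (Csub (H z) w) w) by ring. rewrite E. ring. }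
  exists rho, H. split; [exact Hrho|]. split; [|split].
  - intros z Hz Hd. destruct (HH z Hz Hd) as [H1 H2]. destruct (Hin z (H z) Hz Hd H1) as [H3 H4].
    split; [lra|]. split; [exact H2|].
    set (Z := upd z i (H z)) in *.
    destruct (HG0 Z H3 ltac:(lra)) as [e He]. assert (Hei := Hpart Z e H3 H4 He).
    assert (Pei : 3 * al / 4 <= Cmod (e i)).
    { assert (al <= Cmod (e i) + Cmod (Csub (e i) a)); [|lra].
      unfold al. eapply Rle_trans; [|apply Cmod_sub]. right; f_equal; ring. }
    assert (Hei0 : e i <> C0) by (intro E; rewrite E, Cmod_C0 in Pei; lra).
    (* Implicit differentiation: the gradient of H is minus the gradient [e] of G divided by its
       i-th entry. *)
    set (k := Copp (Cinv (e i))).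
    assert (Ek : Cmul k (e i) = Copp C1).
    { unfold k. replace (Cmul (Copp (Cinv (e i))) (e i)) with (Copp (Cmul (Cinv (e i)) (e i))) by ring.
      now rewrite Cmul_inv_l. }
    exists (fun l => Cmul k (e l)).
    destruct (hderiv_lipschitz N L G Z e He) as (K & d0 & HK & Hd0 & HlipZ).
    set (B := 1 + 2 * K / al).
    assert (HB : 0 <= 2 * K / al) by (apply Rmult_le_pos; [lra|apply Rlt_le, Rinv_0_lt_compat; lra]).
    intros eps Heps.
    assert (Pk := Cmod_ge_0 k).
    destruct (He (eps / (B * (Cmod k + 1)))) as [d1 [Hd1 He1]].
    { apply Rdiv_lt_0_compat; [lra|]. unfold B; nra. }
    set (d2 := rho - cdist N z (upd p i C0)).
    exists (Rmin (Rmin d0 d2) (d1 / B)).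
    split; [repeat apply Rmin_pos; try assumption; [unfold d2; lra|apply Rdiv_lt_0_compat; unfold B; lra]|].
    intros h Hh Hn.
    assert (B1 := Rmin_l (Rmin d0 d2) (d1 / B)). assert (B2 := Rmin_r (Rmin d0 d2) (d1 / B)).
    assert (B3 := Rmin_l d0 d2). assert (B4 := Rmin_r d0 d2). assert (Ph := cnorm_ge_0 N h).
    destruct (HL' h Hh) as [HhL Hhi].
    assert (Hzh : supp L' (padd z h)) by now apply supp_add.
    assert (Hdh : cdist N (padd z h) (upd p i C0) < rho).
    { eapply Rle_lt_trans; [apply cdist_padd_le|]. unfold d2 in *. lra. }
    destruct (HH (padd z h) Hzh Hdh) as [H5 H6].
    set (w := Csub (H (padd z h)) (H z)).
    assert (Hw : Cmod w <= 2 * K / al * cnorm N h).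
    { assert (Q := Hinj (padd z h) (H z) (H (padd z h)) Hzh Hdh H1 H5). fold w in Q.
      rewrite H6, <- upd_padd in Q by exact Hhi. fold Z in Q.
      replace (Csub C0 (G (padd Z h))) with (Copp (Csub (G (padd Z h)) (G Z))) in Q by (rewrite H2; ring).
      rewrite Cmod_opp in Q. specialize (HlipZ h HhL ltac:(lra)).
      apply Rmult_le_reg_l with (al / 2); [lra|].
      replace (al / 2 * (2 * K / al * cnorm N h)) with (K * cnorm N h) by (field; lra). lra. }
    set (kk := padd h (pscal w (punit i))).
    assert (Hkk : padd Z kk = upd (padd z h) i (H (padd z h))).
    { unfold kk. rewrite <- padd_assoc. unfold Z. rewrite upd_padd by exact Hhi.
      rewrite upd_add. f_equal. unfold w; ring. }
    assert (Hkn : cnorm N kk <= B * cnorm N h).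
    { unfold kk. eapply Rle_trans; [apply cnorm_padd|]. generalize (cnorm_punit_le N i w). unfold B. lra. }
    assert (Hks : supp L kk) by (apply supp_add; [exact HhL|now apply supp_scal]).
    assert (HB0 : 0 < B) by (unfold B; lra).
    specialize (He1 kk Hks). assert (Hkd : cnorm N kk < d1).
    { eapply Rle_lt_trans; [apply Hkn|]. apply Rlt_le_trans with (B * (d1 / B)).
      - apply Rmult_lt_compat_l; lra.
      - right; field; lra. }
    specialize (He1 Hkd). rewrite Hkk, H6, H2 in He1.
    replace (Csub (Csub C0 C0) (lin N e kk)) with (Copp (lin N e kk)) in He1 by ring.
    rewrite Cmod_opp in He1. unfold kk at 1 in He1. rewrite lin_add, lin_scal, lin_punit in He1 by exact HiN.
    rewrite lin_scal_l. fold w.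
    replace (Csub w (Cmul k (lin N e h))) with (Copp (Cmul k (Cadd (lin N e h) (Cmul w (e i))))).
    2:{ transitivity (Csub (Copp (Cmul k (lin N e h))) (Cmul w (Cmul k (e i)))); [ring|]. rewrite Ek; ring. }
    rewrite Cmod_opp, Cmod_mul.
    eapply Rle_trans; [apply Rmult_le_compat_l; [exact Pk|apply He1]|].
    apply Rle_trans with ((Cmod k + 1) * (eps / (B * (Cmod k + 1)) * (B * cnorm N h))).
    + assert (Pe : 0 < eps / (B * (Cmod k + 1))) by (apply Rdiv_lt_0_compat; [lra|nra]).
      apply Rmult_le_compat; try lra.
      * apply Rmult_le_pos; [lra|apply cnorm_ge_0].
      * apply Rmult_le_compat_l; lra.
    + right; field. split; lra.
  - apply Huniq.
    + now apply supp_remove_upd.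
    + now rewrite cdist_refl.
    + replace (Csub (p i) (p i)) with C0 by ring. rewrite Cmod_C0; lra.
    + now rewrite upd_upd, upd_self.
  - intros z Hz Hd Hgz. apply Huniq.
    + now apply supp_remove_upd.
    + eapply Rle_lt_trans; [apply cdist_upd0_le|exact Hd].
    + eapply Rle_trans; [apply (coord_le_cdist N z p i HiN)|]. unfold eta; lra.
    + now rewrite upd_upd, upd_self.
Qed.

End Implicit.

(** * Holomorphic discs in zero sets *)

Section Discs.
Context (N : nat).

Lemma hderiv_comp_ex L L' g (G : pt -> pt) z e : 0 < e ->
  (forall h, supp L' h -> cnorm N h < e -> supp L (psub (G (padd z h)) (G z))) ->
  (forall j, (j < N)%nat -> exists d, hderiv N L' (fun w => G w j) z d) ->
  (exists c, hderiv N L g (G z) c) ->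
  exists c, hderiv N L' (fun w => g (G w)) z c.
Proof.
  intros He Hs Hd [c Hc].
  set (d := fun j => epsilon (inhabits (fun _ : nat => C0)) (fun d => hderiv N L' (fun w => G w j) z d)).
  assert (Hd' : forall j, (j < N)%nat -> hderiv N L' (fun w => G w j) z (d j)).
  { intros j Hj. exact (epsilon_spec (inhabits (fun _ : nat => C0)) _ (Hd j Hj)). }
  eexists. exact (hderiv_comp N L L' g G z c d e He Hs Hd' Hc).
Qed.

Lemma dv_iter_hol L p r f v n : below N L -> supp L v -> hol N L p r f ->
  hol N L p r (Nat.iter n (dv v) f).
Proof. intros HL Hv Hf. induction n as [|n IH]; [exact Hf|]. now apply hol_dv. Qed.

(** If all iterated derivatives at p towards a nearby q with f(q) <> 0 vanished, the identity
    principle on the complex line through p and q would give f(q) = 0. Taking q within s / 400 puts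
    the parameter disc of radius 200 inside the ball, and q at the parameter 1 = 200 / 200. *)
Lemma nonzero_iterated_derivative L p r f : below N L -> supp L p -> 0 < r -> hol N L p r f ->
  (forall s, 0 < s -> exists z, supp L z /\ cdist N z p < s /\ f z <> C0) ->
  exists v n, supp L v /\ Nat.iter n (dv v) f p <> C0.
Proof.
  intros HL Hp Hr Hf Hnz.
  destruct (hol_local_bound N L p r f Hp Hr Hf) as (M & s & Hs & HM0 & HM).
  destruct (Hnz (s / 400) ltac:(lra)) as (q & Hq & Hqd & Hfq).
  set (v := psub q p). assert (Hv : supp L v) by now apply supp_sub.
  exists v. apply NNPP; intro Hno.
  assert (H0 : forall n, Nat.iter n (dv v) f p = C0).
  { intro n. apply NNPP; intro. apply Hno. now exists n. }
  apply Hfq. replace q with (padd p (pscal C1 v)) by (rewrite pscal_1; apply padd_psub).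
  fold (cdist N q p) in Hqd.
  assert (Hin : forall w, Cmod w < 200 -> supp L (padd p (pscal w v)) /\ cdist N (padd p (pscal w v)) p < s).
  { intros w Hw. split; [apply supp_add; [exact Hp|now apply supp_scal]|].
    rewrite cdist_padd, cnorm_pscal. change (cnorm N v) with (cdist N q p).
    assert (P1 := cdist_ge_0 N q p). assert (P2 := Cmod_ge_0 w). nra. }
  apply (identity_principle (fun n w => Nat.iter n (dv v) f (padd p (pscal w v))) 200 M); [lra| | | |].
  - intros n w Hw. destruct (Hin w Hw) as [H1 H2].
    destruct (dv_iter_hol L p r f v n HL Hv Hf (padd p (pscal w v)) H1 ltac:(lra)) as [c Hc].
    change (Nat.iter (S n) (dv v) f (padd p (pscal w v)))
      with (dv v (Nat.iter n (dv v) f) (padd p (pscal w v))).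
    rewrite (dv_eq N L v _ _ c Hv Hc). now apply (hderiv_line N L).
  - intros w Hw. destruct (Hin w Hw) as [H1 H2]. now apply HM.
  - intro n. rewrite pscal_0, padd_zero. apply H0.
  - rewrite Cmod_C1. lra.
Qed.

Lemma lin_nonzero_coord L c v : supp L v -> lin N c v <> C0 -> exists i, In i L /\ c i <> C0.
Proof.
  intros Hv Hl. apply NNPP; intro Hno. apply Hl. apply sumC_zero. intros i _.
  destruct (classic (In i L)) as [Hi|Hi].
  - replace (c i) with C0; [ring|]. apply NNPP; intro E. apply Hno. exists i. auto.
  - rewrite (Hv i Hi). ring.
Qed.

Lemma graph_coord_hderiv L i H z j : (j < N)%nat ->
  (exists d, hderiv N L H z d) -> exists d, hderiv N L (fun w => upd w i (H w) j) z d.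
Proof.
  intros Hj [d Hd]. destruct (Nat.eq_dec j i) as [->|Hn].
  - exists d. replace (fun w => upd w i (H w) i) with H; [exact Hd|].
    apply functional_extensionality; intro w. now rewrite upd_at.
  - replace (fun w => upd w i (H w) j) with (fun w : pt => w j); [now apply hderiv_coord|].
    apply functional_extensionality; intro w. now rewrite upd_other.
Qed.

Lemma graph_supp L i H z w : In i L -> supp (remove Nat.eq_dec i L) z -> supp (remove Nat.eq_dec i L) w ->
  supp L (psub (upd z i (H z)) (upd w i (H w))).
Proof.
  intros Hi Hz Hw. apply supp_sub; apply supp_upd; try exact Hi;
    (eapply supp_incl; [apply incl_remove|eassumption]).
Qed.

(* Vanishing of all [g j] on a set T without isolated points confines T, near some point,
   to smaller and smaller graphs, until the [g j] vanish identically on one of them. *)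
Theorem holomorphic_disc (n : nat) : forall L (T : pt -> Prop) p r (g : nat -> pt -> C) k,
  (length L <= n)%nat -> below N L -> 0 < r -> T p ->
  (forall z, T z -> supp L z) ->
  (forall z, T z -> forall e, 0 < e -> exists z', T z' /\ z' <> z /\ cdist N z' z < e) ->
  (forall j, (j < k)%nat -> hol N L p r (g j)) ->
  (forall z j, T z -> cdist N z p < r -> (j < k)%nat -> g j z = C0) ->
  exists p' i (gam : pt -> pt) r', T p' /\ cdist N p' p < r /\ 0 < r' /\ (i < N)%nat /\ gam pzero = p' /\
    forall u, supp [i] u -> cnorm N u < r' ->
      supp L (gam u) /\ cdist N (gam u) p < r /\ (forall j, (j < k)%nat -> g j (gam u) = C0) /\
      (u <> pzero -> gam u <> p') /\
      forall l, (l < N)%nat -> exists c, hderiv N [i] (fun w => gam w l) u c.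
Proof.
  induction n as [|n IH]; intros L T p r g k Hlen HL Hr Tp HT Hiso Hg Hvan.
  - exfalso. destruct L; [|simpl in Hlen; lia].
    destruct (Hiso p Tp 1 Rlt_0_1) as (z & Tz & Hz & _). apply Hz.
    apply functional_extensionality; intro i. rewrite (HT p Tp i), (HT z Tz i); auto.
  - assert (Hp := HT p Tp).
    (* If every [g j] vanishes identically near p, any coordinate disc through p will do. Otherwise
       some [g j0] produces a hypersurface that contains T near one of its points. *)
    destruct (classic (forall j, (j < k)%nat -> exists s, 0 < s /\ forall h, supp L h -> cnorm N h < s ->
       g j (padd p h) = C0)) as [Hall|Hnot].
    + destruct (finite_delta N L (fun j h => g j (padd p h) = C0) k Hall) as [s [Hs Hz]].
      assert (Hex : exists i, In i L).
      { destruct L as [|i L0]; [|exists i; now left].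
        exfalso. destruct (Hiso p Tp 1 Rlt_0_1) as (z & Tz & Hzp & _). apply Hzp.
        apply functional_extensionality; intro i. rewrite (HT p Tp i), (HT z Tz i); auto. }
      destruct Hex as [i Hi].
      assert (Hcomm : forall u, padd u p = padd p u).
      { intro u; apply functional_extensionality; intro; unfold padd; ring. }
      exists p, i, (fun u => padd u p), (Rmin s r).
      split; [exact Tp|]. split; [now rewrite cdist_refl|]. split; [now apply Rmin_pos|].
      split; [now apply HL|]. split; [rewrite Hcomm; apply padd_zero|].
      intros u Hu Hun. assert (B1 := Rmin_l s r). assert (B2 := Rmin_r s r).
      assert (HuL : supp L u).
      { apply (supp_incl L [i]); [intros j [<-|[]]; exact Hi|exact Hu]. }
      rewrite Hcomm. split; [now apply supp_add|]. split; [rewrite cdist_padd; lra|].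
      split; [intros j Hj; apply Hz; try assumption; lra|]. split.
      * intros Hu0 E. apply Hu0. rewrite <- (psub_padd p u), E.
        apply functional_extensionality; intro; unfold psub, pzero; ring.
      * intros l Hl. destruct (hderiv_coord N [i] (padd u p) l Hl) as [c Hc].
        exists c. exact (hderiv_translate N [i] (fun w : pt => w l) u p c Hc).
    + assert (Hj : exists j, (j < k)%nat /\ forall s, 0 < s -> exists z, supp L z /\ cdist N z p < s /\ g j z <> C0).
      { apply NNPP; intro Hno. apply Hnot. intros j Hjk. apply NNPP; intro Hno2. apply Hno.
        exists j. split; [exact Hjk|]. intros s Hs. apply NNPP; intro Hno3. apply Hno2.
        exists s. split; [exact Hs|]. intros h Hh Hhn. apply NNPP; intro Hne. apply Hno3.
        exists (padd p h). split; [now apply supp_add|]. split; [now rewrite cdist_padd|exact Hne]. }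
      destruct Hj as (j0 & Hj0 & Hnz).
      destruct (nonzero_iterated_derivative L p r (g j0) HL Hp Hr (Hg j0 Hj0) Hnz) as (v & n0 & Hv & Hn0).
      set (Dg := fun m => Nat.iter m (dv v) (g j0)).
      (* Along the orders m, [Dg 0] vanishes on T while [Dg n0] does not vanish at p, so somewhere
         vanishing on T is lost. This happens at a point p' that may differ from p, and for this
         reason the disc cannot be made to pass through p. *)
      assert (Hmin : exists m p', T p' /\ cdist N p' p < r /\ Dg (S m) p' <> C0 /\
         forall z, T z -> cdist N z p < r -> Dg m z = C0).
      { assert (Hstrong : forall m, (exists z, T z /\ cdist N z p < r /\ Dg m z <> C0) ->
           exists m' p', T p' /\ cdist N p' p < r /\ Dg (S m') p' <> C0 /\
             forall z, T z -> cdist N z p < r -> Dg m' z = C0).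
        { induction m as [|m IHm]; intros (z & Tz & Hzd & Hz).
          - exfalso. apply Hz. now apply Hvan.
          - destruct (classic (exists y, T y /\ cdist N y p < r /\ Dg m y <> C0)) as [Hy|Hy].
            + now apply IHm.
            + exists m, z. repeat split; try assumption.
              intros y Ty Hyd. apply NNPP; intro. apply Hy. now exists y. }
        apply (Hstrong n0). exists p. split; [exact Tp|]. split; [now rewrite cdist_refl|exact Hn0]. }
      destruct Hmin as (m & p' & Tp' & Hp'd & HDp' & HDz).
      assert (Hp' := HT p' Tp').
      assert (HDhol : hol N L p r (Dg m)) by (apply dv_iter_hol; auto).
      destruct (HDhol p' Hp' Hp'd) as [c Hc].
      change (Dg (S m) p') with (dv v (Dg m) p') in HDp'.
      rewrite (dv_eq N L v _ _ c Hv Hc) in HDp'.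
      destruct (lin_nonzero_coord L c v Hv HDp') as (i & Hi & Hci).
      set (r1 := r - cdist N p' p). assert (Hr1 : 0 < r1) by (unfold r1; lra).
      destruct (implicit_function N L i p' r1 (Dg m) c) as (rho & H & Hrho & HH & Hcen & Huni).
      { exact HL. } { exact Hi. } { exact Hp'. } { exact Hr1. }
      { apply (hol_sub N L p r); [exact HDhol|unfold r1; lra]. }
      { now apply HDz. } { exact Hc. } { exact Hci. }
      set (L' := remove Nat.eq_dec i L) in *.
      set (Gr := fun z => upd z i (H z)).
      set (rh := Rmin rho r1).
      assert (Hrh : 0 < rh) by now apply Rmin_pos.
      assert (Hrh1 : rh <= rho) by apply Rmin_l. assert (Hrh2 : rh <= r1) by apply Rmin_r.
      assert (HGr : forall z, supp L' z -> cdist N z (upd p' i C0) < rh -> supp L (Gr z) /\ cdist N (Gr z) p < r).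
      { intros z Hz Hzd. split.
        - apply supp_upd; [exact Hi|]. apply (supp_incl L L'); [apply incl_remove|exact Hz].
        - destruct (HH z Hz ltac:(lra)) as [Hd _]. eapply Rle_lt_trans; [apply (cdist_triangle N _ p')|].
          unfold Gr, r1 in *. lra. }
      (* The shadow of T on the hyperplane. The distance conditions ensure that [Huni] applies, so
         zeroing the i-th coordinate maps the part of T near p' bijectively onto T', with inverse
         Gr; isolated points are thereby excluded. *)
      set (T' := fun z => supp L' z /\ cdist N z (upd p' i C0) < rh /\ T (Gr z) /\ cdist N (Gr z) p' < rh).
      assert (HGp' : Gr (upd p' i C0) = p').
      { unfold Gr. rewrite Hcen, upd_upd. apply upd_self. }
      destruct (IH L' T' (upd p' i C0) rh (fun j z => g j (Gr z)) k)
        as (p2 & i2 & gam & r2 & Tp2 & Hp2d & Hr2 & Hi2 & Hg0 & Hgam).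
      { assert (Hlt := remove_length_lt Nat.eq_dec L i Hi). fold L' in Hlt. lia. }
      { intros j Hj. apply HL. now apply (incl_remove L i). }
      { exact Hrh. }
      { unfold T'. rewrite HGp', !cdist_refl. split; [now apply supp_remove_upd|].
        split; [exact Hrh|]. split; [exact Tp'|exact Hrh]. }
      { now intros z [Hz _]. }
      { intros z (Hz & Hzd & Tz & Hzd') e He.
        set (e1 := Rmin e (Rmin (rh - cdist N (Gr z) p') (rh - cdist N z (upd p' i C0)))).
        assert (He1 : 0 < e1) by (unfold e1; repeat apply Rmin_pos; lra).
        assert (B1 := Rmin_l e (Rmin (rh - cdist N (Gr z) p') (rh - cdist N z (upd p' i C0)))).
        assert (B2 := Rmin_r e (Rmin (rh - cdist N (Gr z) p') (rh - cdist N z (upd p' i C0)))).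
        assert (B3 := Rmin_l (rh - cdist N (Gr z) p') (rh - cdist N z (upd p' i C0))).
        assert (B4 := Rmin_r (rh - cdist N (Gr z) p') (rh - cdist N z (upd p' i C0))).
        fold e1 in B1, B2.
        destruct (Hiso (Gr z) Tz e1 He1) as (t & Tt & Htz & Htd).
        assert (Htp' : cdist N t p' < rh).
        { eapply Rle_lt_trans; [apply (cdist_triangle N t (Gr z) p')|]. lra. }
        assert (Htp : cdist N t p < r).
        { eapply Rle_lt_trans; [apply (cdist_triangle N t p' p)|]. unfold r1 in *. lra. }
        assert (HHt : H (upd t i C0) = t i) by (apply Huni; [now apply HT|lra|now apply HDz]).
        assert (HGt : Gr (upd t i C0) = t) by (unfold Gr; rewrite HHt, upd_upd; apply upd_self).
        assert (Ez : upd (Gr z) i C0 = z).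
        { unfold Gr. rewrite upd_upd. rewrite <- (upd_self z i) at 2.
          now rewrite (supp_remove_at L z i Hz). }
        assert (Hpr : cdist N (upd t i C0) z <= cdist N t (Gr z)).
        { rewrite <- Ez at 1. apply cdist_upd0_le. }
        exists (upd t i C0). split; [|split].
        - unfold T'. rewrite HGt. split; [apply supp_remove_upd; now apply HT|].
          split; [|split; [exact Tt|exact Htp']].
          eapply Rle_lt_trans; [apply (cdist_triangle N _ z)|]. lra.
        - intro E. apply Htz. now rewrite <- HGt, E.
        - lra. }
      { intros j Hj z Hz Hzd. destruct (HGr z Hz Hzd) as [H1 H2].
        apply (hderiv_comp_ex L L' (g j) Gr z 1 Rlt_0_1).
        - intros h Hh _. apply graph_supp; [exact Hi|now apply supp_add|exact Hz].
        - intros l Hl. apply graph_coord_hderiv; [exact Hl|]. apply HH; [exact Hz|lra].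
        - now apply Hg. }
      { intros z j (Hz & Hzd & Tz & _) _ Hj. apply Hvan; [exact Tz| |exact Hj]. now apply HGr. }
      assert (Hproj : forall z, supp L' z -> upd (Gr z) i C0 = z).
      { intros z Hz. unfold Gr. rewrite upd_upd. rewrite <- (upd_self z i) at 2.
        now rewrite (supp_remove_at L z i Hz). }
      destruct Tp2 as (Hp2 & Hp2d' & Tp2 & Hp2d2).
      exists (Gr p2), i2, (fun u => Gr (gam u)), r2.
      split; [exact Tp2|]. split; [now apply HGr|]. split; [exact Hr2|]. split; [exact Hi2|].
      split; [now rewrite Hg0|].
      intros u Hu Hun. destruct (Hgam u Hu Hun) as (G1 & G2 & G3 & G4 & G5).
      destruct (HGr (gam u) G1 G2) as [Q1 Q2].
      split; [exact Q1|]. split; [exact Q2|]. split; [exact G3|]. split.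
      (* Zeroing the i-th coordinate undoes Gr, so the lifted disc also returns to its centre only
         at u = 0. *)
      * intros Hu0 E. apply (G4 Hu0). rewrite <- (Hproj _ G1), <- (Hproj _ Hp2). now rewrite E.
      * intros l Hl. destruct (Nat.eq_dec l i) as [->|Hn].
        -- replace (fun w => Gr (gam w) i) with (fun w => H (gam w)).
           2:{ apply functional_extensionality; intro w. unfold Gr. now rewrite upd_at. }
           apply (hderiv_comp_ex L' [i2] H gam u (r2 - cnorm N u)); [lra| |exact G5|].
           ++ intros h Hh Hhn. apply supp_sub; [|exact G1].
              apply Hgam; [now apply supp_add|].
              eapply Rle_lt_trans; [apply cnorm_padd|]. lra.
           ++ apply HH; [exact G1|lra].
        -- replace (fun w => Gr (gam w) l) with (fun w => gam w l); [now apply G5|].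
           apply functional_extensionality; intro w. unfold Gr. now rewrite upd_other.
Qed.

Lemma hderiv_unique L f z c c' i : below N L -> In i L -> hderiv N L f z c -> hderiv N L f z c' -> c i = c' i.
Proof.
  intros HL Hi H H'. rewrite <- (lin_punit N c i), <- (lin_punit N c' i) by now apply HL.
  rewrite <- (dv_eq N L (punit i) f z c), <- (dv_eq N L (punit i) f z c'); auto using supp_unit.
Qed.

Lemma hderiv_local_zero L f z e : 0 < e -> (forall h, supp L h -> cnorm N h < e -> f (padd z h) = C0) ->
  hderiv N L f z (fun _ => C0).
Proof.
  intros He H eps Heps. exists e. split; [exact He|]. intros h Hh Hn. rewrite H by assumption.
  replace (f z) with C0.
  - replace (lin N (fun _ => C0) h) with C0 by (symmetry; apply sumC_zero; intros; ring).
    replace (Csub (Csub C0 C0) C0) with C0 by ring. rewrite Cmod_C0.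
    apply Rmult_le_pos; [lra|apply cnorm_ge_0].
  - rewrite <- (padd_zero z). symmetry. apply H; [apply supp_zero|now rewrite cnorm_pzero].
Qed.

Lemma NoDup_remove_length (L : list nat) i : NoDup L -> In i L ->
  NoDup (remove Nat.eq_dec i L) /\ S (length (remove Nat.eq_dec i L)) = length L.
Proof.
  intros HN Hi. split.
  - clear Hi. induction HN as [|j L Hj HN IH]; [constructor|]. simpl.
    destruct Nat.eq_dec; [exact IH|]. constructor; [|exact IH].
    intro H. apply Hj. now apply in_remove in H.
  - induction HN as [|j L Hj HN IH]; [contradiction|]. simpl. destruct Nat.eq_dec as [->|Hn].
    + now rewrite notin_remove.
    + simpl. rewrite IH; [reflexivity|]. destruct Hi; [congruence|assumption].
Qed.

(** Fewer independent equations than variables: solve the last equation for one variable, pull the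
    others back to its graph, and induct. Independence survives because the pullback performs
    Gaussian elimination on the gradients. With no equation left, any coordinate direction is
    free. *)
Lemma regular_zero_not_isolated k : forall L p r (g : nat -> pt -> C) (c : nat -> nat -> C),
  NoDup L -> below N L -> (k < length L)%nat -> supp L p -> 0 < r ->
  (forall j, (j < k)%nat -> hol N L p r (g j)) ->
  (forall j, (j < k)%nat -> hderiv N L (g j) p (c j)) ->
  (forall j, (j < k)%nat -> g j p = C0) ->
  (forall a : nat -> C, (forall i, In i L -> sumC (fun j => Cmul (a j) (c j i)) k = C0) ->
     forall j, (j < k)%nat -> a j = C0) ->
  forall e, 0 < e -> exists q, supp L q /\ q <> p /\ cdist N q p < e /\ forall j, (j < k)%nat -> g j q = C0.
Proof.
  induction k as [|k IH]; intros L p r g c HN HL Hlen Hp Hr Hg Hc Hgp Hind e He.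
  - destruct L as [|i L]; [simpl in Hlen; lia|].
    set (h := pscal (RtoC (e / 2)) (punit i)).
    assert (Hh : supp (i :: L) h) by (apply supp_scal, supp_unit; now left).
    exists (padd p h). split; [now apply supp_add|]. split; [|split; [|intros; lia]].
    + intro E. assert (E' := f_equal (fun z : pt => fst (z i)) E). unfold padd, h, pscal, punit in E'.
      destruct Nat.eq_dec as [_|Hn]; [|contradiction].
      unfold Cadd, Cmul, RtoC, C1 in E'. cbn [fst snd] in E'. lra.
    + rewrite cdist_padd. eapply Rle_lt_trans; [apply cnorm_punit_le|].
      rewrite Cmod_RtoC, Rabs_pos_eq; lra.
  - assert (Hi : exists i, In i L /\ c k i <> C0).
    (* A zero last gradient would be a relation with coefficient 1 in place k and 0 elsewhere. *)
    { apply NNPP; intro Hno.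
      apply C1_neq_C0. rewrite <- (Hind (fun j => if Nat.eq_dec j k then C1 else C0)) with (j := k).
      - now destruct Nat.eq_dec.
      - intros i Hi. rewrite (sumC_single _ (S k) k) by
          (lia || (intros j _ Hj; destruct Nat.eq_dec; [contradiction|ring])).
        replace (c k i) with C0; [ring|]. apply NNPP; intro. apply Hno. exists i; auto.
      - lia. }
    destruct Hi as (i & Hi & Hci). assert (HiN := HL i Hi).
    destruct (implicit_function N L i p r (g k) (c k)) as (rho & H & Hrho & HH & Hcen & _);
      try assumption; try (now apply Hg || now apply Hgp || now apply Hc).
    { apply Hg; lia. } { apply Hgp; lia. } { apply Hc; lia. }
    set (L' := remove Nat.eq_dec i L) in *. set (p0 := upd p i C0) in *.
    set (Gr := fun z => upd z i (H z)).
    assert (HL' : below N L') by (intros j Hj; apply HL; now apply (incl_remove L i)).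
    assert (Hp0 : supp L' p0) by now apply supp_remove_upd.
    assert (HGp0 : Gr p0 = p) by (unfold Gr; rewrite Hcen; unfold p0; rewrite upd_upd; apply upd_self).
    destruct (HH p0 Hp0) as (_ & _ & dH & HdH); [now rewrite cdist_refl|].
    set (D := fun m l : nat => if Nat.eq_dec m i then dH l else if Nat.eq_dec l m then C1 else C0).
    assert (HD : forall j, (j < N)%nat -> hderiv N L' (fun w => Gr w j) p0 (D j)).
    { intros j Hj. unfold D. destruct (Nat.eq_dec j i) as [->|Hn].
      - replace (fun w => Gr w i) with H; [exact HdH|].
        apply functional_extensionality; intro w. unfold Gr. now rewrite upd_at.
      - replace (fun w => Gr w j) with (fun w : pt => w j).
        2:{ apply functional_extensionality; intro w. unfold Gr. now rewrite upd_other. }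
        intros eps Heps. exists 1. split; [lra|]. intros h _ _.
        replace (lin N (fun l => if Nat.eq_dec l j then C1 else C0) h) with (h j).
        + replace (Csub (Csub (padd p0 h j) (p0 j)) (h j)) with C0 by (unfold padd; ring).
          rewrite Cmod_C0. apply Rmult_le_pos; [lra|apply cnorm_ge_0].
        + unfold lin. rewrite (sumC_single _ N j Hj).
          * destruct Nat.eq_dec; [ring|contradiction].
          * intros l _ Hl. destruct Nat.eq_dec; [contradiction|ring]. }
    assert (HsG : forall h, supp L' h -> cnorm N h < 1 -> supp L (psub (Gr (padd p0 h)) (Gr p0))).
    { intros h Hh _. apply graph_supp; [exact Hi|now apply supp_add|exact Hp0]. }
    set (c' := fun j l => sumC (fun m => Cmul (c j m) (D m l)) N).
    assert (Hc' : forall j, (j < S k)%nat -> hderiv N L' (fun z => g j (Gr z)) p0 (c' j)).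
    { intros j Hj. apply (hderiv_comp N L L' (g j) Gr p0 (c j) D 1 Rlt_0_1 HsG HD).
      rewrite HGp0. now apply Hc. }
    assert (Ec' : forall j l, In l L' -> c' j l = Cadd (c j l) (Cmul (c j i) (dH l))).
    { intros j l Hl. assert (HlN := HL' l Hl).
      assert (Hli : l <> i) by (intros ->; now apply remove_In in Hl).
      unfold c'.
      transitivity (Cadd (sumC (fun m => if Nat.eq_dec m l then c j m else C0) N)
                         (sumC (fun m => if Nat.eq_dec m i then Cmul (c j m) (dH l) else C0) N)).
      - rewrite <- sumC_add. apply sumC_ext. intros m _. unfold D.
        destruct (Nat.eq_dec m i) as [E1|E1]; destruct (Nat.eq_dec l m) as [E2|E2];
          destruct (Nat.eq_dec m l) as [E3|E3]; try (exfalso; congruence); ring.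
      - rewrite (sumC_single _ N l HlN), (sumC_single _ N i HiN).
        + destruct (Nat.eq_dec l l); [|contradiction]. destruct (Nat.eq_dec i i); [reflexivity|contradiction].
        + intros m _ Hm. destruct Nat.eq_dec; [contradiction|reflexivity].
        + intros m _ Hm. destruct Nat.eq_dec; [contradiction|reflexivity]. }
    assert (Hzero : forall l, In l L' -> c' k l = C0).
    (* The last equation vanishes identically on its graph, so its pulled-back gradient is zero;
       this expresses the gradient of H through [c k]. *)
    { intros l Hl.
      apply (hderiv_unique L' (fun z => g k (Gr z)) p0 (c' k) (fun _ => C0) l HL' Hl); [apply Hc'; lia|].
      apply (hderiv_local_zero L' _ p0 rho Hrho). intros h Hh Hhn.
      apply HH; [now apply supp_add|now rewrite cdist_padd]. }
    destruct (NoDup_remove_length L i HN Hi) as [HN' Hlen']. fold L' in HN', Hlen'.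
    destruct (hderiv_continuous N L' H p0 dH Hp0 HdH (e / 2) ltac:(lra)) as [s [Hs Hcont]].
    set (e' := Rmin (Rmin rho s) (e / 4)).
    assert (He' : 0 < e') by (unfold e'; repeat apply Rmin_pos; lra).
    assert (B1 := Rmin_l (Rmin rho s) (e / 4)). assert (B2 := Rmin_r (Rmin rho s) (e / 4)).
    assert (B3 := Rmin_l rho s). assert (B4 := Rmin_r rho s). fold e' in B1, B2.
    destruct (IH L' p0 rho (fun j z => g j (Gr z)) c') with (e := e') as (q & Hq & Hqp & Hqd & Hqg); try assumption.
    + lia.
    + intros j Hj z Hz Hzd. destruct (HH z Hz Hzd) as (H1 & _ & H3).
      apply (hderiv_comp_ex L L' (g j) Gr z 1 Rlt_0_1).
      * intros h Hh _. apply graph_supp; [exact Hi|now apply supp_add|exact Hz].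
      * intros l Hl. now apply graph_coord_hderiv.
      * apply Hg; [lia| |exact H1]. apply supp_upd; [exact Hi|].
        apply (supp_incl L L'); [apply incl_remove|exact Hz].
    + intros j Hj. apply Hc'; lia.
    + intros j Hj. rewrite HGp0. apply Hgp; lia.
    + intros a Ha j Hj.
      (* A relation [a] between the pulled-back gradients extends to one between all original
         gradients: [b], the coefficient of the last gradient, is chosen to cancel the i-th
         entry. *)
      set (Ai := sumC (fun j => Cmul (a j) (c j i)) k).
      set (b := Copp (Cmul Ai (Cinv (c k i)))).
      assert (Hb : Cmul b (c k i) = Copp Ai).
      { unfold b. replace (Cmul (Copp (Cmul Ai (Cinv (c k i)))) (c k i))
          with (Copp (Cmul Ai (Cmul (Cinv (c k i)) (c k i)))) by ring.
        rewrite Cmul_inv_l by exact Hci. ring. }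
      assert (Hall := Hind (fun j => if Nat.eq_dec j k then b else a j)).
      rewrite <- (Hall) with (j := j); [|clear Hall|lia].
      { destruct (Nat.eq_dec j k); [lia|reflexivity]. }
      intros l Hl. simpl. destruct (Nat.eq_dec k k) as [_|Hn]; [|contradiction].
      rewrite (sumC_ext _ (fun j => Cmul (a j) (c j l)) k).
      2:{ intros m Hm. destruct (Nat.eq_dec m k); [lia|reflexivity]. }
      destruct (Nat.eq_dec l i) as [->|Hli].
      * fold Ai. rewrite Hb. ring.
      * assert (Hl' : In l L') by now apply in_in_remove.
        specialize (Ha l Hl').
        rewrite (sumC_ext _ (fun j => Cadd (Cmul (a j) (c j l)) (Cmul (dH l) (Cmul (a j) (c j i))))) in Ha.
        2:{ intros m Hm. rewrite Ec' by exact Hl'. ring. }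
        rewrite sumC_add, sumC_scal in Ha. fold Ai in Ha.
        assert (Hz := Hzero l Hl'). rewrite Ec' in Hz by exact Hl'.
        set (Al := sumC (fun j => Cmul (a j) (c j l)) k) in *.
        assert (E1 : c k l = Copp (Cmul (c k i) (dH l))).
        { replace (c k l) with (Csub (Cadd (c k l) (Cmul (c k i) (dH l))) (Cmul (c k i) (dH l))) by ring.
          rewrite Hz. ring. }
        assert (E2 : Al = Copp (Cmul (dH l) Ai)).
        { replace Al with (Csub (Cadd Al (Cmul (dH l) Ai)) (Cmul (dH l) Ai)) by ring.
          rewrite Ha. ring. }
        rewrite E1, E2. transitivity (Csub (Copp (Cmul (dH l) Ai)) (Cmul (Cmul b (c k i)) (dH l))); [ring|].
        rewrite Hb. ring.
    + exists (Gr q). destruct (HH q Hq ltac:(lra)) as (_ & Hgk & _).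
      assert (Hqi := supp_remove_at L q i Hq).
      split; [apply supp_upd; [exact Hi|]; apply (supp_incl L L'); [apply incl_remove|exact Hq]|].
      split; [|split].
      * intro E. apply Hqp. unfold p0. rewrite <- E. unfold Gr. rewrite upd_upd.
        rewrite <- (upd_self q i) at 1. now rewrite Hqi.
      * eapply Rle_lt_trans; [now apply cdist_upd_le|]. fold p0. rewrite <- Hcen.
        specialize (Hcont q Hq ltac:(lra)). fold p0. lra.
      * intros j Hj. destruct (Nat.eq_dec j k) as [->|Hn]; [exact Hgk|]. apply Hqg; lia.
Qed.

End Discs.

(** * Maximum principle on varieties *)

(** A high power lets a larger |f| outweigh any fixed positive factors. *)
Lemma pow_dominate x y b B : 0 < x < y -> 0 < b -> 0 <= B -> exists m, x ^ m * B < y ^ m * b.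
Proof.
  intros Hx Hb HB.
  destruct (pow_lt_1_zero (x / y)) with (y := b / (B + 1)) as [m Hm].
  - rewrite Rabs_pos_eq; [|apply Rlt_le, Rdiv_lt_0_compat; lra].
    apply Rmult_lt_reg_r with y; [lra|]. unfold Rdiv. rewrite Rmult_assoc, Rinv_l; lra.
  - apply Rdiv_lt_0_compat; lra.
  - exists m. specialize (Hm m (Nat.le_refl m)).
    rewrite Rabs_pos_eq in Hm by (apply pow_le, Rlt_le, Rdiv_lt_0_compat; lra).
    assert (Py : 0 < y ^ m) by (apply pow_lt; lra). assert (Px : 0 < x ^ m) by (apply pow_lt; lra).
    unfold Rdiv in Hm at 1. rewrite Rpow_mult_distr, pow_inv in Hm.
    apply (Rmult_lt_compat_r (y ^ m * (B + 1))) in Hm; [|nra].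
    replace (x ^ m * / y ^ m * (y ^ m * (B + 1))) with (x ^ m * (B + 1)) in Hm by (field; lra).
    replace (b / (B + 1) * (y ^ m * (B + 1))) with (y ^ m * b) in Hm by (field; lra). nra.
Qed.

Section Peaks.
Context (N : nat).

Definition entire (f : pt -> C) : Prop := forall z, inCN N z -> exists c, hderiv N (seq 0 N) f z c.

Lemma below_seq : below N (seq 0 N).
Proof. intros i Hi. apply in_seq in Hi. lia. Qed.

Lemma hderiv_mul L f g z c d : hderiv N L f z c -> hderiv N L g z d ->
  exists e, hderiv N L (fun w => Cmul (f w) (g w)) z e.
Proof.
  intros Hf Hg. exists (fun i => Cadd (Cmul (g z) (c i)) (Cmul (f z) (d i))).
  destruct (hderiv_lipschitz N L f z c Hf) as (K & d0 & HK & Hd0 & H0).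
  destruct (hderiv_lipschitz N L g z d Hg) as (K' & d3 & HK' & Hd3 & H3).
  assert (Pf := Cmod_ge_0 (f z)). assert (Pg := Cmod_ge_0 (g z)).
  intros eps He.
  destruct (Hf (eps / (4 * (Cmod (g z) + 1)))) as [d1 [Hd1 H1]]; [apply Rdiv_lt_0_compat; lra|].
  destruct (Hg (eps / (4 * (Cmod (f z) + 1)))) as [d2 [Hd2 H2]]; [apply Rdiv_lt_0_compat; lra|].
  destruct (small_multiple (K * K') (eps / 2)) as [d4 [Hd4 H4]]; [nra|lra|].
  exists (Rmin (Rmin d0 d3) (Rmin (Rmin d1 d2) d4)).
  split; [repeat (assumption || apply Rmin_pos)|]. intros h Hh Hn.
  assert (B1 := Rmin_l (Rmin d0 d3) (Rmin (Rmin d1 d2) d4)).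
  assert (B2 := Rmin_r (Rmin d0 d3) (Rmin (Rmin d1 d2) d4)).
  assert (B3 := Rmin_l d0 d3). assert (B4 := Rmin_r d0 d3).
  assert (B5 := Rmin_l (Rmin d1 d2) d4). assert (B6 := Rmin_r (Rmin d1 d2) d4).
  assert (B7 := Rmin_l d1 d2). assert (B8 := Rmin_r d1 d2).
  assert (Ph := cnorm_ge_0 N h).
  specialize (H0 h Hh ltac:(lra)). specialize (H1 h Hh ltac:(lra)).
  specialize (H2 h Hh ltac:(lra)). specialize (H3 h Hh ltac:(lra)). specialize (H4 (cnorm N h) ltac:(lra)).
  replace (lin N (fun i => Cadd (Cmul (g z) (c i)) (Cmul (f z) (d i))) h)
    with (Cadd (Cmul (g z) (lin N c h)) (Cmul (f z) (lin N d h))).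
  2:{ unfold lin. rewrite <- !sumC_scal, <- sumC_add. apply sumC_ext. intros; ring. }
  match goal with |- Cmod ?t <= _ => replace t with
    (Cadd (Cmul (Csub (f (padd z h)) (f z)) (Csub (g (padd z h)) (g z)))
      (Cadd (Cmul (f z) (Csub (Csub (g (padd z h)) (g z)) (lin N d h)))
            (Cmul (g z) (Csub (Csub (f (padd z h)) (f z)) (lin N c h))))) by ring end.
  eapply Rle_trans; [apply Cmod_add|].
  eapply Rle_trans; [apply Rplus_le_compat_l, Cmod_add|]. rewrite !Cmod_mul.
  assert (E1 : Cmod (Csub (f (padd z h)) (f z)) * Cmod (Csub (g (padd z h)) (g z)) <= eps / 2 * cnorm N h).
  { eapply Rle_trans; [apply Rmult_le_compat; [apply Cmod_ge_0|apply Cmod_ge_0|apply H0|apply H3]|].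
    replace (K * cnorm N h * (K' * cnorm N h)) with (K * K' * cnorm N h * cnorm N h) by ring.
    now apply Rmult_le_compat_r. }
  assert (Haux : forall A B, 0 <= A -> B <= eps / (4 * (A + 1)) * cnorm N h -> A * B <= eps / 4 * cnorm N h).
  { intros A B PA HB. eapply Rle_trans; [apply Rmult_le_compat_l; [exact PA|apply HB]|].
    replace (eps / 4 * cnorm N h)
      with ((A + 1) * (eps / (4 * (A + 1)) * cnorm N h)) by (field; lra).
    apply Rmult_le_compat_r; [|lra].
    apply Rmult_le_pos; [apply Rlt_le, Rdiv_lt_0_compat; lra|exact Ph]. }
  assert (E2 := Haux _ _ Pf H2). assert (E3 := Haux _ _ Pg H1). lra.
Qed.

Lemma hderiv_add L f g z c d : hderiv N L f z c -> hderiv N L g z d ->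
  exists e, hderiv N L (fun w => Cadd (f w) (g w)) z e.
Proof.
  intros Hf Hg. assert (H := hderiv_sub N L f _ z c _ Hf (hderiv_scal N L (Copp C1) g z d Hg)).
  eexists. replace (fun w => Cadd (f w) (g w)) with (fun w => Csub (f w) (Cmul (Copp C1) (g w))).
  - exact H.
  - apply functional_extensionality; intro; ring.
Qed.

Lemma entire_mul f g : entire f -> entire g -> entire (fun w => Cmul (f w) (g w)).
Proof.
  intros Hf Hg z Hz. destruct (Hf z Hz) as [c Hc]. destruct (Hg z Hz) as [d Hd].
  now apply (hderiv_mul _ f g z c d).
Qed.

Lemma entire_add f g : entire f -> entire g -> entire (fun w => Cadd (f w) (g w)).
Proof.
  intros Hf Hg z Hz. destruct (Hf z Hz) as [c Hc]. destruct (Hg z Hz) as [d Hd].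
  now apply (hderiv_add _ f g z c d).
Qed.

Lemma entire_const k : entire (fun _ => k).
Proof. intros z _. eexists; apply hderiv_const. Qed.

Lemma entire_coord i : (i < N)%nat -> entire (fun w => w i).
Proof. intros Hi z _. now apply hderiv_coord. Qed.

Fixpoint cpow (f : pt -> C) (m : nat) (z : pt) : C :=
  match m with O => C1 | S m => Cmul (f z) (cpow f m z) end.

Lemma entire_cpow f m : entire f -> entire (cpow f m).
Proof.
  intro Hf. induction m as [|m IH]; [apply entire_const|]. exact (entire_mul _ _ Hf IH).
Qed.

Lemma Cmod_cpow f m z : Cmod (cpow f m z) = Cmod (f z) ^ m.
Proof. induction m as [|m IH]; simpl; [apply Cmod_C1|]. now rewrite Cmod_mul, IH. Qed.

Fixpoint weight (n : nat) (z : pt) : R :=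
  match n with O => 1 | S m => weight m z * (1 + Cmod (z m) * Cmod (z m)) end.
Fixpoint polar (n : nat) (p z : pt) : C :=
  match n with O => C1 | S m => Cmul (polar m p z) (Cadd C1 (Cmul (Cconj (p m)) (z m))) end.

Lemma weight_ge_1 n z : 1 <= weight n z.
Proof.
  induction n as [|n IH]; simpl; [lra|]. generalize (Cmod_ge_0 (z n)). nra.
Qed.

(** Lagrange's identity for the vectors (1, a) and (1, b): the defect in Cauchy-Schwarz is |b -
    a|^2. *)
Lemma polar_factor a b : Cmod (Cadd C1 (Cmul (Cconj a) b)) * Cmod (Cadd C1 (Cmul (Cconj a) b)) =
  (1 + Cmod b * Cmod b) * (1 + Cmod a * Cmod a) - Cmod (Csub b a) * Cmod (Csub b a).
Proof. rewrite !Cmod_sqr. unfold Cadd, Cmul, Cconj, Csub, C1; cbn [fst snd]. ring. Qed.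

Lemma polar_self n p : Cmod (polar n p p) = weight n p.
Proof.
  induction n as [|n IH]; simpl; [apply Cmod_C1|]. rewrite Cmod_mul, IH. f_equal.
  replace (Cadd C1 (Cmul (Cconj (p n)) (p n))) with (RtoC (1 + Cmod (p n) * Cmod (p n))).
  - rewrite Cmod_RtoC, Rabs_pos_eq; [reflexivity|]. generalize (Cmod_ge_0 (p n)). nra.
  - rewrite Cmod_sqr. unfold RtoC, Cadd, Cmul, Cconj, C1; cbn [fst snd]. f_equal; ring.
Qed.

(* Equality case of (1 + |a|^2)(1 + |b|^2) >= |1 + conj(a) b|^2 in each coordinate: this is what
   turns a maximum into a strict one using a holomorphic factor only. *)
Lemma polar_bound n p z :
  Cmod (polar n p z) * Cmod (polar n p z) <= weight n z * weight n p /\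
  ((exists j, (j < n)%nat /\ z j <> p j) ->
    Cmod (polar n p z) * Cmod (polar n p z) < weight n z * weight n p).
Proof.
  induction n as [|n [IH1 IH2]]; simpl.
  - rewrite Cmod_C1. split; [lra|]. intros [j [Hj _]]; lia.
  - rewrite Cmod_mul.
    set (P := Cmod (polar n p z)) in *. set (A := weight n z * weight n p) in *.
    set (F := Cmod (Cadd C1 (Cmul (Cconj (p n)) (z n)))).
    set (B := (1 + Cmod (z n) * Cmod (z n)) * (1 + Cmod (p n) * Cmod (p n))).
    assert (EF : F * F = B - Cmod (Csub (z n) (p n)) * Cmod (Csub (z n) (p n))) by apply polar_factor.
    assert (HA : 0 < A).
    { unfold A. generalize (weight_ge_1 n z) (weight_ge_1 n p). nra. }
    assert (HB : 0 < B) by (unfold B; generalize (Cmod_ge_0 (z n)) (Cmod_ge_0 (p n)); nra).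
    assert (Pd := Cmod_ge_0 (Csub (z n) (p n))).
    assert (HF : 0 <= F * F <= B) by (split; nra).
    assert (HP : 0 <= P * P) by nra.
    replace (P * F * (P * F)) with (P * P * (F * F)) by ring.
    replace (weight n z * (1 + Cmod (z n) * Cmod (z n)) * (weight n p * (1 + Cmod (p n) * Cmod (p n))))
      with (A * B) by (unfold A, B; ring).
    split; [apply Rmult_le_compat; lra|]. intros [j [Hj Hzp]].
    destruct (classic (z n = p n)) as [E|E].
    + assert (EFB : F * F = B).
      { rewrite EF, E. replace (Csub (p n) (p n)) with C0 by ring. rewrite Cmod_C0. ring. }
      rewrite EFB. apply Rmult_lt_compat_r; [exact HB|]. apply IH2. exists j. split; [|exact Hzp].
      destruct (Nat.eq_dec j n) as [->|]; [contradiction|lia].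
    + assert (0 < Cmod (Csub (z n) (p n))).
      { apply Cmod_pos. intro E0. apply E. replace (z n) with (Cadd (Csub (z n) (p n)) (p n)) by ring.
        rewrite E0; ring. }
      assert (F * F < B) by nra.
      apply Rle_lt_trans with (A * (F * F)); [apply Rmult_le_compat_r; lra|].
      apply Rmult_lt_compat_l; lra.
Qed.

Lemma entire_polar n p : (n <= N)%nat -> entire (polar n p).
Proof.
  induction n as [|n IH]; intro Hn; [apply entire_const|].
  apply (entire_mul (polar n p) (fun z => Cadd C1 (Cmul (Cconj (p n)) (z n)))); [apply IH; lia|].
  apply (entire_add (fun _ => C1)); [apply entire_const|].
  apply (entire_mul (fun _ => Cconj (p n))); [apply entire_const|]. apply entire_coord; lia.
Qed.

Lemma Cmod_diff_le a b : Rabs (Cmod a - Cmod b) <= Cmod (Csub a b).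
Proof.
  apply Rabs_le.
  assert (Q1 : Cmod a <= Cmod (Csub a b) + Cmod b).
  { eapply Rle_trans; [|apply Cmod_add]. right; f_equal; ring. }
  assert (Q2 : Cmod b <= Cmod (Csub a b) + Cmod a).
  { rewrite Cmod_sub_sym. eapply Rle_trans; [|apply Cmod_add]. right; f_equal; ring. }
  lra.
Qed.

Lemma entire_continuous f z : entire f -> inCN N z -> forall eps, 0 < eps -> exists d, 0 < d /\
  forall w, inCN N w -> cdist N w z < d -> Cmod (Csub (f w) (f z)) < eps.
Proof.
  intros Hf Hz eps He. destruct (Hf z Hz) as [c Hc].
  destruct (hderiv_continuous N (seq 0 N) f z c) with (eps := eps / 2) as [d [Hd H]];
    [now apply supp_seq|exact Hc|lra|].
  exists d. split; [exact Hd|]. intros w Hw Hwd.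
  specialize (H w ltac:(now apply supp_seq) Hwd). lra.
Qed.

Lemma pcontinuous_Cmod A f : (forall z, A z -> inCN N z) -> entire f -> pcontinuous_on N A (fun z => Cmod (f z)).
Proof.
  intros HA Hf l Hl eps He. destruct (entire_continuous f l Hf (HA l Hl) eps He) as [d [Hd H]].
  exists d. split; [exact Hd|]. intros w Hw Hwd.
  eapply Rle_lt_trans; [apply Cmod_diff_le|]. apply H; auto.
Qed.

Lemma pcontinuous_const A k : pcontinuous_on N A (fun _ => k).
Proof.
  intros l _ eps He. exists 1. split; [lra|]. intros. rewrite Rminus_diag, Rabs_R0. lra.
Qed.

Lemma pcontinuous_add A F G : pcontinuous_on N A F -> pcontinuous_on N A G ->
  pcontinuous_on N A (fun z => F z + G z).
Proof.
  intros HF HG l Hl eps He.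
  destruct (HF l Hl (eps / 2) ltac:(lra)) as [d1 [Hd1 H1]].
  destruct (HG l Hl (eps / 2) ltac:(lra)) as [d2 [Hd2 H2]].
  exists (Rmin d1 d2). split; [now apply Rmin_pos|]. intros w Hw Hwd.
  assert (B1 := Rmin_l d1 d2). assert (B2 := Rmin_r d1 d2).
  specialize (H1 w Hw ltac:(lra)). specialize (H2 w Hw ltac:(lra)).
  apply Rabs_def2 in H1. apply Rabs_def2 in H2. apply Rabs_def1; lra.
Qed.

Lemma pcontinuous_mult A F G : pcontinuous_on N A F -> pcontinuous_on N A G ->
  pcontinuous_on N A (fun z => F z * G z).
Proof.
  intros HF HG l Hl eps He.
  set (Kf := Rabs (F l) + 1). set (Kg := Rabs (G l) + 1).
  assert (Pf : 0 < Kf) by (unfold Kf; generalize (Rabs_pos (F l)); lra).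
  assert (Pg : 0 < Kg) by (unfold Kg; generalize (Rabs_pos (G l)); lra).
  set (ef := Rmin 1 (eps / (4 * Kg))). set (eg := eps / (4 * Kf)).
  assert (Hef : 0 < ef) by (unfold ef; apply Rmin_pos; [lra|apply Rdiv_lt_0_compat; lra]).
  assert (Heg : 0 < eg) by (apply Rdiv_lt_0_compat; lra).
  assert (Hef1 : ef <= 1) by apply Rmin_l. assert (Hef2 : ef <= eps / (4 * Kg)) by apply Rmin_r.
  destruct (HF l Hl ef Hef) as [d1 [Hd1 H1]]. destruct (HG l Hl eg Heg) as [d2 [Hd2 H2]].
  exists (Rmin d1 d2). split; [now apply Rmin_pos|]. intros w Hw Hwd.
  assert (B1 := Rmin_l d1 d2). assert (B2 := Rmin_r d1 d2).
  specialize (H1 w Hw ltac:(lra)). specialize (H2 w Hw ltac:(lra)).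
  assert (HFw : Rabs (F w) <= Kf).
  { replace (F w) with (F w - F l + F l) by ring. eapply Rle_trans; [apply Rabs_triang|]. unfold Kf; lra. }
  replace (F w * G w - F l * G l) with (F w * (G w - G l) + (F w - F l) * G l) by ring.
  eapply Rle_lt_trans; [apply Rabs_triang|]. rewrite !Rabs_mult.
  assert (E1 : Rabs (F w) * Rabs (G w - G l) <= Kf * eg) by (apply Rmult_le_compat; try apply Rabs_pos; lra).
  assert (E2 : Rabs (F w - F l) * Rabs (G l) <= eps / (4 * Kg) * Kg).
  { apply Rmult_le_compat; try apply Rabs_pos; [lra|unfold Kg; lra]. }
  replace (Kf * eg) with (eps / 4) in E1 by (unfold eg; field; lra).
  replace (eps / (4 * Kg) * Kg) with (eps / 4) in E2 by (field; lra). lra.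
Qed.

Lemma pcontinuous_weight A n : (forall z, A z -> inCN N z) -> (n <= N)%nat -> pcontinuous_on N A (weight n).
Proof.
  intros HA. induction n as [|n IH]; intro Hn; [apply pcontinuous_const|].
  assert (Hc : pcontinuous_on N A (fun z => Cmod (z n))).
  { apply (pcontinuous_Cmod A (fun z => z n) HA). apply entire_coord; lia. }
  apply (pcontinuous_mult A (weight n) (fun z => 1 + Cmod (z n) * Cmod (z n))); [apply IH; lia|].
  apply (pcontinuous_add A (fun _ => 1)); [apply pcontinuous_const|]. now apply pcontinuous_mult.
Qed.

(** S is a boundary to be avoided, on which |f| stays below |f(q)|; a high power of f keeps the
    maximum of the weighted modulus away from it. The factor l forces the peak away from the zeros
    of l: a coordinate difference moves it off a given point, and l = 1 imposes nothing. *)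
Lemma strict_peak_exists (A S : pt -> Prop) f l q mu :
  pcompact N A -> A q -> entire f -> entire l -> l q <> C0 -> 0 < mu < Cmod (f q) ->
  (forall s, A s -> S s -> Cmod (f s) <= mu) ->
  exists p f', A p /\ ~ S p /\ l p <> C0 /\ entire f' /\ forall x, A x -> x <> p -> Cmod (f' x) < Cmod (f' p).
Proof.
  intros HA Aq Hf Hl Hlq Hmu HS. assert (HAin := proj1 HA).
  set (b := fun z => Cmod (l z) * Cmod (l z) * weight N z).
  assert (Hbc : pcontinuous_on N A b).
  { unfold b. apply (pcontinuous_mult A (fun z => Cmod (l z) * Cmod (l z)) (weight N)).
    - apply pcontinuous_mult; now apply pcontinuous_Cmod.
    - now apply pcontinuous_weight. }
  destruct (pcompact_max N A b q HA Hbc Aq) as [xb [_ Hxb]].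
  assert (Hbpos : forall z, 0 <= b z).
  { intro z. unfold b. generalize (Cmod_ge_0 (l z)) (weight_ge_1 N z). intros.
    apply Rmult_le_pos; [nra|lra]. }
  assert (Hbq : 0 < b q).
  { unfold b. assert (P := Cmod_pos _ Hlq). generalize (weight_ge_1 N q). intros.
    apply Rmult_lt_0_compat; [nra|lra]. }
  destruct (pow_dominate (mu * mu) (Cmod (f q) * Cmod (f q)) (b q) (b xb)) as [m Hm];
    [nra|exact Hbq|apply Hbpos|].
  set (h := fun z => Cmul (cpow f m z) (l z)).
  assert (Hh : entire h) by (apply entire_mul; [now apply entire_cpow|exact Hl]).
  set (F := fun z => Cmod (h z) * Cmod (h z) * weight N z).
  assert (EF : forall z, F z = (Cmod (f z) * Cmod (f z)) ^ m * b z).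
  { intro z. unfold F, h, b. rewrite Cmod_mul, Cmod_cpow, Rpow_mult_distr. ring. }
  assert (HFc : pcontinuous_on N A F).
  { unfold F. apply (pcontinuous_mult A (fun z => Cmod (h z) * Cmod (h z)) (weight N)).
    - apply pcontinuous_mult; now apply pcontinuous_Cmod.
    - now apply pcontinuous_weight. }
  destruct (pcompact_max N A F q HA HFc Aq) as [p [Ap Hp]].
  assert (HFq : (mu * mu) ^ m * b xb < F p).
  { eapply Rlt_le_trans; [apply Hm|]. rewrite <- EF. now apply Hp. }
  assert (Hmm : 0 < (mu * mu) ^ m) by (apply pow_lt; nra).
  assert (HFp : 0 < F p) by (generalize (Hbpos xb); nra).
  exists p, (fun z => Cmul (h z) (polar N p z)).
  split; [exact Ap|]. split; [|split; [|split]].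
  - intro Sp. specialize (HS p Ap Sp). rewrite EF in HFq.
    assert ((Cmod (f p) * Cmod (f p)) ^ m * b p <= (mu * mu) ^ m * b xb); [|lra].
    assert (P := Cmod_ge_0 (f p)).
    apply Rmult_le_compat; [apply pow_le; nra|apply Hbpos| |now apply Hxb].
    apply pow_incr. nra.
  - intro E. unfold F, h in HFp. rewrite E in HFp. rewrite Cmod_mul, Cmod_C0 in HFp. lra.
  - apply entire_mul; [exact Hh|now apply entire_polar].
  - intros x Ax Hxp. rewrite !Cmod_mul, polar_self.
    assert (Hex : exists j, (j < N)%nat /\ x j <> p j).
    { apply NNPP; intro Hno. apply Hxp. apply functional_extensionality; intro j.
      destruct (Nat.le_gt_cases N j) as [Hj|Hj].
      - now rewrite (HAin x Ax j Hj), (HAin p Ap j Hj).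
      - apply NNPP; intro. apply Hno. now exists j. }
    destruct (polar_bound N p x) as [_ Hlt]. specialize (Hlt Hex). specialize (Hp x Ax).
    assert (Wp := weight_ge_1 N p). assert (Wx := weight_ge_1 N x).
    assert (P1 := Cmod_ge_0 (h x)). assert (P2 := Cmod_ge_0 (polar N p x)). assert (P3 := Cmod_ge_0 (h p)).
    unfold F in *. set (hx := Cmod (h x)) in *. set (px := Cmod (polar N p x)) in *. set (hp := Cmod (h p)) in *.
    (* The square at x is strictly below F x * weight p by the strict kernel inequality, or because
       F p is positive when h x = 0. At p the kernel equals the weight, so the square there is
       exactly F p * weight p. *)
    assert (Hsq : (hx * px) * (hx * px) < (hp * weight N p) * (hp * weight N p)).
    { replace (hp * weight N p * (hp * weight N p)) with (hp * hp * weight N p * weight N p) by ring.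
      destruct P1 as [P1|P1].
      - apply Rlt_le_trans with (hx * hx * weight N x * weight N p).
        + replace (hx * px * (hx * px)) with (hx * hx * (px * px)) by ring.
          rewrite (Rmult_assoc (hx * hx) (weight N x)). apply Rmult_lt_compat_l; [nra|exact Hlt].
        + apply Rmult_le_compat_r; lra.
      - rewrite <- P1. rewrite Rmult_0_l, Rmult_0_l. apply Rmult_lt_0_compat; lra. }
    assert (0 <= hp * weight N p) by (apply Rmult_le_pos; lra). nra.
Qed.

(** What the maximum principle uses of a variety of positive dimension. *)
Definition tame (V : pt -> Prop) : Prop :=
  (forall z, V z -> inCN N z) /\
  (forall u l, (forall n, V (u n)) -> inCN N l -> pcvg N u l -> V l) /\
  (forall p, V p -> exists r k (g : nat -> pt -> C), 0 < r /\
     (forall j, (j < k)%nat -> hol N (seq 0 N) p r (g j)) /\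
     (forall q, inCN N q -> cdist N q p < r -> (V q <-> forall j, (j < k)%nat -> g j q = C0))) /\
  (forall p, V p -> forall e, 0 < e -> exists q, V q /\ q <> p /\ cdist N q p < e).

Definition peak (V : pt -> Prop) (p : pt) : Prop :=
  V p /\ exists f r, entire f /\ 0 < r /\
    forall q, V q -> q <> p -> cdist N q p < r -> Cmod (f q) < Cmod (f p).

Lemma pcompact_closed_ball V p r : tame V -> inCN N p -> pcompact N (fun x => V x /\ cdist N x p <= r).
Proof.
  intros (H1 & H2 & _) Hp. apply (closed_bounded_pcompact N _ (r + cnorm N p)).
  - intros z [Hz _]. now apply H1.
  - intros z [_ Hz]. rewrite <- (padd_psub p z). eapply Rle_trans; [apply cnorm_padd|].
    unfold cdist in Hz. lra.
  - intros u l Hu Hl Hc. split; [apply (H2 u l); [intro; apply Hu|exact Hl|exact Hc]|].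
    apply le_epsilon. intros e He. destruct (pcvg_eps N _ _ Hc e He) as [n Hn].
    specialize (Hn n (Nat.le_refl n)). eapply Rle_trans; [apply (cdist_triangle N l (u n) p)|].
    rewrite (cdist_sym N l). generalize (proj2 (Hu n)). lra.
Qed.

Lemma pcompact_subset (A B : pt -> Prop) : pcompact N A -> (forall z, B z -> A z) ->
  (forall u l, (forall n, B (u n)) -> A l -> pcvg N u l -> B l) -> pcompact N B.
Proof.
  intros [HA1 HA2] HB Hcl. split; [intros z Hz; apply HA1; now apply HB|].
  intros u Hu. destruct (HA2 u) as (phi & l & Hp & Hl & Hc); [intro; now apply HB|].
  exists phi, l. split; [exact Hp|]. split; [|exact Hc].
  apply (Hcl (fun n => u (phi n))); [intro; apply Hu|exact Hl|exact Hc].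
Qed.

Lemma peak_not_isolated V p e : tame V -> peak V p -> 0 < e ->
  exists p', peak V p' /\ p' <> p /\ cdist N p' p < e.
Proof.
  intros HV (Vp & f & r & Hf & Hr & Hpk) He.
  assert (HVin := proj1 HV). assert (Hiso := proj2 (proj2 (proj2 HV))).
  assert (Hp := HVin p Vp).
  (* The sphere of radius r' is the boundary to be avoided: a strict peak on the closed ball that
     lies off the sphere is a local peak of V. *)
  set (r' := Rmin r e / 2).
  assert (B1 := Rmin_l r e). assert (B2 := Rmin_r r e). assert (B3 : 0 < Rmin r e) by now apply Rmin_pos.
  assert (Hr' : 0 < r') by (unfold r'; lra).
  set (A := fun x => V x /\ cdist N x p <= r').
  assert (HA : pcompact N A) by now apply pcompact_closed_ball.
  set (S := fun x => cdist N x p = r').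
  assert (Hfp : 0 < Cmod (f p)).
  { destruct (Hiso p Vp r Hr) as (q & Vq & Hq & Hqd). generalize (Hpk q Vq Hq Hqd) (Cmod_ge_0 (f q)). lra. }
  assert (Hmu0 : exists mu0, mu0 < Cmod (f p) /\ forall s, A s -> S s -> Cmod (f s) <= mu0).
  { destruct (classic (exists s, A s /\ S s)) as [[s0 [As0 Ss0]]|Hno].
    - assert (HAS : pcompact N (fun x => A x /\ S x)).
      { apply (pcompact_subset A); [exact HA|tauto|]. intros u l Hu Al Hc. split; [exact Al|].
        unfold S. apply Rle_antisym; [apply Al|]. apply le_epsilon. intros e0 He0.
        destruct (pcvg_eps N _ _ Hc e0 He0) as [n Hn]. specialize (Hn n (Nat.le_refl n)).
        destruct (Hu n) as [_ Sn]. unfold S in Sn. rewrite <- Sn.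
        eapply Rle_trans; [apply (cdist_triangle N (u n) l p)|]. lra. }
      destruct (pcompact_max N _ (fun x => Cmod (f x)) s0 HAS) as [s [[As Ss] Hs]].
      + apply pcontinuous_Cmod; [apply HAS|exact Hf].
      + now split.
      + exists (Cmod (f s)). split; [|intros; apply Hs; now split].
        apply Hpk; [apply As| |unfold S in Ss; unfold r' in *; lra].
        intros ->. unfold S in Ss. rewrite cdist_refl in Ss. lra.
    - exists 0. split; [exact Hfp|]. intros s As Ss. exfalso. apply Hno. now exists s. }
  destruct Hmu0 as [mu0 [Hmu0 Hmus]].
  (* The second entry makes mu positive, also when V does not meet the sphere or f vanishes on
     it. *)
  set (mu := Rmax mu0 (Cmod (f p) / 2)).
  assert (Hmu1 : 0 < mu < Cmod (f p)).
  { assert (C2 := Rmax_r mu0 (Cmod (f p) / 2)). split; [fold mu in C2; lra|].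
    unfold mu. apply Rmax_lub_lt; lra. }
  destruct (entire_continuous f p Hf Hp (Cmod (f p) - mu) ltac:(lra)) as [d [Hd Hcont]].
  destruct (Hiso p Vp (Rmin d r')) as (q & Vq & Hq & Hqd); [now apply Rmin_pos|].
  assert (B4 := Rmin_l d r'). assert (B5 := Rmin_r d r').
  assert (Hqf : mu < Cmod (f q)).
  { specialize (Hcont q (HVin q Vq) ltac:(lra)).
    assert (Q := Cmod_diff_le (f q) (f p)). apply Rabs_le_between in Q. lra. }
  assert (Hex : exists i, (i < N)%nat /\ q i <> p i).
  { apply NNPP; intro Hno. apply Hq. apply functional_extensionality; intro j.
    destruct (Nat.le_gt_cases N j) as [Hj|Hj].
    - now rewrite (HVin q Vq j Hj), (Hp j Hj).
    - apply NNPP; intro. apply Hno. now exists j. }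
  destruct Hex as (i & Hi & Hqi).
  set (l := fun z : pt => Cadd (Copp (p i)) (z i)).
  assert (Hl : entire l).
  { apply (entire_add (fun _ => Copp (p i))); [apply entire_const|now apply entire_coord]. }
  destruct (strict_peak_exists A S f l q mu) as (p' & f' & Ap' & Sp' & Hlp' & Hf' & Hpk'); try assumption.
  - split; [exact Vq|lra].
  - unfold l. intro E. apply Hqi. replace (q i) with (Cadd (Cadd (Copp (p i)) (q i)) (p i)) by ring.
    rewrite E. ring.
  - lra.
  - intros s As Ss. eapply Rle_trans; [now apply Hmus|apply Rmax_l].
  - destruct Ap' as [Vp' Hp'd].
    assert (Hlt : cdist N p' p < r') by (destruct Hp'd as [|E]; [assumption|now elim Sp']).
    exists p'. split; [|split].
    + split; [exact Vp'|]. exists f', (r' - cdist N p' p). split; [exact Hf'|]. split; [lra|].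
      intros x Vx Hx Hxd. apply Hpk'; [|exact Hx]. split; [exact Vx|].
      eapply Rle_trans; [apply (cdist_triangle N x p' p)|]. lra.
    + intros ->. apply Hlp'. unfold l. ring.
    + unfold r' in *. lra.
Qed.

Lemma no_peak V p : tame V -> ~ peak V p.
Proof.
  intros HV Hpk. assert (HVin := proj1 HV).
  destruct (proj1 (proj2 (proj2 HV)) p (proj1 Hpk)) as (r & k & g & Hr & Hg & HVg).
  destruct (holomorphic_disc N N (seq 0 N) (peak V) p r g k)
    as (p' & i & gam & r' & Hp' & Hp'd & Hr' & Hi & Hg0 & Hgam).
  { rewrite length_seq. lia. } { exact below_seq. } { exact Hr. } { exact Hpk. }
  { intros z [Vz _]. apply supp_seq. now apply HVin. }
  { intros z Hz e He. destruct (peak_not_isolated V z e HV Hz He) as (z' & H1 & H2 & H3). now exists z'. }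
  { exact Hg. }
  { intros z j [Vz _] Hzd Hj. apply (HVg z); [now apply HVin|exact Hzd|exact Vz|exact Hj]. }
  destruct Hp' as (Vp' & f & rp & Hf & Hrp & Hfpk).
  assert (Hzin : supp [i] pzero /\ cnorm N pzero < r') by (split; [apply supp_zero|now rewrite cnorm_pzero]).
  (* The N coordinate errors rp / (N + 1) add up to less than rp, so the disc stays where the peak
     inequality holds. *)
  destruct (finite_delta N [i] (fun j h => Cmod (Csub (gam h j) (p' j)) <= rp / (INR N + 1)) N) as [d [Hd Hdd]].
  { intros j Hj. destruct (Hgam pzero (proj1 Hzin) (proj2 Hzin)) as (_ & _ & _ & _ & Hc).
    destruct (Hc j Hj) as [c Hcj].
    destruct (hderiv_continuous N [i] _ pzero c (supp_zero _) Hcj (rp / (INR N + 1))) as [d [Hd H]].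
    { apply Rdiv_lt_0_compat; [lra|generalize (pos_INR N); lra]. }
    exists d. split; [exact Hd|]. intros h Hh Hhn. rewrite <- Hg0. apply H; [exact Hh|].
    unfold cdist. replace (psub h pzero) with h; [exact Hhn|].
    apply functional_extensionality; intro; unfold psub, pzero; ring. }
  assert (Hnear : forall h, supp [i] h -> cnorm N h < d -> cdist N (gam h) p' < rp).
  { intros h Hh Hhn. eapply Rle_lt_trans; [apply cnorm_le_sum|].
    apply Rle_lt_trans with (sumR (fun _ => rp / (INR N + 1)) N).
    - apply sumR_le. intros j Hj. now apply Hdd.
    - rewrite sumR_const. assert (PN := pos_INR N).
      assert (0 < rp / (INR N + 1)) by (apply Rdiv_lt_0_compat; lra).
      assert (E : (INR N + 1) * (rp / (INR N + 1)) = rp) by (field; lra). lra. }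
  set (R0 := Rmin r' d). assert (HR0 : 0 < R0) by now apply Rmin_pos.
  assert (B1 := Rmin_l r' d). assert (B2 := Rmin_r r' d). fold R0 in B1, B2.
  set (e := punit i).
  assert (He : supp [i] e) by (apply supp_unit; now left).
  assert (Hline : forall s, Cmod s < R0 -> supp [i] (pscal s e) /\ cnorm N (pscal s e) < R0).
  { intros s Hs. split; [now apply supp_scal|]. eapply Rle_lt_trans; [apply cnorm_punit_le|exact Hs]. }
  apply (strict_maximum_principle (fun s => f (gam (padd pzero (pscal s e)))) R0 HR0).
  - intros s Hs. replace (Csub s C0) with s in Hs by ring. destruct (Hline s Hs) as [H1 H2].
    assert (Ez : padd pzero (pscal s e) = pscal s e).
    { apply functional_extensionality; intro; unfold padd, pzero; ring. }
    destruct (Hgam (pscal s e) H1 ltac:(lra)) as (G1 & _ & _ & _ & G5).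
    destruct (hderiv_comp_ex N (seq 0 N) [i] f gam (pscal s e) (r' - cnorm N (pscal s e))) as [c Hc].
    + lra.
    + intros h Hh Hhn. apply supp_sub; [|exact G1]. apply Hgam; [now apply supp_add|].
      eapply Rle_lt_trans; [apply cnorm_padd|]. lra.
    + exact G5.
    + apply Hf. now apply supp_seq.
    + rewrite <- Ez in Hc. eexists. exact (hderiv_line N [i] (fun u => f (gam u)) pzero e s c He Hc).
  - intros s Hs.
    assert (Ez : forall t, padd pzero (pscal t e) = pscal t e).
    { intro t; apply functional_extensionality; intro; unfold padd, pzero; ring. }
    rewrite !Ez, pscal_0, Hg0. destruct (Hline s (proj2 Hs)) as [H1 H2].
    destruct (Hgam (pscal s e) H1 ltac:(lra)) as (G1 & G2 & G3 & G4 & _).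
    apply Hfpk.
    + apply HVg; [now apply supp_seq|exact G2|exact G3].
    + apply G4. intro E. apply (f_equal (fun z : pt => Cmod (z i))) in E.
      unfold pscal, e, punit, pzero in E. destruct Nat.eq_dec; [|contradiction].
      rewrite Cmod_mul, Cmod_C1, Cmod_C0 in E. lra.
    + apply Hnear; [exact H1|lra].
Qed.

(** * Level sets of the distance and the maximum principle *)

Definition near (K : pt -> Prop) (d : R) (x : pt) : Prop :=
  inCN N x /\ exists k, K k /\ cdist N x k <= d.
(** The set where the distance to K equals d, stated without an infimum: the upper bound is attained
    at a point of K, the lower bound holds against all of K. *)
Definition level (K : pt -> Prop) (d : R) (x : pt) : Prop :=
  near K d x /\ forall k, K k -> d <= cdist N x k.

Lemma pcompact_bounded (K : pt -> Prop) : pcompact N K -> exists M, forall z, K z -> cnorm N z <= M.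
Proof.
  intro HK. destruct (classic (exists z, K z)) as [[z0 Hz0]|Hno].
  - destruct (pcompact_max N K (cnorm N) z0 HK) as [m [_ Hm]]; [|exact Hz0|now exists (cnorm N m)].
    intros l _ eps He. exists eps. split; [exact He|]. intros w _ Hw.
    assert (Q1 : cnorm N w <= cnorm N l + cdist N w l).
    { rewrite <- (padd_psub l w) at 1. apply cnorm_padd. }
    assert (Q2 : cnorm N l <= cnorm N w + cdist N w l).
    { rewrite cdist_sym. rewrite <- (padd_psub w l) at 1. apply cnorm_padd. }
    apply Rabs_def1; lra.
  - exists 0. intros z Hz. exfalso. apply Hno. now exists z.
Qed.

Lemma pcompact_near K d : pcompact N K -> pcompact N (near K d).
Proof.
  intro HK. destruct (pcompact_bounded K HK) as [M HM].
  apply (closed_bounded_pcompact N _ (d + M)).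
  - now intros z [Hz _].
  - intros z [_ [k [Hk Hd]]]. rewrite <- (padd_psub k z). eapply Rle_trans; [apply cnorm_padd|].
    specialize (HM k Hk). unfold cdist in Hd. lra.
  - intros u l Hu Hl Hc. split; [exact Hl|].
    set (kk := fun n => epsilon (inhabits pzero) (fun k => K k /\ cdist N (u n) k <= d)).
    assert (Hkk : forall n, K (kk n) /\ cdist N (u n) (kk n) <= d).
    { intro n. destruct (Hu n) as [_ Hn]. exact (epsilon_spec (inhabits pzero) _ Hn). }
    destruct (proj2 HK kk) as (phi & k & Hp & Kk & Hck); [intro; apply Hkk|].
    exists k. split; [exact Kk|]. apply le_epsilon. intros e He.
    destruct (pcvg_eps N _ _ Hc (e / 2) ltac:(lra)) as [n1 Hn1].
    destruct (pcvg_eps N _ _ Hck (e / 2) ltac:(lra)) as [n2 Hn2].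
    set (n := (n1 + n2)%nat). assert (Hge := extraction_ge phi Hp n).
    specialize (Hn1 (phi n) ltac:(unfold n in *; lia)). specialize (Hn2 n ltac:(unfold n; lia)).
    cbv beta in Hn2. destruct (Hkk (phi n)) as [_ Hkd].
    eapply Rle_trans; [apply (cdist_triangle N l (u (phi n)) k)|].
    eapply Rle_trans; [apply Rplus_le_compat_l, (cdist_triangle N _ (kk (phi n)) k)|].
    rewrite (cdist_sym N l). lra.
Qed.

Lemma pcompact_level K d : pcompact N K -> pcompact N (level K d).
Proof.
  intro HK. apply (pcompact_subset (near K d)); [now apply pcompact_near|now intros z [Hz _]|].
  intros u l Hu Hl Hc. split; [exact Hl|]. intros k Hk. apply le_epsilon. intros e He.
  destruct (pcvg_eps N _ _ Hc e He) as [n Hn]. specialize (Hn n (Nat.le_refl n)).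
  destruct (Hu n) as [_ Hn2]. specialize (Hn2 k Hk).
  generalize (cdist_triangle N (u n) l k). lra.
Qed.

Lemma coord_form_continuous A a i : (i < N)%nat -> pcontinuous_on N A (fun z => fst (Cmul a (z i))).
Proof.
  intros Hi l _ eps He.
  destruct (small_multiple (Cmod a) (eps / 2) (Cmod_ge_0 a) ltac:(lra)) as [d [Hd H]].
  exists d. split; [exact Hd|]. intros w _ Hw.
  apply Rle_lt_trans with (Cmod (Cmul a (Csub (w i) (l i)))).
  - eapply Rle_trans; [|apply fst_le_Cmod]. right; f_equal. unfold Cmul, Csub; cbn [fst snd]; ring.
  - rewrite Cmod_mul.
    assert (Hwl : cdist N w l < d) by exact Hw.
    assert (Q := coord_le_cdist N w l i Hi).
    specialize (H (Cmod (Csub (w i) (l i))) ltac:(split; [apply Cmod_ge_0|lra])). lra.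
Qed.

(* A variety cannot leave K only through the part of a level set of the distance where the real
   linear form Re (a z_i) is smaller: otherwise |M + a z_i|, for M large, yields a peak point. *)
Lemma escape V K z d a i : tame V -> pcompact N K -> V z -> K z -> 0 < d -> (i < N)%nat ->
  exists q, V q /\ level K d q /\ fst (Cmul a (z i)) <= fst (Cmul a (q i)).
Proof.
  intros HV HK Vz Kz Hd Hi. apply NNPP; intro Hno.
  assert (HVin := proj1 HV).
  set (A := fun x => V x /\ near K d x).
  assert (HA : pcompact N A).
  { apply (pcompact_subset (near K d)); [now apply pcompact_near|now intros x [_ Hx]|].
    intros u l Hu Hl Hc. split; [|exact Hl].
    apply (proj1 (proj2 HV) u l); [intro; apply Hu|apply Hl|exact Hc]. }
  assert (Az : A z).
  { split; [exact Vz|]. split; [now apply HVin|]. exists z. split; [exact Kz|rewrite cdist_refl; lra]. }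
  set (X := fun x : pt => fst (Cmul a (x i))).
  assert (HS : forall s, A s -> level K d s -> X s < X z).
  { intros s [Vs _] Ls. apply Rnot_le_lt; intro. apply Hno. now exists s. }
  assert (Hf : exists f mu, entire f /\ 0 < mu < Cmod (f z) /\ forall s, A s -> level K d s -> Cmod (f s) <= mu).
  { destruct (classic (exists s, A s /\ level K d s)) as [[s0 [As0 Ls0]]|Hnone].
    - assert (HAL : pcompact N (fun x => A x /\ level K d x)).
      { apply (pcompact_subset A); [exact HA|tauto|]. intros u l Hu Al Hc. split; [exact Al|].
        split; [apply Al|]. intros k Hk. apply le_epsilon. intros e He.
        destruct (pcvg_eps N _ _ Hc e He) as [n Hn]. specialize (Hn n (Nat.le_refl n)).
        destruct (Hu n) as [_ [_ Hn2]]. specialize (Hn2 k Hk).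
        generalize (cdist_triangle N (u n) l k). lra. }
      destruct (pcompact_max N _ X s0 HAL (coord_form_continuous _ a i Hi) (conj As0 Ls0)) as [s [[As Ls] Hs]].
      destruct (pcompact_bounded A HA) as [M0 HM0].
      set (Y := Cmod a * Rmax M0 0).
      assert (HY0 : 0 <= Y) by (apply Rmult_le_pos; [apply Cmod_ge_0|apply Rmax_r]).
      assert (HY : forall x, A x -> Cmod (Cmul a (x i)) <= Y).
      { intros x Ax. rewrite Cmod_mul. apply Rmult_le_compat_l; [apply Cmod_ge_0|].
        eapply Rle_trans; [apply (coord_le_cnorm N x i Hi)|]. eapply Rle_trans; [now apply HM0|apply Rmax_l]. }
      set (tau := X z - X s). assert (Htau : 0 < tau) by (unfold tau; generalize (HS s As Ls); lra).
      assert (Hq : 0 < (Y * Y + 1) / tau) by (apply Rdiv_lt_0_compat; nra).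
      (* Replacing M + X z - tau by M + X z raises the square by 2 * tau * (M + X z) - tau^2. For
         this M the gain exceeds Y * Y, the most that the imaginary part contributes on the level
         set; the terms 2 * Y + tau keep the real parts nonnegative. *)
      set (M := 2 * Y + tau + (Y * Y + 1) / tau).
      assert (HXz : - Y <= X z).
      { assert (Q := fst_le_Cmod (Cmul a (z i))). assert (Q2 := HY z Az).
        apply Rabs_le_between in Q. unfold X. lra. }
      set (f := fun x : pt => Cadd (RtoC M) (Cmul a (x i))).
      assert (Hge : M + X z <= Cmod (f z)).
      { eapply Rle_trans; [|apply fst_le_Cmod]. eapply Rle_trans; [|apply Rle_abs].
        unfold f, X, Cadd, RtoC; cbn [fst snd]. lra. }
      set (m2 := (M + X z - tau) * (M + X z - tau) + Y * Y).
      assert (Hm2 : 0 < m2) by (unfold m2, M; nra).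
      exists f, (sqrt m2). split; [|split; [split|]].
      + apply (entire_add (fun _ => RtoC M)); [apply entire_const|].
        apply (entire_mul (fun _ => a)); [apply entire_const|now apply entire_coord].
      + now apply sqrt_lt_R0.
      + eapply Rlt_le_trans; [|exact Hge].
        assert (Hpos : 0 <= M + X z) by (unfold M; lra).
        rewrite <- (sqrt_square (M + X z)) by exact Hpos. apply sqrt_lt_1_alt. split; [lra|].
        unfold m2.
        assert (E : tau * ((Y * Y + 1) / tau) = Y * Y + 1) by (field; lra).
        assert (tau * (M + X z) >= tau * tau + (Y * Y + 1)) by (unfold M; nra). nra.
      + intros x Ax Lx. unfold Cmod at 1. apply sqrt_le_1_alt. unfold m2.
        assert (Hxs : X x <= X z - tau) by (unfold tau; generalize (Hs x (conj Ax Lx)); lra).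
        assert (Q := HY x Ax). assert (Q1 := fst_le_Cmod (Cmul a (x i))). assert (Q2 := snd_le_Cmod (Cmul a (x i))).
        apply Rabs_le_between in Q1. apply Rabs_le_between in Q2.
        unfold f, Cadd, RtoC. cbn [fst snd]. change (fst (Cmul a (x i))) with (X x) in *.
        assert (0 <= M + X x) by (unfold M; lra).
        assert ((M + X x) * (M + X x) <= (M + X z - tau) * (M + X z - tau)) by (apply Rmult_le_compat; lra).
        set (y := snd (Cmul a (x i))) in *. nra.
    (* If V misses the level set within A, any nonzero constant serves, and the strict peak comes
       from the kernel alone. *)
    - exists (fun _ => C1), (/ 2). split; [apply entire_const|]. rewrite Cmod_C1. split; [lra|].
      intros s As Ls. exfalso. apply Hnone. now exists s. }
  destruct Hf as (f & mu & Hf & Hmu & Hfs).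
  destruct (strict_peak_exists A (level K d) f (fun _ => C1) z mu) as (p & f' & Ap & Lp & _ & Hf' & Hpk);
    try assumption.
  - apply entire_const.
  - apply C1_neq_C0.
  - destruct Ap as [Vp Np].
    (* Off the level set p lies at distance less than d from some k in K, so points of V near p
       still belong to A and the peak is a local peak of V. *)
    assert (Hk : exists k, K k /\ cdist N p k < d).
    { apply NNPP; intro Hnk. apply Lp. split; [exact Np|]. intros k Hk.
      apply Rnot_lt_le; intro. apply Hnk. now exists k. }
    destruct Hk as (k & Kk & Hkd).
    apply (no_peak V p HV). split; [exact Vp|]. exists f', (d - cdist N p k).
    split; [exact Hf'|]. split; [lra|]. intros q Vq Hq Hqd. apply Hpk; [|exact Hq].
    split; [exact Vq|]. split; [now apply HVin|]. exists k. split; [exact Kk|].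
    eapply Rle_trans; [apply (cdist_triangle N q p k)|]. lra.
Qed.

(** * Varieties of positive dimension *)

Lemma has_cderiv_hderiv f z c : has_cderiv N f z c -> hderiv N (seq 0 N) f z c.
Proof.
  intros H eps He. destruct (H eps He) as [d [Hd Hf]]. exists d. split; [exact Hd|].
  intros h Hh Hn. apply supp_seq in Hh. destruct (cnorm_ge_0 N h) as [Hp|Hp].
  - apply Hf; [exact Hh|lra].
  - rewrite (cnorm_0_eq N h Hh ltac:(lra)), padd_zero, lin_pzero, cnorm_pzero.
    replace (Csub (Csub (f z) (f z)) C0) with C0 by ring. rewrite Cmod_C0. lra.
Qed.

Lemma holo_on_hol p r f : holo_on N (ball N p r) f -> hol N (seq 0 N) p r f.
Proof.
  intros H z Hz Hd. apply supp_seq in Hz. destruct (H z) as [c Hc]; [now split|exact Hz|].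
  exists c. now apply has_cderiv_hderiv.
Qed.

(** For the absence of isolated points: regular points of dimension N - m > 0 occur arbitrarily near
    p. One that differs from p already suffices; if p itself is regular, m < N independent equations
    have a further common zero nearby. *)
Lemma analytic_pure_codim_tame V m : (m < N)%nat -> analytic_pure_codim N V m -> tame V.
Proof.
  intros Hm ([Hin Hloc] & _ & Hpure).
  assert (Hloc' : forall p, inCN N p -> exists r k (g : nat -> pt -> C), 0 < r /\
     (forall j, (j < k)%nat -> hol N (seq 0 N) p r (g j)) /\
     (forall q, inCN N q -> cdist N q p < r -> (V q <-> forall j, (j < k)%nat -> g j q = C0))).
  { intros p Hp. destruct (Hloc p Hp) as (r & Hr & k & g & Hg & HV). exists r, k, g.
    split; [exact Hr|]. split; [intros j Hj; now apply holo_on_hol, Hg|].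
    intros q Hq Hqd. apply HV. now split. }
  split; [exact Hin|]. split; [|split].
  (* Local equations exist around every point of C^N, hence around l before l is known to lie in V;
     by continuity they vanish at l. *)
  - intros u l Hu Hl Hc. destruct (Hloc' l Hl) as (r & k & g & Hr & Hg & HV).
    apply HV; [exact Hl|now rewrite cdist_refl|]. intros j Hj. apply Cmod_eq_0, le_epsilon. intros e He.
    destruct (Hg j Hj l) as [c Hcj]; [now apply supp_seq|now rewrite cdist_refl|].
    destruct (hderiv_continuous N (seq 0 N) (g j) l c ltac:(now apply supp_seq) Hcj e He) as [d [Hd Hcont]].
    destruct (pcvg_eps N _ _ Hc (Rmin r d)) as [n Hn]; [now apply Rmin_pos|].
    specialize (Hn n (Nat.le_refl n)). assert (B1 := Rmin_l r d). assert (B2 := Rmin_r r d).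
    assert (Hun := Hin _ (Hu n)).
    specialize (Hcont (u n) ltac:(now apply supp_seq) ltac:(lra)).
    rewrite (proj1 (HV (u n) Hun ltac:(lra)) (Hu n) j Hj) in Hcont.
    replace (g j l) with (Copp (Csub C0 (g j l))) by ring. rewrite Cmod_opp. lra.
  - intros p Vp. now apply Hloc', Hin.
  - intros p Vp e He. assert (Hp := Hin p Vp).
    destruct (proj2 (Hpure p Vp) e He) as (q & [Hq Hqd] & Hreg).
    destruct (classic (q = p)) as [->|Hne].
    + destruct Hreg as (_ & HdN & r & Hr & g & c & Hg & Hc & Hind & HV).
      assert (Hpb : ball N p r p) by (split; [exact Hp|now rewrite cdist_refl]).
      destruct (regular_zero_not_isolated N (N - (N - m)) (seq 0 N) p r g c) with (e := Rmin e r)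
        as (q & Hqs & Hqp & Hqd' & Hqg).
      * apply seq_NoDup.
      * exact below_seq.
      * rewrite length_seq. lia.
      * now apply supp_seq.
      * exact Hr.
      * intros j Hj. apply holo_on_hol. now apply Hg.
      * intros j Hj. apply has_cderiv_hderiv. now apply Hc.
      * now apply HV.
      * intros a Ha. apply Hind. intros i Hi. apply Ha. apply in_seq. lia.
      * now apply Rmin_pos.
      * assert (B1 := Rmin_l e r). assert (B2 := Rmin_r e r). apply supp_seq in Hqs.
        exists q. split; [|split; [exact Hqp|lra]]. apply HV; [split; [exact Hqs|lra]|exact Hqg].
    + exists q. split; [apply Hreg|]. split; assumption.
Qed.

End Peaks.

(** * The Cantor set *)

(** The latest letter comes first, so that passing from n to S n descends to a child in the tree. *)
Fixpoint prefix (a : nat -> bool) (n : nat) : list bool :=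
  match n with O => nil | S m => a m :: prefix a m end.

Lemma prefix_length a n : length (prefix a n) = n.
Proof. induction n; simpl; congruence. Qed.

Lemma prefix_ext a b n : (forall k, (k < n)%nat -> a k = b k) -> prefix a n = prefix b n.
Proof.
  induction n as [|n IH]; intro H; simpl; [reflexivity|].
  rewrite H by lia. f_equal. apply IH. intros; apply H; lia.
Qed.

(** * Ternary expansions with digits 0 and 2 *)

Definition digit (a : nat -> bool) (n : nat) : R := (if a n then 2 else 0) / 3 ^ S n.
Definition ternary (a : nat -> bool) (x : R) : Prop := infinite_sum (digit a) x.

Lemma pow3_pos n : 0 < 3 ^ n.
Proof. apply pow_lt; lra. Qed.

Lemma inv_pow3_S n : / 3 ^ n = 3 * / 3 ^ S n.
Proof. simpl. assert (P := pow3_pos n). field. lra. Qed.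

Lemma inv_pow3_le k n : (k <= n)%nat -> / 3 ^ n <= / 3 ^ k.
Proof. intro H. apply Rinv_le_contravar; [apply pow3_pos|]. apply Rle_pow; [lra|exact H]. Qed.

Lemma inv_pow3_small eps : 0 < eps -> exists n, / 3 ^ n < eps.
Proof.
  intro He. destruct (pow_lt_1_zero (/ 3) ltac:(rewrite Rabs_pos_eq; lra) eps He) as [n Hn].
  exists n. specialize (Hn n (Nat.le_refl n)). rewrite pow_inv in Hn.
  rewrite Rabs_pos_eq in Hn; [exact Hn|]. apply Rlt_le, Rinv_0_lt_compat, pow3_pos.
Qed.

Lemma digit_bound a n : 0 <= digit a n /\ digit a n + / 3 ^ S n <= / 3 ^ n.
Proof.
  unfold digit, Rdiv. rewrite (inv_pow3_S n).
  assert (0 < / 3 ^ S n) by apply Rinv_0_lt_compat, pow3_pos.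
  destruct (a n); nra.
Qed.

Lemma sum_f_R0_sumR f n : sum_f_R0 f n = sumR f (S n).
Proof.
  induction n as [|n IH]; [simpl; ring|]. simpl sum_f_R0. rewrite IH. reflexivity.
Qed.

Lemma ternary_partial_sums a n k :
  sumR (digit a) n <= sumR (digit a) (n + k) /\
  sumR (digit a) (n + k) + / 3 ^ (n + k) <= sumR (digit a) n + / 3 ^ n.
Proof.
  induction k as [|k [IH1 IH2]]; [rewrite Nat.add_0_r; lra|].
  rewrite Nat.add_succ_r. simpl sumR. destruct (digit_bound a (n + k)). lra.
Qed.

(** Replaces the series by nested intervals of length 3^-n, from which existence, separation and
    closeness can be read off. *)
Lemma ternary_iff a x : ternary a x <-> forall n, sumR (digit a) n <= x <= sumR (digit a) n + / 3 ^ n.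
Proof.
  split.
  - intros H n. split; apply le_epsilon; intros e He; destruct (H e He) as [n0 Hn0];
      specialize (Hn0 (n0 + n)%nat ltac:(lia)); rewrite sum_f_R0_sumR in Hn0;
      unfold Rdist in Hn0; apply Rabs_def2 in Hn0;
      destruct (ternary_partial_sums a n (S n0)) as [P1 P2];
      replace (n + S n0)%nat with (S (n0 + n)) in P1, P2 by lia.
    + lra.
    + assert (0 < / 3 ^ S (n0 + n)) by apply Rinv_0_lt_compat, pow3_pos. lra.
  - intros H e He. destruct (inv_pow3_small e He) as [n0 Hn0]. exists n0. intros n Hn.
    rewrite sum_f_R0_sumR. unfold Rdist. specialize (H (S n)).
    assert (Q := inv_pow3_le n0 (S n) ltac:(lia)). apply Rabs_def1; lra.
Qed.

Lemma ternary_exists a : exists x, ternary a x.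
Proof.
  destruct (nested_intervals (fun n => sumR (digit a) n) (fun n => / 3 ^ n)) as [x Hx].
  - intro n. apply Rlt_le, Rinv_0_lt_compat, pow3_pos.
  - intro n. simpl. destruct (digit_bound a n). lra.
  - intro n. simpl sumR. destruct (digit_bound a n). lra.
  - exists x. now apply ternary_iff.
Qed.

(** At the first differing digit k the partial sums differ by 2 / 3^(k+1) while the tails differ by
    at most 1 / 3^(k+1). A gap of at least 1 / 3^(k+1) remains, too large when k < n. *)
Lemma ternary_digits a b x y n : ternary a x -> ternary b y -> Rabs (x - y) < / 3 ^ n ->
  forall k, (k < n)%nat -> a k = b k.
Proof.
  intros Ha Hb Hxy. apply Rabs_def2 in Hxy.
  assert (K : forall a b x y k, ternary a x -> ternary b y -> (forall j, (j < k)%nat -> a j = b j) ->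
     a k = true -> b k = false -> / 3 ^ S k <= x - y).
  { clear. intros a b x y k Ha Hb Hag Hak Hbk.
    apply (proj1 (ternary_iff a x)) with (n := S k) in Ha.
    apply (proj1 (ternary_iff b y)) with (n := S k) in Hb.
    assert (Ea : digit a k = 2 * / 3 ^ S k) by (unfold digit; rewrite Hak; reflexivity).
    assert (Eb : digit b k = 0) by (unfold digit; rewrite Hbk; unfold Rdiv; ring).
    simpl sumR in Ha, Hb. rewrite Ea in Ha. rewrite Eb in Hb.
    rewrite (sumR_ext (digit a) (digit b)) in Ha by (intros j Hj; unfold digit; now rewrite Hag).
    lra. }
  induction k as [k IH] using lt_wf_ind. intro Hk.
  assert (Hag : forall j, (j < k)%nat -> a j = b j) by (intros j Hj; apply IH; lia).
  assert (Q := inv_pow3_le (S k) n ltac:(lia)).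
  destruct (a k) eqn:Ea; destruct (b k) eqn:Eb; try reflexivity; exfalso.
  - specialize (K a b x y k Ha Hb Hag Ea Eb). lra.
  - specialize (K b a y x k Hb Ha ltac:(intros; symmetry; auto) Eb Ea). lra.
Qed.

Lemma ternary_close a b x y n : ternary a x -> ternary b y -> (forall k, (k < n)%nat -> a k = b k) ->
  Rabs (x - y) <= / 3 ^ n.
Proof.
  intros Ha Hb Hag. apply (proj1 (ternary_iff a x)) with (n := n) in Ha.
  apply (proj1 (ternary_iff b y)) with (n := n) in Hb.
  rewrite (sumR_ext (digit a) (digit b)) in Ha by (intros j Hj; unfold digit; now rewrite Hag).
  apply Rabs_le. lra.
Qed.

(** * The binary tree of compact sets *)

Section Tree.
Context (N : nat) (e0 : R).
Context (HN : (1 <= N)%nat) (He0 : 0 < e0).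

(* [form n] runs cyclically through the 2N real coordinates: Re(-i z) = Im z. *)
Definition form_index (n : nat) : nat := ((n mod (2 * N)) / 2)%nat.
Definition form_coef (n : nat) : C := if Nat.even (n mod (2 * N)) then C1 else (0, -1).
Definition form (n : nat) (z : pt) : R := fst (Cmul (form_coef n) (z (form_index n))).

Lemma form_index_lt n : (form_index n < N)%nat.
Proof.
  unfold form_index. apply Nat.Div0.div_lt_upper_bound. apply Nat.mod_upper_bound. lia.
Qed.

Lemma form_coef_unit n : Cmul (form_coef n) (Cconj (form_coef n)) = C1.
Proof.
  unfold form_coef. destruct Nat.even; unfold Cmul, Cconj, C1; cbn [fst snd]; f_equal; ring.
Qed.

Lemma form_coef_mod n : Cmod (form_coef n) = 1.
Proof.
  assert (H := f_equal Cmod (form_coef_unit n)). rewrite Cmod_mul, Cmod_conj, Cmod_C1 in H.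
  generalize (Cmod_ge_0 (form_coef n)). nra.
Qed.

Lemma form_diff n x y : form n x - form n y <= cdist N x y.
Proof.
  apply Rle_trans with (fst (Cmul (form_coef n) (Csub (x (form_index n)) (y (form_index n))))).
  - right. unfold form, Cmul, Csub; cbn [fst snd]. ring.
  - eapply Rle_trans; [apply Rle_abs|]. eapply Rle_trans; [apply fst_le_Cmod|].
    rewrite Cmod_mul, form_coef_mod, Rmult_1_l. apply coord_le_cdist, form_index_lt.
Qed.

Lemma cdist_le_forms x y w : (forall j, (j < 2 * N)%nat -> Rabs (form j x - form j y) <= w) ->
  cdist N x y <= 2 * INR N * w.
Proof.
  intro H. eapply Rle_trans; [apply cnorm_le_sum|].
  apply Rle_trans with (sumR (fun _ => 2 * w) N); [|rewrite sumR_const; lra].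
  apply sumR_le. intros i Hi. eapply Rle_trans; [apply Cmod_le_abs|].
  assert (H1 := H (2 * i)%nat ltac:(lia)). assert (H2 := H (2 * i + 1)%nat ltac:(lia)).
  unfold form, form_coef, form_index in H1, H2. rewrite !Nat.mod_small in H1, H2 by lia.
  replace ((2 * i) / 2)%nat with i in H1 by (symmetry; rewrite Nat.mul_comm; apply Nat.div_mul; lia).
  replace ((2 * i + 1) / 2)%nat with i in H2.
  2:{ rewrite Nat.mul_comm, Nat.div_add_l by lia. simpl. lia. }
  rewrite Nat.even_mul in H1. rewrite Nat.even_add, Nat.even_mul in H2. simpl in H1, H2.
  unfold Cmul, C1 in H1, H2. cbn [fst snd] in H1, H2. unfold psub, Csub; cbn [fst snd].
  replace (1 * fst (x i) - 0 * snd (x i) - (1 * fst (y i) - 0 * snd (y i)))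
    with (fst (x i) - fst (y i)) in H1 by ring.
  replace (0 * fst (x i) - -1 * snd (x i) - (0 * fst (y i) - -1 * snd (y i)))
    with (snd (x i) - snd (y i)) in H2 by ring. lra.
Qed.

(** In units of the scale at level n, the children lie at distances 1/4 and 1/2 from K, with collars
    of radius 1/16. Hence collars stay in the collar of the parent, as 1/2 + 1/16 <= 1, and sibling
    collars are 1/2 - 1/4 - 2/16 = 1/8 apart. *)
Definition scale (n : nat) : R := e0 / 16 ^ n.

Lemma scale_pos n : 0 < scale n.
Proof. apply Rdiv_lt_0_compat; [exact He0|apply pow_lt; lra]. Qed.

Lemma scale_S n : scale (S n) = scale n / 16.
Proof. unfold scale. simpl. field. apply pow_nonzero; lra. Qed.

Lemma scale_le k n : (k <= n)%nat -> scale n <= scale k.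
Proof.
  induction 1 as [|n _ IH]; [lra|]. rewrite scale_S. generalize (scale_pos n). lra.
Qed.

Definition is_mid (n : nat) (K : pt -> Prop) (m : R) : Prop :=
  exists p q, K p /\ K q /\ (forall k, K k -> form n p <= form n k <= form n q) /\
    m = (form n p + form n q) / 2.
Definition mid (n : nat) (K : pt -> Prop) : R := epsilon (inhabits 0) (is_mid n K).

Lemma mid_spec n K : pcompact N K -> (exists k, K k) -> is_mid n K (mid n K).
Proof.
  intros HK [k Kk]. unfold mid. apply epsilon_spec.
  assert (Hc : forall a, pcontinuous_on N K (fun z => fst (Cmul a (z (form_index n))))).
  { intro a. apply coord_form_continuous, form_index_lt. }
  destruct (pcompact_max N K _ k HK (Hc (form_coef n)) Kk) as [q [Kq Hq]].
  destruct (pcompact_max N K _ k HK (Hc (Copp (form_coef n))) Kk) as [p [Kp Hp]].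
  exists ((form n p + form n q) / 2), p, q. split; [exact Kp|]. split; [exact Kq|]. split; [|reflexivity].
  intros x Kx. split; [|now apply Hq]. specialize (Hp x Kx). cbv beta in Hp.
  unfold form. unfold Cmul, Copp in *. cbn [fst snd] in *. lra.
Qed.

(** The two different distances from K separate the children even where the form equals [mid]; the
    conditions on the form cut its range roughly in half. *)
Definition child (b : bool) (n : nat) (K : pt -> Prop) (x : pt) : Prop :=
  if b then level N K (scale n / 2) x /\ form n x <= mid n K
  else level N K (scale n / 4) x /\ mid n K <= form n x.

Fixpoint node (s : list bool) : pt -> Prop :=
  match s with
  | nil => fun x => inCN N x /\ cnorm N x <= 1
  | b :: s' => child b (length s') (node s')
  end.

(** Nodes are not nested: each child lies off its parent. Their collars are nested, and these define
    the limit set. *)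
Definition cell (s : list bool) : pt -> Prop := near N (node s) (scale (length s)).

Lemma cnorm_cdist z : cnorm N z = cdist N z pzero.
Proof.
  unfold cdist. f_equal. apply functional_extensionality; intro; unfold psub, pzero; ring.
Qed.

Lemma child_near b n K x : child b n K x -> near N K (scale n / 2) x.
Proof.
  destruct b; intros [[Hx _] _]; [exact Hx|]. destruct Hx as [H1 [k [Kk Hk]]].
  split; [exact H1|]. exists k. split; [exact Kk|]. generalize (scale_pos n). lra.
Qed.

Lemma child_pcompact b n K : pcompact N K -> pcompact N (child b n K).
Proof.
  intro HK. destruct b.
  - apply (pcompact_subset N (level N K (scale n / 2))); [now apply pcompact_level|now intros z [Hz _]|].
    intros u l Hu Hl Hc. split; [exact Hl|]. apply le_epsilon. intros e He.
    destruct (pcvg_eps N _ _ Hc e He) as [m Hm]. specialize (Hm m (Nat.le_refl m)).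
    destruct (Hu m) as [_ Hum]. assert (Q := form_diff n l (u m)). rewrite cdist_sym in Q. lra.
  - apply (pcompact_subset N (level N K (scale n / 4))); [now apply pcompact_level|now intros z [Hz _]|].
    intros u l Hu Hl Hc. split; [exact Hl|]. apply le_epsilon. intros e He.
    destruct (pcvg_eps N _ _ Hc e He) as [m Hm]. specialize (Hm m (Nat.le_refl m)).
    destruct (Hu m) as [_ Hum]. assert (Q := form_diff n (u m) l). lra.
Qed.

Lemma form_shift n p t : exists x, (inCN N p -> inCN N x) /\ form n x = form n p + t /\ cdist N x p <= Rabs t.
Proof.
  set (w := Cmul (RtoC t) (Cconj (form_coef n))).
  exists (padd p (pscal w (punit (form_index n)))). split; [|split].
  - intros Hp i Hi. unfold padd, pscal, punit. rewrite (Hp i Hi).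
    destruct Nat.eq_dec as [->|]; [generalize (form_index_lt n); lia|ring].
  - unfold form at 1. unfold padd, pscal, punit. destruct Nat.eq_dec as [_|]; [|contradiction].
    assert (E := form_coef_unit n).
    replace (Cmul (form_coef n) (Cadd (p (form_index n)) (Cmul w C1)))
      with (Cadd (Cmul (form_coef n) (p (form_index n))) (Cmul (RtoC t) (Cmul (form_coef n) (Cconj (form_coef n)))))
      by (unfold w; ring).
    rewrite E. unfold form, Cadd, RtoC, C1. unfold Cmul at 2. cbn [fst snd]. ring.
  - rewrite cdist_padd. eapply Rle_trans; [apply cnorm_punit_le|].
    unfold w. rewrite Cmod_mul, Cmod_RtoC, Cmod_conj, form_coef_mod. lra.
Qed.

(** Push an extremal point of the form outward by the required distance. The form is 1-Lipschitz and
    changes by the full amount, so no point of K is closer than the starting point. *)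
Lemma child_nonempty b n K : pcompact N K -> (exists k, K k) -> exists x, child b n K x.
Proof.
  intros HK Hk. destruct (mid_spec n K HK Hk) as (p & q & Kp & Kq & Hpq & Hm).
  assert (Ps := scale_pos n). assert (Hle := Hpq p Kp). assert (Hin := proj1 HK).
  destruct b.
  - destruct (form_shift n p (- (scale n / 2))) as (x & Hx & Hf & Hd).
    rewrite Rabs_Ropp, Rabs_pos_eq in Hd by lra.
    exists x. split; [split|].
    + split; [apply Hx, Hin, Kp|]. exists p. now split.
    + intros k Kk. assert (Q := form_diff n k x). rewrite cdist_sym in Q. specialize (Hpq k Kk). lra.
    + lra.
  - destruct (form_shift n q (scale n / 4)) as (x & Hx & Hf & Hd). rewrite Rabs_pos_eq in Hd by lra.
    exists x. split; [split|].
    + split; [apply Hx, Hin, Kq|]. exists q. now split.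
    + intros k Kk. assert (Q := form_diff n x k). specialize (Hpq k Kk). lra.
    + lra.
Qed.

Lemma node_pcompact s : pcompact N (node s).
Proof.
  induction s as [|b s IH]; [|now apply child_pcompact].
  apply (closed_bounded_pcompact N _ 1); [now intros z []|now intros z []|].
  intros u l Hu Hl Hc. split; [exact Hl|]. apply le_epsilon. intros e He.
  destruct (pcvg_eps N _ _ Hc e He) as [m Hm]. specialize (Hm m (Nat.le_refl m)).
  destruct (Hu m) as [_ Hum]. rewrite cnorm_cdist in Hum |- *.
  eapply Rle_trans; [apply (cdist_triangle N l (u m))|]. rewrite (cdist_sym N l). lra.
Qed.

Lemma node_nonempty s : exists x, node s x.
Proof.
  induction s as [|b s IH].
  - exists pzero. split; [now intros i _|]. rewrite cnorm_pzero. lra.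
  - apply child_nonempty; [apply node_pcompact|exact IH].
Qed.

Lemma node_inCN s x : node s x -> inCN N x.
Proof. apply (proj1 (node_pcompact s)). Qed.

Lemma node_cell s x : node s x -> cell s x.
Proof.
  intro H. split; [now apply (node_inCN s)|]. exists x. split; [exact H|].
  rewrite cdist_refl. apply Rlt_le, scale_pos.
Qed.

Lemma cell_pcompact s : pcompact N (cell s).
Proof. apply pcompact_near, node_pcompact. Qed.

Lemma cell_parent b s x : cell (b :: s) x -> cell s x.
Proof.
  intros [Hx [k [Kk Hk]]]. destruct (child_near b _ _ _ Kk) as [_ [k' [Kk' Hk']]].
  split; [exact Hx|]. exists k'. split; [exact Kk'|]. simpl length in Hk. rewrite scale_S in Hk.
  assert (P := scale_pos (length s)).
  eapply Rle_trans; [apply (cdist_triangle N x k k')|]. lra.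
Qed.

Lemma cell_separated s x y : cell (true :: s) x -> cell (false :: s) y -> scale (length s) / 8 <= cdist N x y.
Proof.
  intros [_ [k [[[_ Hlev] _] Hk]]] [_ [k' [[[[_ [c [Kc Hc]]] _] _] Hk']]].
  specialize (Hlev c Kc). simpl length in Hk, Hk'. rewrite scale_S in Hk, Hk'.
  assert (P := scale_pos (length s)).
  assert (Q1 := cdist_triangle N k x c). assert (Q2 := cdist_triangle N x y c).
  assert (Q3 := cdist_triangle N y k' c). rewrite (cdist_sym N k x) in Q1. lra.
Qed.

Definition width_le (j : nat) (K : pt -> Prop) (w : R) : Prop :=
  forall x y, K x -> K y -> form j x - form j y <= w.

Lemma child_width b n j K w : width_le j K w -> width_le j (child b n K) (w + scale n).
Proof.
  intros Hw x y Hx Hy. destruct (child_near _ _ _ _ Hx) as [_ [k [Kk Hk]]].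
  destruct (child_near _ _ _ _ Hy) as [_ [k' [Kk' Hk']]].
  assert (Q1 := form_diff j x k). assert (Q2 := form_diff j k' y). rewrite cdist_sym in Q2.
  specialize (Hw k k' Kk Kk'). lra.
Qed.

Lemma child_width_split b n K w : pcompact N K -> (exists k, K k) ->
  width_le n K w -> width_le n (child b n K) (w / 2 + scale n / 2).
Proof.
  intros HK Hne Hw x y Hx Hy.
  destruct (mid_spec n K HK Hne) as (p & q & Kp & Kq & Hpq & Hm).
  assert (Hwqp := Hw q p Kq Kp).
  destruct (child_near _ _ _ _ Hx) as [_ [k [Kk Hk]]].
  destruct (child_near _ _ _ _ Hy) as [_ [k' [Kk' Hk']]].
  assert (Q1 := form_diff n x k). assert (Q2 := form_diff n k' y). rewrite cdist_sym in Q2.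
  assert (R1 := Hpq k Kk). assert (R2 := Hpq k' Kk').
  destruct b; destruct Hx as [_ Hx]; destruct Hy as [_ Hy]; lra.
Qed.

(** A bound for the range of form j on a node at depth n, enlarged by twice the scale. It shrinks
    exactly at the levels where the cycle reaches form j. The initial value is the range 2 on the
    unit ball plus 2 * scale 0. *)
Fixpoint width_bound (j n : nat) : R :=
  match n with
  | O => 2 + 2 * e0
  | S m => if Nat.eq_dec (m mod (2 * N)) (j mod (2 * N)) then 3 / 4 * width_bound j m else width_bound j m
  end.

Lemma width_bound_pos j n : 0 < width_bound j n.
Proof. induction n as [|n IH]; simpl; [lra|]. destruct Nat.eq_dec; lra. Qed.

Lemma width_bound_decr j n k : width_bound j (n + k) <= width_bound j n.
Proof.
  induction k as [|k IH]; [rewrite Nat.add_0_r; lra|]. rewrite Nat.add_succ_r.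
  assert (P := width_bound_pos j (n + k)). simpl. destruct Nat.eq_dec; lra.
Qed.

Lemma form_mod_eq n j x : n mod (2 * N) = j mod (2 * N) -> form n x = form j x.
Proof. intro E. unfold form, form_coef, form_index. now rewrite E. Qed.

(** The subtracted 2 * scale pays for thickening: a child widens a range by at most one scale s, and
    w - 2 s + s <= w - 2 (s / 16). At a splitting level w / 2 - s / 2 is below 3 w / 4 - s / 8. *)
Lemma node_width j s : width_le j (node s) (width_bound j (length s) - 2 * scale (length s)).
Proof.
  induction s as [|b s IH].
  - intros x y [Hx Hx1] [Hy Hy1]. simpl. unfold scale; simpl.
    rewrite cnorm_cdist in Hx1, Hy1. assert (Q := form_diff j x y).
    assert (Q2 := cdist_triangle N x pzero y). rewrite (cdist_sym N pzero) in Q2. lra.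
  - set (n := length s) in *. assert (Ps := scale_pos n). assert (Pw := width_bound_pos j n).
    simpl length. fold n. rewrite scale_S. simpl node. fold n. simpl width_bound.
    destruct Nat.eq_dec as [E|E].
    + assert (IH' : width_le n (node s) (width_bound j n - 2 * scale n)).
      { intros x y Hx Hy. rewrite !(form_mod_eq n j) by exact E. now apply IH. }
      intros x y Hx Hy.
      assert (Q := child_width_split b n _ _ (node_pcompact s) (node_nonempty s) IH' x y Hx Hy).
      rewrite !(form_mod_eq n j) in Q by exact E. lra.
    + intros x y Hx Hy. assert (Q := child_width b n j _ _ IH x y Hx Hy). lra.
Qed.

(** Each block of 2 N consecutive levels contains one at which form j is split. *)
Lemma width_bound_geometric j m : (j < 2 * N)%nat ->
  width_bound j (2 * N * m) <= (3 / 4) ^ m * (2 + 2 * e0).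
Proof.
  intro Hj. induction m as [|m IH]; [rewrite Nat.mul_0_r; simpl; lra|].
  replace (2 * N * S m)%nat with (S (2 * N * m + j) + (2 * N - j - 1))%nat by lia.
  eapply Rle_trans; [apply width_bound_decr|]. simpl width_bound.
  assert (E : ((2 * N * m + j) mod (2 * N) = j mod (2 * N))%nat).
  { rewrite Nat.add_comm, Nat.mul_comm. apply Nat.Div0.mod_add. }
  change (N + (N + 0))%nat with (2 * N)%nat.
  destruct (Nat.eq_dec ((2 * N * m + j) mod (2 * N)) (j mod (2 * N))) as [_|Hn]; [|contradiction].
  assert (Q := width_bound_decr j (2 * N * m) j). simpl pow. lra.
Qed.

Lemma cell_small eps : 0 < eps -> exists n, forall s x y, length s = n -> cell s x -> cell s y -> cdist N x y < eps.
Proof.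
  intro He.
  (* The first term bounds the diameter of a node through its 2 N forms, the second adds the collars
     at both ends. *)
  set (B := 2 * INR N * (2 + 2 * e0) + 2 * e0).
  assert (PN : 1 <= INR N) by (apply (le_INR 1); exact HN).
  assert (HB : 0 < B) by (unfold B; nra).
  destruct (pow_lt_1_zero (3 / 4) ltac:(rewrite Rabs_pos_eq; lra) (eps / B)) as [m Hm];
    [apply Rdiv_lt_0_compat; lra|].
  specialize (Hm m (Nat.le_refl m)). rewrite Rabs_pos_eq in Hm by (apply pow_le; lra).
  exists (2 * N * m)%nat. intros s x y Hs [_ [k [Kk Hk]]] [_ [k' [Kk' Hk']]]. rewrite Hs in Hk, Hk'.
  set (n := (2 * N * m)%nat) in *. set (t := (3 / 4) ^ m) in *.
  assert (Ht : 0 <= t) by (apply pow_le; lra).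
  assert (Hsc : scale n <= t * e0).
  { unfold scale, t, Rdiv at 1. rewrite Rmult_comm. apply Rmult_le_compat_r; [lra|].
    rewrite <- pow_inv. apply Rle_trans with ((/ 16) ^ m).
    - unfold n. replace (2 * N * m)%nat with (m + (2 * N - 1) * m)%nat by nia. rewrite pow_add.
      rewrite <- (Rmult_1_r ((/ 16) ^ m)) at 2. apply Rmult_le_compat_l; [apply pow_le; lra|].
      rewrite <- (pow1 ((2 * N - 1) * m)). apply pow_incr. lra.
    - apply pow_incr; lra. }
  assert (Hkk : cdist N k k' <= 2 * INR N * (t * (2 + 2 * e0))).
  { apply cdist_le_forms. intros j Hj. assert (Q := width_bound_geometric j m Hj). fold n t in Q.
    assert (W := node_width j s). rewrite Hs in W. assert (Ps := scale_pos n).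
    assert (W1 := W k k' Kk Kk'). assert (W2 := W k' k Kk' Kk). apply Rabs_le. lra. }
  assert (Hfin : t * B < eps).
  { apply (Rmult_lt_compat_r B) in Hm; [|exact HB].
    replace (eps / B * B) with eps in Hm by (field; lra). exact Hm. }
  assert (Q1 := cdist_triangle N x k y). assert (Q2 := cdist_triangle N k k' y).
  rewrite (cdist_sym N k' y) in Q2. unfold B in Hfin. lra.
Qed.

(** * The limit set and its coding by binary sequences *)

Definition on_branch (a : nat -> bool) (x : pt) : Prop := forall n, cell (prefix a n) x.
Definition limit_set (x : pt) : Prop := exists a, on_branch a x.

Lemma on_branch_ext a b x : (forall k, a k = b k) -> on_branch a x -> on_branch b x.
Proof. intros E H n. rewrite <- (prefix_ext a b n) by auto. apply H. Qed.

Lemma on_branch_inCN a x : on_branch a x -> inCN N x.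
Proof. intro H. apply (H 0%nat). Qed.

Lemma on_branch_unique a x y : on_branch a x -> on_branch a y -> x = y.
Proof.
  intros Hx Hy. apply (cdist_0_eq N); [now apply (on_branch_inCN a)|now apply (on_branch_inCN a)|].
  apply le_epsilon. intros e He. destruct (cell_small e He) as [n Hn].
  specialize (Hn (prefix a n) x y (prefix_length a n) (Hx n) (Hy n)). lra.
Qed.

(** At the first disagreement the points would lie in sibling cells, which are at least a scale / 8
    apart. This is the analogue in the tree of [ternary_digits]. *)
Lemma on_branch_agree a b x y n : on_branch a x -> on_branch b y -> cdist N x y < scale n / 8 ->
  forall k, (k <= n)%nat -> a k = b k.
Proof.
  intros Ha Hb Hd. induction k as [k IH] using lt_wf_ind. intro Hk.
  assert (Hp : prefix a k = prefix b k) by (apply prefix_ext; intros j Hj; apply IH; lia).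
  assert (Hak := Ha (S k)). assert (Hbk := Hb (S k)). simpl in Hak, Hbk. rewrite <- Hp in Hbk.
  assert (Q := scale_le k n Hk).
  destruct (a k); destruct (b k); try reflexivity; exfalso.
  - assert (S1 := cell_separated _ _ _ Hak Hbk). rewrite prefix_length in S1. lra.
  - assert (S1 := cell_separated _ _ _ Hbk Hak). rewrite prefix_length, cdist_sym in S1. lra.
Qed.

Lemma node_prefix_cell a n m x : (m <= n)%nat -> node (prefix a n) x -> cell (prefix a m) x.
Proof.
  intros Hm Hx. apply node_cell in Hx.
  induction Hm as [|n Hm IH]; [exact Hx|]. apply IH. now apply (cell_parent (a n)).
Qed.

(** For each m the later terms of the subsequence lie in the compact cell of depth m, so their limit
    lies in it as well. Leaving [u] free yields both the existence of branch points and, for [u] in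
    V, branch points in V. *)
Lemma branch_limit a (u : nat -> pt) : (forall n, node (prefix a n) (u n)) ->
  exists phi l, extraction phi /\ pcvg N (fun n => u (phi n)) l /\ on_branch a l.
Proof.
  intro Hu.
  destruct (proj2 (cell_pcompact nil) u) as (phi & l & Hp & Hl & Hc).
  { intro n. apply (node_prefix_cell a n 0 (u n) ltac:(lia)), Hu. }
  exists phi, l. split; [exact Hp|]. split; [exact Hc|]. intro m.
  destruct (proj2 (cell_pcompact (prefix a m)) (fun n => u (phi (m + n)%nat))) as (psi & l' & Hp' & Hl' & Hc').
  { intro n. apply (node_prefix_cell a (phi (m + n)%nat)); [|apply Hu].
    generalize (extraction_ge phi Hp (m + n)%nat). lia. }
  replace l with l'; [exact Hl'|]. apply (cdist_0_eq N); [apply Hl'|apply Hl|].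
  apply le_epsilon. intros e He.
  destruct (pcvg_eps N _ _ Hc (e / 2) ltac:(lra)) as [n1 Hn1].
  destruct (pcvg_eps N _ _ Hc' (e / 2) ltac:(lra)) as [n2 Hn2].
  set (n := (n1 + n2)%nat). assert (Hge := extraction_ge psi Hp' n).
  specialize (Hn1 (m + psi n)%nat ltac:(unfold n in *; lia)). specialize (Hn2 n ltac:(unfold n; lia)).
  cbv beta in Hn1, Hn2. assert (Q := cdist_triangle N l' (u (phi (m + psi n)%nat)) l).
  rewrite (cdist_sym N l' (u _)) in Q. lra.
Qed.

Lemma on_branch_exists a : exists x, on_branch a x.
Proof.
  destruct (branch_limit a (fun n => epsilon (inhabits pzero) (node (prefix a n)))) as (_ & l & _ & _ & Hl).
  - intro n. apply epsilon_spec, node_nonempty.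
  - now exists l.
Qed.

(** Both sides are coded by binary sequences, branches on one and ternary digits on the other. On
    each side close points share long prefixes and long common prefixes force closeness, so matching
    codes is a homeomorphism. *)
Lemma limit_set_cantor : cantor_set N limit_set.
Proof.
  split; [intros z [a Ha]; now apply (on_branch_inCN a)|].
  set (br := fun z => epsilon (inhabits (fun _ : nat => true)) (fun a => on_branch a z)).
  assert (Hbr : forall z, limit_set z -> on_branch (br z) z).
  { intros z Hz. exact (epsilon_spec (inhabits (fun _ : nat => true)) _ Hz). }
  set (f := fun z => epsilon (inhabits 0) (ternary (br z))).
  assert (Hf : forall z, ternary (br z) (f z)) by (intro z; apply epsilon_spec, ternary_exists).
  set (dg := fun t => epsilon (inhabits (fun _ : nat => true)) (fun a => ternary a t)).
  assert (Hdg : forall t, cantor_ternary t -> ternary (dg t) t).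
  { intros t Ht. exact (epsilon_spec (inhabits (fun _ : nat => true)) _ Ht). }
  set (g := fun t => epsilon (inhabits pzero) (on_branch (dg t))).
  assert (Hg : forall t, on_branch (dg t) (g t)) by (intro t; apply epsilon_spec, on_branch_exists).
  assert (Hfc : forall z, cantor_ternary (f z)) by (intro z; exists (br z); apply Hf).
  assert (Hgc : forall t, limit_set (g t)) by (intro t; exists (dg t); apply Hg).
  assert (P3 : forall n, 0 < / 3 ^ n) by (intro; apply Rinv_0_lt_compat, pow3_pos).
  exists f, g. repeat split.
  - intros z _. apply Hfc.
  - intros t _. apply Hgc.
  - intros z Hz. apply (on_branch_unique (br z)); [|now apply Hbr].
    apply (on_branch_ext (dg (f z))); [|apply Hg]. intro k.
    apply (ternary_digits _ _ (f z) (f z) (S k)); [now apply Hdg|apply Hf| |lia].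
    rewrite Rminus_diag, Rabs_R0. apply P3.
  - intros t Ht. assert (Hag : forall k, br (g t) k = dg t k).
    { intro k. apply (on_branch_agree _ _ (g t) (g t) k); [now apply Hbr|apply Hg| |lia].
      rewrite cdist_refl. generalize (scale_pos k). lra. }
    apply Rminus_diag_uniq. destruct (Req_dec (f (g t) - t) 0) as [E|E]; [exact E|exfalso].
    apply Rabs_pos_lt in E. destruct (inv_pow3_small _ E) as [n Hn].
    assert (Q := ternary_close _ _ (f (g t)) t n (Hf (g t)) (Hdg t Ht) ltac:(intros; apply Hag)). lra.
  - intros z Hz eps He. destruct (inv_pow3_small eps He) as [n Hn].
    exists (scale n / 8). split; [generalize (scale_pos n); lra|]. intros w Hw Hwz.
    eapply Rle_lt_trans; [|apply Hn]. apply (ternary_close (br w) (br z)); [apply Hf|apply Hf|].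
    intros k Hk. apply (on_branch_agree _ _ w z n); [now apply Hbr|now apply Hbr|exact Hwz|lia].
  - intros t Ht eps He. destruct (cell_small eps He) as [n Hn].
    exists (/ 3 ^ n). split; [apply P3|]. intros s Hs Hst.
    apply (Hn (prefix (dg t) n)); [apply prefix_length| |apply Hg].
    rewrite <- (prefix_ext (dg s) (dg t) n); [apply Hg|].
    apply (ternary_digits _ _ s t n); [now apply Hdg|now apply Hdg|exact Hst].
Qed.

(** Depth 1 decides: e0 / 4 - e0 / 16 > 0 keeps the point off the unit ball, and e0 / 2 + e0 / 16 <
    e0 keeps it within the outer radius. *)
Lemma limit_set_shell x : limit_set x -> 1 < cnorm N x < 1 + e0.
Proof.
  intros [a Ha]. destruct (Ha 1%nat) as [Hx [k [Kk Hk]]]. simpl in Hk, Kk.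
  change 1%nat with (S 0) in Hk. rewrite scale_S in Hk.
  assert (E0 : scale 0 = e0) by (unfold scale; simpl; field). rewrite E0 in Hk.
  destruct (child_near _ _ _ _ Kk) as [_ [c [[Hc Hc1] Hkc]]]. rewrite E0 in Hkc.
  rewrite cnorm_cdist in Hc1 |- *. split.
  - apply Rnot_le_lt. intro Hle.
    assert (Hlev : e0 / 4 <= cdist N k x).
    { assert (Bx : inCN N x /\ cnorm N x <= 1) by (split; [exact Hx|rewrite cnorm_cdist; exact Hle]).
      destruct (a 0%nat); destruct Kk as [[_ Hl] _]; specialize (Hl x Bx); rewrite E0 in Hl; lra. }
    rewrite cdist_sym in Hlev. lra.
  - assert (Q1 := cdist_triangle N x k pzero). assert (Q2 := cdist_triangle N k c pzero). lra.
Qed.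

(** The side of [mid] on which z lies selects the child. [escape] moves z to the prescribed distance
    without crossing back; on the lower side it is applied to the negated form. *)
Lemma tame_meets_child V s z : tame N V -> V z -> node s z -> exists b q, V q /\ node (b :: s) q.
Proof.
  intros HV Vz Hz. set (n := length s). assert (Ps := scale_pos n).
  destruct (Rle_lt_dec (form n z) (mid n (node s))) as [H|H].
  - destruct (escape N V (node s) z (scale n / 2) (Copp (form_coef n)) (form_index n))
      as (q & Vq & Lq & Hq); try assumption; [apply node_pcompact|lra|apply form_index_lt|].
    exists true, q. split; [exact Vq|]. split; [exact Lq|].
    assert (form n q <= form n z); [|fold n; lra].
    unfold form. unfold Cmul, Copp in *. cbn [fst snd] in *. lra.
  - destruct (escape N V (node s) z (scale n / 4) (form_coef n) (form_index n))
      as (q & Vq & Lq & Hq); try assumption; [apply node_pcompact|lra|apply form_index_lt|].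
    exists false, q. split; [exact Vq|]. split; [exact Lq|]. fold n. unfold form in *. lra.
Qed.

Lemma tame_meets_limit_set V z : tame N V -> V z -> cnorm N z <= 1 -> exists x, V x /\ limit_set x.
Proof.
  intros HV Vz Hz.
  destruct (dependent_choice (fun n (t : list bool * pt) => length (fst t) = n /\ V (snd t) /\ node (fst t) (snd t))
    (fun n t t' => exists b, fst t' = b :: fst t) (nil, z)) as [u [Hu0 Hu]].
  - split; [reflexivity|]. split; [exact Vz|]. split; [|exact Hz]. now apply (proj1 HV).
  - intros n [s y]; cbn [fst snd]. intros (Hs & Vy & Hy).
    destruct (tame_meets_child V s y HV Vy Hy) as (b & q & Vq & Hq).
    exists (b :: s, q). cbn [fst snd]. split; [|now exists b].
    split; [simpl; now f_equal|]. now split.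
  (* The branch is read off the heads of the growing words; these are nonempty, so the default
     [true] never occurs. The points of V along it need not approach z, but a limit of a subsequence
     lies in V because V is closed. *)
  - set (a := fun n => hd true (fst (u (S n)))).
    assert (Hpre : forall n, prefix a n = fst (u n)).
    { induction n as [|n IH]; [now rewrite Hu0|]. simpl. rewrite IH. unfold a.
      destruct (proj2 (Hu n)) as [b Hb]. now rewrite Hb. }
    destruct (branch_limit a (fun n => snd (u n))) as (phi & l & Hp & Hc & Hl).
    { intro n. rewrite Hpre. apply Hu. }
    exists l. split; [|now exists a].
    apply (proj1 (proj2 HV) (fun n => snd (u (phi n)))); [intro; apply Hu|now apply (on_branch_inCN a)|exact Hc].
Qed.

End Tree.

Theorem theorem6p1 (N : nat) (rho : R) :
  (2 <= N)%nat -> 1 < rho ->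
  exists X : pt -> Prop,
    cantor_set N X /\
    (forall z, X z -> 1 < cnorm N z < rho) /\
    (forall z, inCN N z -> cnorm N z <= 1 -> rational_hull N (N - 1) X z).
Proof.
  intros HN Hrho.
  assert (HN1 : (1 <= N)%nat) by lia. assert (He : 0 < rho - 1) by lra.
  exists (limit_set N (rho - 1)). split; [now apply limit_set_cantor|]. split.
  - intros z Hz. apply limit_set_shell in Hz; [lra|exact He].
  - intros z Hz Hz1. split; [exact Hz|]. intros V m Hm HV Vz.
    apply (tame_meets_limit_set N (rho - 1) HN1 He V z); [|exact Vz|exact Hz1].
    (* From m <= N - 1 it follows that m < N, so V has positive dimension. *)
    apply (analytic_pure_codim_tame N V m); [lia|exact HV].
Qed.
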